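(* For every nonzero real number $x$, $$\left.\frac{\partial \mathrm{Wi}_{\alpha,\beta}(x)}{\partial\beta}\right|_{\alpha=\beta=1}=\frac x2\left[{}_3F_4\left(1,1,1;\,2,2,2,2;\,x\right)-\ln x\;{}_2F_3\left(1,1;\,2,2,2;\,x\right)\right]+\frac12\,G^{3,0}_{1,3}\left(x\,\middle|\,{1\atop 0,0,0}\right)$$ $$-\frac14\ln x\,(\ln x+4\gamma)-\gamma^2-\frac{\pi^2}{12}.$$
   Context: The integral Wright function is $\mathrm{Wi}_{\alpha,\beta}(x)=\sum_{k=1}^\infty\frac{x^k}{k\,k!\,\Gamma(\alpha k+\beta)}$ (with $1/\Gamma=0$ at the poles of $\Gamma$), so that $\frac{\partial \mathrm{Wi}_{\alpha,\beta}(x)}{\partial\beta}=-\sum_{k=1}^\infty\frac{\psi(\alpha k+\beta)}{k\,k!\,\Gamma(\alpha k+\beta)}x^k$, with $\psi=\Gamma'/\Gamma$ the digamma function. $\gamma$ is the Euler-Mascheroni constant; ${}_pF_q(a_1,\dots,a_p;b_1,\dots,b_q;z)$ is the generalized hypergeometric function. $G^{m,n}_{p,q}$ is the Meijer G-function (NIST Handbook convention); in the case at hand $G^{3,0}_{1,3}\left(x\,\middle|\,{1\atop 0,0,0}\right)=\frac{1}{2\pi i}\int_{c-i\infty}^{c+i\infty}\frac{\Gamma(-s)^3}{\Gamma(1-s)}\,x^{s}\,ds$ with $c<0$, for $x>0$, and its analytic continuation along the principal branch for $x<0$. For $x<0$, $\ln x$ denotes the principal branch. *)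

(* Defs.v *)
From Stdlib Require Import Reals Factorial List ClassicalEpsilon.
From Coquelicot Require Import Coquelicot.
Import ListNotations.
Open Scope R_scope.

Definition Clim_seq (u : nat -> C) : C :=
  (real (Lim_seq (fun n => Re (u n))), real (Lim_seq (fun n => Im (u n)))).

Definition Cexp (z : C) : C := (exp (Re z) * cos (Im z), exp (Re z) * sin (Im z)).

(* Principal argument, with values in (-PI, PI]; arbitrary at z = 0. *)
Definition Carg (z : C) : R :=
  if Rle_dec 0 (Im z) then acos (Re z / Cmod z) else - acos (Re z / Cmod z).

Definition Cln (z : C) : C := (ln (Cmod z), Carg z).

Definition Cpower (z s : C) : C := Cexp (s * Cln z)%C.

Fixpoint Crising (z : C) (n : nat) : C :=
  match n with
  | O => 1%C
  | S k => (Crising z k * (z + INR k))%C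
  end.

(* Euler's limit Gamma(z) = lim n! n^z / (z (z+1) ... (z+n)), written for 1/Gamma:
   the limit then exists for every complex z, with value 0 at z = 0, -1, -2, ... *)
Definition rGamma (z : C) : C :=
  Clim_seq (fun n => Crising z (S n) / (INR (fact n) * Cpower (INR n) z))%C.

(* Meaningful only off the poles 0, -1, -2, ... *)
Definition Gamma (z : C) : C := (/ rGamma z)%C.

Definition euler_gamma : R :=
  real (Lim_seq (fun n => sum_n_m (fun k => / INR k) 1 n - ln (INR n))).

Definition Wi (alpha beta x : R) : R :=
  Series (fun j => let k := S j in
    x ^ k / (INR k * INR (fact k)) * Re (rGamma (alpha * INR k + beta)%R)).

Fixpoint rising (a : R) (n : nat) : R :=
  match n with
  | O => 1
  | S k => rising a k * (a + INR k)
  end.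

Definition pFq (a b : list R) (z : R) : R :=
  Series (fun k =>
    fold_right Rmult 1 (map (fun t => rising t k) a) /
    fold_right Rmult 1 (map (fun t => rising t k) b) * z ^ k / INR (fact k)).

Definition Cprod (l : list C) : C := fold_right Cmult 1%C l.

(* Integrand of G^{m,n}_{p,q}(z | a; b) in the NIST convention,
   with p = length a and q = length b. *)
Definition meijer_integrand (m n : nat) (a b : list C) (z s : C) : C :=
  (Cprod (map (fun t => Gamma (t - s)) (firstn m b)) *
   Cprod (map (fun t => Gamma (1 - t + s)) (firstn n a)) *
   Cprod (map (fun t => rGamma (1 - t + s)) (skipn m b)) *
   Cprod (map (fun t => rGamma (t - s)) (skipn n a)) *
   Cpower z s)%C.

Definition Canalytic_at (f : C -> C) (z0 : C) : Prop :=
  exists (a : nat -> C) (r : R), 0 < r /\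
    forall z : C, Cmod (z - z0)%C < r ->
      is_pseries (K := C_AbsRing) (V := C_NormedModule) a (z - z0)%C (f z).

Definition slit_plane (z : C) : Prop := ~ (Im z = 0 /\ Re z <= 0).

(* g is the principal branch of the G-function given for x > 0 by the integral
   (1 / (2 i pi)) int_{c - i oo}^{c + i oo}: analytic in the plane cut along
   (-oo, 0], with the values on the cut taken at argument +PI, i.e. from above. *)
Definition is_meijerG (m n : nat) (a b : list C) (c : R) (g : C -> C) : Prop :=
  (forall x : R, 0 < x ->
    is_RInt_gen (V := C_R_NormedModule)
      (fun t : R => (meijer_integrand m n a b x (c + Ci * t) * Ci)%C)
      (Rbar_locally m_infty) (Rbar_locally p_infty)
      (2 * PI * Ci * g (RtoC x))%C) /\
  (forall z : C, slit_plane z -> Canalytic_at g z) /\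
  (forall x : R, x < 0 ->
    filterlim g (within (fun z : C => 0 < Im z) (locally (RtoC x)))
      (locally (g (RtoC x)))).

(* The conditions above determine g on C \ {0}.  The contour being the vertical
   line Re s = c, this is the Meijer G-function when p < q, p + q < 2 (m + n),
   and the line has the poles of the Gamma (b_j - s) on its right and those of
   the Gamma (1 - a_j + s) on its left. *)
Definition meijerG (m n : nat) (a b : list C) (c : R) : C -> C :=
  epsilon (inhabits (fun _ : C => RtoC 0)) (is_meijerG m n a b c).

(* Main.v *)
Require Import Defs.
From Stdlib Require Import Reals Factorial List Lra Lia Psatz ClassicalEpsilon.
From Coquelicot Require Import Coquelicot.
Import ListNotations.
Open Scope R_scope.

(** Put u = - s.  Since Gamma (1 + u) = u Gamma u, the Mellin-Barnes integral is,
    for x > 0,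

      G(x) = (1 / (2 i pi)) int Gamma(u)^2 / u * x^(-u) du   along  Re u = - c > 0,

    and closing the contour to the left produces one residue at each u = - k.  The
    double poles at k >= 1 give, for H_k the harmonic numbers and L = ln x,

      sum_k x^k / (k k!^2) * (L + 2 gamma - 2 H_k - 1 / k),

    and the triple pole at 0 gives (2 gamma + L)^2 / 2 + pi^2 / 6.  On the other side
    the derivative of 1 / Gamma (k + beta) at beta = 1 is (gamma - H_k) / k!, so that
    the derivative of Wi is sum_k x^k / (k k!^2) * (gamma - H_k).  Comparing the two
    gives the formula for x > 0; the remaining sums, with summands x^k / (k k!^2) and
    x^k / (k^2 k!^2), are the two hypergeometric series.

    The contour is never moved for Gamma itself.  Euler's products

      n! n^u / (u (u + 1) ... (u + n))

    converge to Gamma, and their squares divided by u are rational functions times an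
    exponential.  These have an explicit partial fraction expansion
    ([partial_fractions]), and the integral of each term is elementary ([PV_ker]); the
    result is a finite sum of residues ([PV_sqG]).  When n grows, the
    residue sums converge to the series above ([res_sum_cv], by dominated convergence
    for series and the value of the sum of the inverse squares, [harm2_cv]), while the
    integrals converge to G because the products converge with an error
    O(1 / (n |u|^2)) on the line ([eulerG_cv_unif]).  This is [mellin_barnes].

    For x < 0 the closed form, read with the principal logarithm, is analytic on the
    slit plane and continuous up to the cut from above, so it is an admissible
    G-function ([Gclosed_is_meijerG]).  Any other one has the same values on the
    positive half-line, hence on the slit plane ([identity_theorem]), hence by
    continuity on the cut ([meijerG_unique]).  So the formula extends to x < 0 with
    the same computation. *)

(** Put u = - s.  Since Gamma (1 + u) = u Gamma u, the Mellin-Barnes integral is,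
    for x > 0,

      G(x) = (1 / (2 i pi)) int Gamma(u)^2 / u * x^(-u) du   along  Re u = - c > 0,

    and closing the contour to the left produces one residue at each u = - k.  The
    double poles at k >= 1 give, for H_k the harmonic numbers and L = ln x,

      sum_k x^k / (k k!^2) * (L + 2 gamma - 2 H_k - 1 / k),

    and the triple pole at 0 gives (2 gamma + L)^2 / 2 + pi^2 / 6.  On the other side
    the derivative of 1 / Gamma (k + beta) at beta = 1 is (gamma - H_k) / k!, so that
    the derivative of Wi is sum_k x^k / (k k!^2) * (gamma - H_k).  Comparing the two
    gives the formula for x > 0; the remaining sums, with summands x^k / (k k!^2) and
    x^k / (k^2 k!^2), are the two hypergeometric series.

    The contour is never moved for Gamma itself.  Euler's products

      n! n^u / (u (u + 1) ... (u + n))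

    converge to Gamma, and their squares divided by u are rational functions times an
    exponential.  These have an explicit partial fraction expansion
    ([partial_fractions]), and the integral of each term is elementary ([PV_ker]); the
    result is a finite sum of residues ([PV_sqG]).  When n grows, the
    residue sums converge to the series above ([res_sum_cv], by dominated convergence
    for series and the value of the sum of the inverse squares, [harm2_cv]), while the
    integrals converge to G because the products converge with an error
    O(1 / (n |u|^2)) on the line ([eulerG_cv_unif]).  This is [mellin_barnes].

    For x < 0 the closed form, read with the principal logarithm, is analytic on the
    slit plane and continuous up to the cut from above, so it is an admissible
    G-function ([Gclosed_is_meijerG]).  Any other one has the same values on the
    positive half-line, hence on the slit plane ([identity_theorem]), hence by
    continuity on the cut ([meijerG_unique]).  So the formula extends to x < 0 with
    the same computation. *)

Ltac toR := match goal with |- @eq _ ?x ?y => change (@eq R x y) end.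

Ltac toC := match goal with |- @eq _ ?x ?y => change (@eq C x y) end.

(** * The complex exponential and complex sequences *)

(** Derivatives, integrals and series leave equations typed in the carrier of a normed
    module; [ring] and [field] need them in [R] or [C]. *)


Lemma ex_derive_continuous_R (f : R -> R) x : ex_derive f x -> continuous f x.
Proof. apply (ex_derive_continuous (V := R_NormedModule)). Qed.
Lemma exp_le_compat x y : x <= y -> exp x <= exp y.
Proof. intros [L|L]. left; apply exp_increasing; auto. rewrite L; lra. Qed.
Lemma INR_ge_1 n : (1 <= n)%nat -> 1 <= INR n.
Proof. intros Hn. apply (le_INR 1), Hn. Qed.
Lemma INR_S_ge_1 n : 1 <= INR (S n).
Proof. apply INR_ge_1. lia. Qed.
Lemma INR_S_neq_0 n : INR (S n) <> 0.
Proof. apply not_0_INR. lia. Qed.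
Lemma inv_INR_S n : 0 < / INR (S n) <= 1.
Proof.
  assert (Hn := INR_S_ge_1 n). split; [apply Rinv_0_lt_compat; lra|]. rewrite <- Rinv_1. apply Rinv_le_contravar; lra.
Qed.

Lemma Cexp_plus (a b : C) : Cexp (a + b)%C = (Cexp a * Cexp b)%C.
Proof.
  unfold Cexp. destruct a as [a1 a2], b as [b1 b2]; simpl.
  rewrite exp_plus, cos_plus, sin_plus. unfold Cmult; simpl. f_equal; ring.
Qed.
Lemma Cexp_RtoC (a : R) : Cexp (RtoC a) = RtoC (exp a).
Proof. unfold Cexp, RtoC; simpl. rewrite cos_0, sin_0. f_equal; ring. Qed.
Lemma Cmod_Cexp (a : C) : Cmod (Cexp a) = exp (Re a).
Proof.
  unfold Cmod, Cexp; simpl.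
  replace (_ + _) with (exp (Re a) ^ 2).
  rewrite sqrt_pow2; auto. left; apply exp_pos.
  generalize (sin2_cos2 (Im a)). unfold Rsqr. intros H.
  transitivity (exp (Re a) ^ 2 * (sin (Im a) * sin (Im a) + cos (Im a) * cos (Im a))). rewrite H; ring. ring.
Qed.
Lemma Cexp_neq_0 a : Cexp a <> 0%C.
Proof. apply Cmod_gt_0. rewrite Cmod_Cexp. apply exp_pos. Qed.
Lemma Cexp_inv a : (/ Cexp a)%C = Cexp (- a).
Proof.
  assert (H : (Cexp a * Cexp (- a) = 1)%C).
  { rewrite <- Cexp_plus. replace (a + - a)%C with (RtoC 0) by ring. rewrite Cexp_RtoC, exp_0. reflexivity. }
  generalize (Cexp_neq_0 a). intros Ha.
  transitivity (/ Cexp a * (Cexp a * Cexp (- a)))%C. rewrite H; ring. field. auto.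
Qed.

Lemma im_le_Cmod (z : C) : Rabs (Im z) <= Cmod z.
Proof. eapply Rle_trans; [|apply Rmax_Cmod]. apply Rmax_r. Qed.
Lemma Cmod_le_re_im (z : C) : Cmod z <= Rabs (Re z) + Rabs (Im z).
Proof.
  replace z with (RtoC (Re z) + Ci * RtoC (Im z))%C at 1.
  2:{ destruct z; unfold RtoC, Cplus, Cmult, Ci, Re, Im; simpl. f_equal; ring. }
  eapply Rle_trans. apply Cmod_triangle. rewrite Cmod_mult, !Cmod_R.
  replace (Cmod Ci) with 1. lra. unfold Cmod, Ci; simpl. rewrite <- sqrt_1 at 1. f_equal. ring.
Qed.
Lemma Cmod_sqr (z : C) : Cmod z ^ 2 = Re z ^ 2 + Im z ^ 2.
Proof. unfold Cmod. rewrite pow2_sqrt. reflexivity. generalize (pow2_ge_0 (fst z)) (pow2_ge_0 (snd z)); unfold Re, Im; lra. Qed.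
Lemma RtoC_neq_0 (a : R) : a <> 0 -> RtoC a <> 0%C.
Proof. intros H E. apply H, RtoC_inj, E. Qed.
Lemma Re_RtoC_mult (a : R) (z : C) : Re (RtoC a * z)%C = a * Re z.
Proof. unfold Re, Im; simpl. ring. Qed.
Lemma Im_RtoC_mult (a : R) (z : C) : Im (RtoC a * z)%C = a * Im z.
Proof. unfold Re, Im; simpl. ring. Qed.

(** The elementary bounds below all come from the mean value theorem on the segment
    from 0. *)
Lemma lipschitz_at_0 (f df : R -> R) (K b : R) :
  (forall x, is_derive f x (df x)) -> (forall x, Rabs x <= Rabs b -> Rabs (df x) <= K) ->
  Rabs (f b - f 0) <= K * Rabs b.
Proof.
  intros Hd HK.
  destruct (MVT_gen f 0 b df) as [c [Hc1 Hc2]].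
  - intros; apply Hd.
  - intros; apply continuity_pt_filterlim. apply (ex_derive_continuous f). eexists; apply Hd.
  - rewrite Hc2, Rabs_mult, Rminus_0_r. apply Rmult_le_compat_r. apply Rabs_pos. apply HK.
    unfold Rmin, Rmax in Hc1. destruct (Rle_dec 0 b).
    rewrite !Rabs_pos_eq; lra. rewrite !Rabs_left1; lra.
Qed.

Lemma exp_minus_1_bound a : Rabs (exp a - 1) <= exp (Rabs a) * Rabs a.
Proof.
  rewrite <- exp_0 at 1. apply (lipschitz_at_0 exp exp). apply is_derive_exp.
  intros x Hx. rewrite Rabs_pos_eq by (left; apply exp_pos).
  apply exp_le_compat. eapply Rle_trans; [apply Rle_abs|auto].
Qed.
Lemma exp_taylor1 a : Rabs (exp a - 1 - a) <= exp (Rabs a) * Rabs a * Rabs a.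
Proof.
  replace (exp a - 1 - a) with ((fun a => exp a - 1 - a) a - (fun a => exp a - 1 - a) 0).
  2:{ rewrite exp_0. ring. }
  apply (lipschitz_at_0 (fun a => exp a - 1 - a) (fun x => exp x - 1)). intros x; auto_derive; auto. ring.
  intros x Hx. eapply Rle_trans. apply exp_minus_1_bound.
  apply Rmult_le_compat; auto. left; apply exp_pos. apply Rabs_pos.
  apply exp_le_compat, Hx.
Qed.
Lemma Rabs_sin_le b : Rabs (sin b) <= Rabs b.
Proof.
  replace (sin b) with (sin b - sin 0) by (rewrite sin_0; ring).
  rewrite <- (Rmult_1_l (Rabs b)). apply (lipschitz_at_0 sin cos). apply is_derive_sin.
  intros x _. apply Rabs_le. generalize (COS_bound x); lra.
Qed.
Lemma cos_minus_1_bound b : Rabs (cos b - 1) <= Rabs b * Rabs b.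
Proof.
  rewrite <- cos_0 at 1. apply (lipschitz_at_0 cos (fun x => - sin x)). apply is_derive_cos.
  intros x Hx. rewrite Rabs_Ropp. eapply Rle_trans. apply Rabs_sin_le. auto.
Qed.
Lemma cos_minus_1_bound' b : Rabs (cos b - 1) <= Rabs b.
Proof.
  rewrite <- cos_0 at 1. rewrite <- (Rmult_1_l (Rabs b)). apply (lipschitz_at_0 cos (fun x => - sin x)). apply is_derive_cos.
  intros x Hx. rewrite Rabs_Ropp. apply Rabs_le. generalize (SIN_bound x); lra.
Qed.
Lemma sin_minus_bound b : Rabs (sin b - b) <= Rabs b * Rabs b.
Proof.
  replace (sin b - b) with ((fun x => sin x - x) b - (fun x => sin x - x) 0) by (simpl; rewrite sin_0; ring).
  apply (lipschitz_at_0 (fun x => sin x - x) (fun x => cos x - 1)). intros x; auto_derive; auto; ring.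
  intros x Hx. eapply Rle_trans. apply cos_minus_1_bound'. auto.
Qed.

Lemma Cexp_taylor1 (w : C) : Cmod (Cexp w - 1 - w)%C <= 4 * exp (Rabs (Re w)) * Cmod w ^ 2.
Proof.
  set (a := Re w). set (b := Im w). set (E := exp (Rabs a)).
  assert (HE : 1 <= E). { unfold E. rewrite <- exp_0. generalize (exp_ineq1_le (Rabs a)) (Rabs_pos a). rewrite exp_0. lra. }
  assert (Hea : exp a <= E) by apply exp_le_compat, Rle_abs.
  assert (Hw : Cmod w ^ 2 = Rabs a ^ 2 + Rabs b ^ 2) by (rewrite Cmod_sqr, !pow2_abs; reflexivity).
  generalize (exp_taylor1 a) (exp_minus_1_bound a) (cos_minus_1_bound b) (sin_minus_bound b) (Rabs_pos a) (Rabs_pos b) (exp_pos a).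
  fold E. intros H1 H2 H3 H4 Ha Hb Hp.
  assert (R1 : Rabs (Re (Cexp w - 1 - w)%C) <= E * Rabs a ^ 2 + E * Rabs b ^ 2).
  { replace (Re (Cexp w - 1 - w)%C) with ((exp a - 1 - a) + exp a * (cos b - 1)) by (unfold a, b, Cexp, Re, Im; simpl; ring).
    eapply Rle_trans. apply Rabs_triang. rewrite Rabs_mult, (Rabs_pos_eq (exp a)) by lra.
    apply Rplus_le_compat. lra. generalize (Rabs_pos (cos b - 1)). intros.
    apply Rmult_le_compat; lra. }
  assert (R2 : Rabs (Im (Cexp w - 1 - w)%C) <= E * Rabs b ^ 2 + E * Rabs a * Rabs b).
  { replace (Im (Cexp w - 1 - w)%C) with (exp a * (sin b - b) + (exp a - 1) * b) by (unfold a, b, Cexp, Re, Im; simpl; ring).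
    eapply Rle_trans. apply Rabs_triang. rewrite !Rabs_mult, (Rabs_pos_eq (exp a)) by lra.
    generalize (Rabs_pos (sin b - b)). intros.
    apply Rplus_le_compat. apply Rmult_le_compat; lra. apply Rmult_le_compat_r; lra. }
  eapply Rle_trans. apply Cmod_le_re_im. rewrite Hw.
  assert (0 <= (Rabs a - Rabs b) ^ 2) by apply pow2_ge_0. nra.
Qed.

(** Convergence is taken componentwise because [Clim_seq], and hence [rGamma], is. *)
Definition Ccv (u : nat -> C) (l : C) :=
  is_lim_seq (fun n => Re (u n)) (Re l) /\ is_lim_seq (fun n => Im (u n)) (Im l).

Lemma Ccv_ext_loc u v l : (exists N, forall n, (N <= n)%nat -> u n = v n) -> Ccv u l -> Ccv v l.
Proof.
  intros [N HN] [H1 H2]. split.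
  apply (is_lim_seq_ext_loc (fun n => Re (u n))); auto. exists N; intros; rewrite HN; auto.
  apply (is_lim_seq_ext_loc (fun n => Im (u n))); auto. exists N; intros; rewrite HN; auto.
Qed.
Lemma Ccv_ext u v l : (forall n, u n = v n) -> Ccv u l -> Ccv v l.
Proof. intros H. apply Ccv_ext_loc. exists 0%nat; auto. Qed.
Lemma Ccv_const l : Ccv (fun _ => l) l.
Proof. split; apply is_lim_seq_const. Qed.
Lemma Ccv_plus u v l m : Ccv u l -> Ccv v m -> Ccv (fun n => u n + v n)%C (l + m)%C.
Proof.
  intros [H1 H2] [H3 H4]. split; simpl.
  apply (is_lim_seq_plus' _ _ _ _ H1 H3). apply (is_lim_seq_plus' _ _ _ _ H2 H4).
Qed.
Lemma Ccv_mult u v l m : Ccv u l -> Ccv v m -> Ccv (fun n => u n * v n)%C (l * m)%C.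
Proof.
  intros [H1 H2] [H3 H4]. split; simpl.
  apply (is_lim_seq_minus' _ _ _ _ (is_lim_seq_mult' _ _ _ _ H1 H3) (is_lim_seq_mult' _ _ _ _ H2 H4)).
  apply (is_lim_seq_plus' _ _ _ _ (is_lim_seq_mult' _ _ _ _ H1 H4) (is_lim_seq_mult' _ _ _ _ H2 H3)).
Qed.
Lemma Ccv_unique u l m : Ccv u l -> Ccv u m -> l = m.
Proof.
  intros [H1 H2] [H3 H4].
  apply is_lim_seq_unique in H1, H2, H3, H4. rewrite H1 in H3; rewrite H2 in H4.
  inversion H3; inversion H4. destruct l, m; simpl in *; congruence.
Qed.
Lemma Ccv_Clim u l : Ccv u l -> Clim_seq u = l.
Proof.
  intros [H1 H2]. unfold Clim_seq. apply is_lim_seq_unique in H1, H2. rewrite H1, H2.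
  destruct l; reflexivity.
Qed.
Lemma Ccv_Cmod u l : Ccv u l -> is_lim_seq (fun n => Cmod (u n)) (Cmod l).
Proof.
  intros [H1 H2]. unfold Cmod. apply (is_lim_seq_continuous sqrt).
  apply continuity_pt_sqrt. generalize (pow2_ge_0 (fst l)) (pow2_ge_0 (snd l)); lra.
  simpl. apply is_lim_seq_plus'; apply is_lim_seq_mult'; auto; apply is_lim_seq_mult'; auto; apply is_lim_seq_const.
Qed.
Lemma Ccv_Cmod_le u l B : Ccv u l -> (exists N, forall n, (N <= n)%nat -> Cmod (u n) <= B) -> Cmod l <= B.
Proof.
  intros H [N HN]. apply (is_lim_seq_le_loc (fun n => Cmod (u n)) (fun _ => B) (Cmod l) B).
  exists N; auto. apply Ccv_Cmod; auto. apply is_lim_seq_const.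
Qed.

Lemma increments_telescope (w : nat -> C) (B : R) (N : nat) : (1 <= N)%nat -> 0 <= B ->
  (forall n, (N <= n)%nat -> Cmod (w (S n) - w n)%C <= B / INR n ^ 2) ->
  forall n k, (N <= n)%nat -> Cmod (w (n + k)%nat - w n)%C <= 2 * B * (/ INR n - / INR (n + k)).
Proof.
  intros HN HB H n k Hn. induction k.
  - rewrite Nat.add_0_r. replace (w n - w n)%C with (RtoC 0) by ring. rewrite Cmod_0. lra.
  - replace (w (n + S k)%nat - w n)%C with ((w (n + S k)%nat - w (n + k)%nat) + (w (n + k)%nat - w n))%C by ring.
    eapply Rle_trans. apply Cmod_triangle.
    rewrite Nat.add_succ_r.
    assert (Hk : (N <= n + k)%nat) by lia. specialize (H _ Hk).
    assert (0 < INR (n + k)) by (apply lt_0_INR; lia).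
    assert (B / INR (n + k) ^ 2 <= 2 * B * (/ INR (n + k) - / INR (S (n + k)))).
    { rewrite S_INR. set (p := INR (n + k)) in *.
      assert (1 <= p). { unfold p. replace 1 with (INR 1) by reflexivity. apply le_INR; lia. }
      replace (/ p - / (p + 1)) with (/ (p * (p + 1))) by (field; lra).
      replace (2 * B * / (p * (p + 1))) with (B * (2 * / (p * (p + 1)))) by ring.
      apply Rmult_le_compat_l; auto. replace (2 * / (p * (p + 1))) with (/ (p * (p + 1) / 2)) by (field; lra).
      apply Rinv_le_contravar. nra. nra. }
    lra.
Qed.

Lemma is_lim_seq_inv_INR : is_lim_seq (fun n => / INR n) 0.
Proof. apply (is_lim_seq_inv INR p_infty); [apply is_lim_seq_INR|discriminate]. Qed.
Lemma is_lim_seq_div_INR c : is_lim_seq (fun n => c / INR n) 0.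
Proof.
  replace (Finite 0) with (Rbar_mult c 0) by (simpl; f_equal; ring).
  apply (is_lim_seq_scal_l _ c 0), is_lim_seq_inv_INR.
Qed.

(** Increments O(1 / n^2) are summable, and the tail of their sum is O(1 / n).  The
    explicit rate is what makes the convergence to Gamma uniform on vertical lines. *)
Lemma Ccv_of_increments (w : nat -> C) (B : R) (N : nat) : (1 <= N)%nat -> 0 <= B ->
  (forall n, (N <= n)%nat -> Cmod (w (S n) - w n)%C <= B / INR n ^ 2) ->
  exists l, Ccv w l /\ forall n, (N <= n)%nat -> Cmod (w n - l)%C <= 2 * B / INR n.
Proof.
  intros HN HB H.
  assert (T : forall n m, (N <= n)%nat -> (n <= m)%nat -> Cmod (w m - w n)%C <= 2 * B / INR n).
  { intros n m Hn Hm. replace m with (n + (m - n))%nat by lia. eapply Rle_trans. apply (increments_telescope w B N); auto.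
    unfold Rdiv. apply Rmult_le_compat_l. lra.
    assert (0 < INR (n + (m - n))) by (apply lt_0_INR; lia). apply Rinv_0_lt_compat in H0. lra. }
  assert (Cau : forall eps : posreal, exists K, forall n m, (K <= n)%nat -> (n <= m)%nat -> Cmod (w m - w n)%C < eps).
  { intros eps. destruct (proj1 (is_lim_seq_Reals _ _) (is_lim_seq_div_INR (2 * B)) eps (cond_pos eps)) as [K HK].
    exists (max K N). intros n m Hn Hm. eapply Rle_lt_trans. apply T; lia.
    specialize (HK n ltac:(lia)). unfold Rdist in HK. rewrite Rminus_0_r in HK. eapply Rle_lt_trans. apply Rle_abs. auto. }
  assert (Cau' : forall (p : C -> R), (forall a b, p a - p b = p (a - b)%C) -> (forall a, Rabs (p a) <= Cmod a) ->
     ex_finite_lim_seq (fun n => p (w n))).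
  { intros p Hp1 Hp2. apply ex_lim_seq_cauchy_corr. intros eps. destruct (Cau eps) as [K HK].
    exists K. intros n m Hn Hm. rewrite Hp1. eapply Rle_lt_trans. apply Hp2.
    destruct (Nat.le_ge_cases m n). apply HK; auto.
    replace (w n - w m)%C with (- (w m - w n))%C by ring. rewrite Cmod_opp. apply HK; auto. }
  destruct (Cau' Re) as [l1 H1]; [intros; unfold Re, Im; simpl; ring|apply re_le_Cmod|].
  destruct (Cau' Im) as [l2 H2]; [intros; unfold Re, Im; simpl; ring|apply im_le_Cmod|].
  exists (l1, l2). split. split; auto.
  intros n Hn. replace (w n - (l1, l2))%C with (- ((l1, l2) - w n))%C by ring. rewrite Cmod_opp.
  apply (Ccv_Cmod_le (fun m => w m - w n)%C).
  apply (Ccv_plus w (fun _ => - w n)%C (l1, l2) (- w n)%C). split; auto. apply Ccv_const.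
  exists n; intros; apply T; auto.
Qed.

(** An infinite product of factors 1 + O(1 / n^2) is bounded: 1 + y <= exp y turns it
    into the exponential of a telescoping sum. *)
Lemma prod_bound (a : nat -> R) (B : R) : 0 <= B -> (forall n, 0 <= a n) ->
  (forall n, (1 <= n)%nat -> a (S n) <= a n * (1 + B / INR n ^ 2)) ->
  forall n, (1 <= n)%nat -> a n <= a 1%nat * exp (2 * B).
Proof.
  intros HB Ha H.
  assert (G : forall n, a (S n) <= a 1%nat * exp (2 * B * (1 - / INR (S n)))).
  { induction n. simpl. rewrite Rinv_1. replace (2 * B * (1 - 1)) with 0 by ring. rewrite exp_0; lra.
    eapply Rle_trans. apply H; lia.
    set (p := INR (S n)). assert (1 <= p). { unfold p. rewrite S_INR. generalize (pos_INR n); lra. }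
    assert (E : 1 + B / p ^ 2 <= exp (2 * B * (/ p - / (p + 1)))).
    { eapply Rle_trans; [|apply exp_ineq1_le].
      replace (/ p - / (p + 1)) with (/ (p * (p + 1))) by (field; lra).
      replace (2 * B * / (p * (p + 1))) with (B * (2 * / (p * (p + 1)))) by ring.
      apply Rplus_le_compat_l.
      apply Rmult_le_compat_l; auto. replace (2 * / (p * (p + 1))) with (/ (p * (p + 1) / 2)) by (field; lra).
      apply Rinv_le_contravar. nra. nra. }
    replace (INR (S (S n))) with (p + 1) by (unfold p; rewrite !S_INR; ring).
    replace (2 * B * (1 - / (p + 1))) with (2 * B * (1 - / p) + 2 * B * (/ p - / (p + 1))) by ring.
    rewrite exp_plus, <- Rmult_assoc. apply Rmult_le_compat; auto.
    assert (0 <= B / p ^ 2). { apply Rdiv_le_0_compat; auto. apply pow_lt; lra. } lra. }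
  intros n Hn. destruct n. lia. eapply Rle_trans. apply G. apply Rmult_le_compat_l; auto.
  assert (Hp : 0 < INR (S n)) by (apply lt_0_INR; lia). apply Rinv_0_lt_compat in Hp.
  apply exp_le_compat. nra.
Qed.

Lemma Ccv_of_Cmod u l : is_lim_seq (fun n => Cmod (u n - l)%C) 0 -> Ccv u l.
Proof.
  intros L.
  assert (G : forall p : C -> R, (forall a b, p a - p b = p (a - b)%C) -> (forall a, Rabs (p a) <= Cmod a) ->
     is_lim_seq (fun n => p (u n)) (p l)).
  { intros p P1 P2. apply is_lim_seq_ext with (fun n => (p (u n) - p l) + p l). intros; ring.
    replace (Finite (p l)) with (Finite (0 + p l)) by (f_equal; ring).
    apply is_lim_seq_plus'; [|apply is_lim_seq_const]. apply is_lim_seq_abs_0.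
    apply (is_lim_seq_le_le (fun _ => 0) _ (fun n => Cmod (u n - l)%C)); auto; [|apply is_lim_seq_const].
    intros n. split. apply Rabs_pos. rewrite P1. apply P2. }
  split; apply G; [|apply re_le_Cmod| |apply im_le_Cmod]; intros; unfold Re, Im; simpl; ring.
Qed.

(** * Harmonic numbers and Euler's constant *)

Lemma ln_ge x : 0 < x -> 1 - / x <= ln x.
Proof.
  intros Hx. rewrite <- (Ropp_involutive (ln x)), <- ln_Rinv by auto.
  generalize (exp_ineq1_le (ln (/ x))). rewrite exp_ln by (apply Rinv_0_lt_compat; auto). lra.
Qed.
Lemma ln_le x : 0 < x -> ln x <= x - 1.
Proof. intros Hx. generalize (exp_ineq1_le (ln x)). rewrite exp_ln by auto. lra. Qed.
Lemma ln_1p_bound x : Rabs x <= / 2 -> Rabs (ln (1 + x) - x) <= 2 * x ^ 2.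
Proof.
  intros H. apply Rabs_le_between in H. generalize (ln_le (1 + x) ltac:(lra)) (ln_ge (1 + x) ltac:(lra)). intros.
  assert (1 - / (1 + x) = x - x ^ 2 * / (1 + x)) by (field; lra).
  assert (/ (1 + x) <= 2). { replace 2 with (/ (/ 2)) by field. apply Rinv_le_contravar; lra. }
  assert (x ^ 2 * / (1 + x) <= x ^ 2 * 2). { apply Rmult_le_compat_l; auto. apply pow2_ge_0. }
  apply Rabs_le. nra.
Qed.
Lemma ln_succ_bounds n : (1 <= n)%nat -> / INR (S n) <= ln (INR (S n)) - ln (INR n) <= / INR n.
Proof.
  intros Hn. assert (0 < INR n) by (apply lt_0_INR; lia). assert (0 < INR (S n)) by (apply lt_0_INR; lia).
  rewrite <- ln_div by auto.
  generalize (ln_le (INR (S n) / INR n) ltac:(apply Rdiv_lt_0_compat; auto)) (ln_ge (INR (S n) / INR n) ltac:(apply Rdiv_lt_0_compat; auto)).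
  replace (INR (S n) / INR n - 1) with (/ INR n) by (rewrite S_INR; field; lra).
  replace (1 - / (INR (S n) / INR n)) with (/ INR (S n)). lra. rewrite S_INR in *; field; lra.
Qed.

Definition harm (n : nat) : R := sum_n_m (fun k => / INR k) 1 n.
Lemma harm_0 : harm 0 = 0.
Proof. unfold harm. rewrite sum_n_m_zero; auto. Qed.
Lemma harm_S n : harm (S n) = harm n + / INR (S n).
Proof. unfold harm. rewrite sum_n_Sm by lia. reflexivity. Qed.
Definition harm2 (n : nat) : R := sum_n_m (fun k => / INR k ^ 2) 1 n.
Lemma harm2_0 : harm2 0 = 0.
Proof. unfold harm2. rewrite sum_n_m_zero; auto. Qed.
Lemma harm2_S n : harm2 (S n) = harm2 n + / INR (S n) ^ 2.
Proof. unfold harm2. rewrite sum_n_Sm by lia. reflexivity. Qed.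
Lemma harm2_nonneg_le n : 0 <= harm2 n <= 2.
Proof.
  assert (G : forall n, 0 <= harm2 (S n) <= 2 - / INR (S n)).
  { induction n0. rewrite harm2_S, harm2_0. simpl. lra.
    rewrite harm2_S. set (p := INR (S n0)) in *.
    replace (INR (S (S n0))) with (p + 1) by (unfold p; rewrite !S_INR; ring).
    assert (1 <= p). { unfold p. rewrite S_INR. generalize (pos_INR n0); lra. }
    assert (0 < / (p + 1) ^ 2). { apply Rinv_0_lt_compat, pow_lt; lra. }
    assert (/ (p + 1) ^ 2 <= / p - / (p + 1)).
    { replace (/ p - / (p + 1)) with (/ (p * (p + 1))) by (field; lra). apply Rinv_le_contravar; nra. }
    lra. }
  destruct n. rewrite harm2_0; lra. specialize (G n).
  assert (0 < / INR (S n)) by (apply Rinv_0_lt_compat, lt_0_INR; lia). lra.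
Qed.

Lemma harm_minus_ln n : (1 <= n)%nat -> 0 <= harm n - ln (INR n) <= 1.
Proof.
  intros Hn. assert (G : / INR n <= harm n - ln (INR n) <= 1).
  { induction n as [|n IH]; [lia|]. destruct n.
    - rewrite harm_S, harm_0. simpl. rewrite ln_1, Rinv_1. lra.
    - specialize (IH ltac:(lia)). generalize (ln_succ_bounds (S n) ltac:(lia)). rewrite (harm_S (S n)). lra. }
  assert (0 < / INR n) by (apply Rinv_0_lt_compat, lt_0_INR; lia). lra.
Qed.
Lemma is_lim_seq_euler_gamma : is_lim_seq (fun n => harm n - ln (INR n)) euler_gamma.
Proof.
  destruct (Ccv_of_increments (fun n => RtoC (harm n - ln (INR n))) 1 1) as [l [[Hl _] _]]; auto; try lra.
  { intros n Hn. rewrite <- RtoC_minus, Cmod_R, harm_S.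
    generalize (ln_succ_bounds n Hn). intros B.
    assert (Hp := INR_ge_1 n Hn).
    rewrite S_INR in *. set (p := INR n) in *.
    assert (/ p - / (p + 1) <= 1 / p ^ 2).
    { replace (/ p - / (p + 1)) with (/ (p * (p + 1))) by (field; lra). unfold Rdiv. rewrite Rmult_1_l.
      apply Rinv_le_contravar; nra. }
    apply Rabs_le. lra. }
  unfold euler_gamma. simpl in Hl.
  replace (Lim_seq _) with (Finite (Re l)). exact Hl.
  symmetry. apply is_lim_seq_unique, Hl.
Qed.

(** * Euler's product for the Gamma function *)

Definition eulerG (n : nat) (u : C) : C := (INR (fact n) * Cexp (u * ln (INR n)) / Crising u (S n))%C.

Lemma Cmod_shift_ge (u : C) (k : nat) : 0 < Re u -> Re u + INR k <= Cmod (u + INR k)%C.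
Proof.
  intros Hu. eapply Rle_trans; [|apply re_le_Cmod]. unfold Re in *. simpl. apply Rle_abs.
Qed.
Lemma Cmod_shift_pos (u : C) (k : nat) : 0 < Re u -> 0 < Cmod (u + INR k)%C.
Proof. intros Hu. generalize (Cmod_shift_ge u k Hu) (pos_INR k). lra. Qed.
Lemma shift_neq_0 (u : C) (k : nat) : 0 < Re u -> (u + INR k)%C <> 0%C.
Proof. intros Hu. apply Cmod_gt_0, Cmod_shift_pos, Hu. Qed.
Lemma Crising_neq_0 u n : 0 < Re u -> Crising u n <> 0%C.
Proof. intros Hu. induction n; simpl. apply RtoC_neq_0; lra. apply Cmult_neq_0; auto. apply shift_neq_0; auto. Qed.
Lemma RtoC_fact_neq_0 n : RtoC (INR (fact n)) <> 0%C.
Proof. apply RtoC_neq_0, INR_fact_neq_0. Qed.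
Lemma eulerG_neq_0 n u : 0 < Re u -> eulerG n u <> 0%C.
Proof.
  intros Hu. unfold eulerG, Cdiv. repeat apply Cmult_neq_0. apply RtoC_fact_neq_0. apply Cexp_neq_0.
  apply Cmod_gt_0. rewrite Cmod_inv. 2: apply Crising_neq_0; auto. apply Rinv_0_lt_compat, Cmod_gt_0, Crising_neq_0; auto.
Qed.

Lemma Cln_pos x : 0 < x -> Cln x = RtoC (ln x).
Proof.
  intros Hx. unfold Cln, Carg. rewrite Cmod_R, Rabs_pos_eq by lra. unfold RtoC; simpl. f_equal.
  destruct (Rle_dec 0 0); [|lra]. unfold Rdiv. rewrite Rinv_r by lra. apply acos_1.
Qed.

Lemma rGamma_seq n u : 0 < Re u -> (1 <= n)%nat ->
  (Crising u (S n) / (INR (fact n) * Cpower (INR n) u) = / eulerG n u)%C.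
Proof.
  intros Hu Hn. unfold Cpower, eulerG. rewrite Cln_pos by (apply lt_0_INR; lia).
  generalize (Crising_neq_0 u (S n) Hu) (RtoC_fact_neq_0 n) (Cexp_neq_0 (u * ln (INR n))). intros.
  field. repeat split; auto.
Qed.

Definition ratioG (n : nat) (u : C) : C := (INR (S n) / (u + INR (S n)) * Cexp (u * (ln (INR (S n)) - ln (INR n))%R))%C.

Lemma eulerG_S n u : 0 < Re u -> eulerG (S n) u = (eulerG n u * ratioG n u)%C.
Proof.
  intros Hu. unfold eulerG, ratioG. rewrite fact_simpl, mult_INR, RtoC_mult.
  replace (u * ln (INR (S n)))%C with (u * ln (INR n) + u * (ln (INR (S n)) - ln (INR n))%R)%C.
  2:{ rewrite RtoC_minus. ring. }
  rewrite Cexp_plus. change (Crising u (S (S n))) with (Crising u (S n) * (u + INR (S n)))%C.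
  generalize (Crising_neq_0 u (S n) Hu) (shift_neq_0 u (S n) Hu). intros. field. auto.
Qed.

(** With d = ln ((n + 1) / n), the ratio of consecutive products is
    (n + 1) / (u + n + 1) * exp (u d).  Both exp (u d) and (u + n + 1) / (n + 1) are
    1 + u / n + O(1 / n^2), so the ratio is 1 + O(1 / n^2); the dependence on u is kept
    because u runs over a vertical line. *)
Lemma ratioG_bound n u : 0 < Re u -> (1 <= n)%nat ->
  Cmod (ratioG n u - 1)%C <= (4 * exp (Re u) + 1) * (1 + Cmod u ^ 2) / INR n ^ 2.
Proof.
  intros Hu Hn. unfold ratioG. set (d := ln (INR (S n)) - ln (INR n)).
  generalize (ln_succ_bounds n Hn). fold d. intros Hd.
  assert (Hp := INR_ge_1 n Hn).
  assert (HS : INR (S n) = INR n + 1) by apply S_INR.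
  generalize (shift_neq_0 u (S n) Hu) (Cmod_shift_ge u (S n) Hu). intros Hne Hge.
  set (w := (u * d)%C).
  assert (HSn : RtoC (INR (S n)) <> 0%C) by (apply RtoC_neq_0; lra).
  replace (INR (S n) / (u + INR (S n)) * Cexp w - 1)%C with
    (INR (S n) / (u + INR (S n)) * ((Cexp w - 1 - w) + u * (d - / INR (S n))%R))%C.
  2:{ rewrite RtoC_minus, RtoC_inv by lra. unfold w. field. auto. }
  rewrite Cmod_mult.
  assert (H1 : Cmod (INR (S n) / (u + INR (S n)))%C <= 1).
  { rewrite Cmod_div by auto. rewrite Cmod_R, Rabs_pos_eq by lra.
    apply (Rdiv_le_1 (INR (S n))). lra. lra. }
  assert (H2 : Cmod ((Cexp w - 1 - w) + u * (d - / INR (S n))%R)%C <= (4 * exp (Re u) + 1) * (1 + Cmod u ^ 2) / INR n ^ 2).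
  { eapply Rle_trans. apply Cmod_triangle. rewrite Cmod_mult, Cmod_R.
    rewrite (Rabs_pos_eq (d - _)) by lra.
    assert (Hinv : 0 < / INR (S n)) by (apply Rinv_0_lt_compat; lra).
    assert (Hi2 : / INR n <= 1) by (rewrite <- Rinv_1; apply Rinv_le_contravar; lra).
    assert (A1 : Cmod (Cexp w - 1 - w)%C <= 4 * exp (Re u) * (Cmod u ^ 2 * / INR n ^ 2)).
    { eapply Rle_trans. apply Cexp_taylor1.
      assert (E1 : Rabs (Re w) <= Re u).
      { unfold w. rewrite Cmult_comm, Re_RtoC_mult, Rabs_mult, !Rabs_pos_eq by lra. nra. }
      assert (E2 : exp (Rabs (Re w)) <= exp (Re u)).
      { apply exp_le_compat, E1. }
      assert (E3 : Cmod w ^ 2 <= Cmod u ^ 2 * / INR n ^ 2).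
      { unfold w. rewrite Cmod_mult, Cmod_R, Rabs_pos_eq by lra. rewrite Rpow_mult_distr.
        apply Rmult_le_compat_l. apply pow2_ge_0. rewrite <- pow_inv. apply pow_incr. lra. }
      apply Rmult_le_compat; auto. generalize (exp_pos (Rabs (Re w))); lra. apply pow2_ge_0. lra. }
    assert (A2 : Cmod u * (d - / INR (S n)) <= Cmod u * / INR n ^ 2).
    { apply Rmult_le_compat_l. apply Cmod_ge_0. rewrite HS in *.
      assert (/ INR n - / (INR n + 1) <= / INR n ^ 2).
      { replace (/ INR n - / (INR n + 1)) with (/ (INR n * (INR n + 1))) by (field; lra).
        apply Rinv_le_contravar; nra. } lra. }
    assert (A3 : Cmod u <= 1 + Cmod u ^ 2) by nra.
    assert (0 < / INR n ^ 2) by (apply Rinv_0_lt_compat, pow_lt; lra).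
    assert (0 <= Cmod u ^ 2) by apply pow2_ge_0. generalize (exp_pos (Re u)). intros.
    unfold Rdiv. set (v := / INR n ^ 2) in *.
    assert (Cmod u * v <= (1 + Cmod u ^ 2) * v) by (apply Rmult_le_compat_r; lra).
    assert (0 <= exp (Re u) * v) by nra.
    nra. }
  generalize (Cmod_ge_0 (INR (S n) / (u + INR (S n)))%C) (Cmod_ge_0 ((Cexp w - 1 - w) + u * (d - / INR (S n))%R)%C). nra.
Qed.

Lemma ratioG_inv_bound n u : 0 < Re u -> (1 <= n)%nat ->
  Cmod (/ ratioG n u - 1)%C <= (1 + Cmod u) * (4 * exp (Re u) + 1) * (1 + Cmod u ^ 2) / INR n ^ 2.
Proof.
  intros Hu Hn.
  assert (Hp := INR_ge_1 n Hn).
  assert (HS : INR (S n) = INR n + 1) by apply S_INR.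
  assert (HSn : RtoC (INR (S n)) <> 0%C) by (apply RtoC_neq_0; lra).
  generalize (shift_neq_0 u (S n) Hu). intros Hne.
  assert (Hq : (/ ratioG n u)%C = ((u + INR (S n)) / INR (S n) * Cexp (- (u * (ln (INR (S n)) - ln (INR n))%R)))%C).
  { unfold ratioG. rewrite <- Cexp_inv. field. repeat split; auto. apply Cexp_neq_0. }
  assert (Hq0 : ratioG n u <> 0%C).
  { unfold ratioG. apply Cmult_neq_0; [|apply Cexp_neq_0]. apply Cmod_gt_0. rewrite Cmod_div by auto.
    apply Rdiv_lt_0_compat; apply Cmod_gt_0; auto. }
  replace (/ ratioG n u - 1)%C with (- (/ ratioG n u * (ratioG n u - 1)))%C by (field; auto).
  rewrite Cmod_opp, Cmod_mult. rewrite Rmult_assoc. unfold Rdiv. rewrite Rmult_assoc.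
  apply Rmult_le_compat; try apply Cmod_ge_0.
  2: apply ratioG_bound; auto.
  rewrite Hq, Cmod_mult, Cmod_Cexp.
  generalize (ln_succ_bounds n Hn). intros Hd. set (d := ln (INR (S n)) - ln (INR n)) in *.
  assert (E : exp (Re (- (u * d))%C) <= 1).
  { rewrite <- exp_0 at 1. assert (0 <= d). { assert (0 < / INR (S n)) by (apply Rinv_0_lt_compat; lra). lra. }
    replace (Re (- (u * d))%C) with (- (Re u * d)) by (unfold Re; simpl; ring).
    apply exp_le_compat. nra. }
  assert (E2 : Cmod ((u + INR (S n)) / INR (S n))%C <= 1 + Cmod u).
  { rewrite Cmod_div by auto. rewrite (Cmod_R (INR (S n))), (Rabs_pos_eq (INR (S n))) by lra. apply (Rle_div_l _ _ (INR (S n))). lra.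
    eapply Rle_trans. apply Cmod_triangle. rewrite Cmod_R, Rabs_pos_eq by lra. generalize (Cmod_ge_0 u); nra. }
  generalize (Cmod_ge_0 ((u + INR (S n)) / INR (S n))%C) (exp_pos (Re (- (u * d))%C)). intros.
  apply Rle_trans with ((1 + Cmod u) * 1); [|lra]. apply Rmult_le_compat; lra.
Qed.

Lemma product_bounded (w q : nat -> C) (B : R) : 0 <= B ->
  (forall n, (1 <= n)%nat -> w (S n) = (w n * q n)%C) ->
  (forall n, (1 <= n)%nat -> Cmod (q n - 1)%C <= B / INR n ^ 2) ->
  forall n, (1 <= n)%nat -> Cmod (w n) <= Cmod (w 1%nat) * exp (2 * B).
Proof.
  intros HB Hw Hq. apply (prod_bound (fun n => Cmod (w n))); auto. intros; apply Cmod_ge_0.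
  intros n Hn. rewrite Hw, Cmod_mult by auto. apply Rmult_le_compat_l. apply Cmod_ge_0.
  replace (q n) with (1 + (q n - 1))%C by ring. eapply Rle_trans. apply Cmod_triangle. rewrite Cmod_1.
  apply Rplus_le_compat_l, Hq; auto.
Qed.

Lemma product_cv (w q : nat -> C) (B : R) : 0 <= B ->
  (forall n, (1 <= n)%nat -> w (S n) = (w n * q n)%C) ->
  (forall n, (1 <= n)%nat -> Cmod (q n - 1)%C <= B / INR n ^ 2) ->
  exists l, Ccv w l.
Proof.
  intros HB Hw Hq. generalize (product_bounded w q B HB Hw Hq). intros Hb.
  set (A := Cmod (w 1%nat) * exp (2 * B)) in *.
  assert (0 <= A). { unfold A. apply Rmult_le_pos. apply Cmod_ge_0. left; apply exp_pos. }
  destruct (Ccv_of_increments w (A * B) 1) as [l [Hl _]]; auto. apply Rmult_le_pos; auto.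
  2: exists l; auto.
  intros n Hn. rewrite Hw by auto. replace (w n * q n - w n)%C with (w n * (q n - 1))%C by ring.
  rewrite Cmod_mult. unfold Rdiv. rewrite Rmult_assoc. apply Rmult_le_compat; try apply Cmod_ge_0. apply Hb; auto. apply Hq; auto.
Qed.

(** The products and their inverses both converge; as their limits are inverse to each
    other, 1 / Gamma does not vanish, and [Gamma] is the limit of the products. *)
Lemma eulerG_cv u : 0 < Re u ->
  Ccv (fun n => eulerG n u) (Gamma u) /\ Ccv (fun n => / eulerG n u)%C (rGamma u) /\ (Gamma u * rGamma u = 1)%C.
Proof.
  intros Hu. set (B := (4 * exp (Re u) + 1) * (1 + Cmod u ^ 2)).
  assert (HB : 0 <= B). { unfold B. generalize (exp_pos (Re u)) (pow2_ge_0 (Cmod u)). nra. }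
  generalize (Cmod_ge_0 u). intros Hm.
  destruct (product_cv (fun n => eulerG n u) (fun n => ratioG n u) B) as [l1 H1]; auto.
  { intros; apply eulerG_S; auto. } { intros; apply ratioG_bound; auto. }
  destruct (product_cv (fun n => / eulerG n u)%C (fun n => / ratioG n u)%C ((1 + Cmod u) * B)) as [l2 H2]; auto.
  { nra. }
  { intros n Hn. generalize (eulerG_neq_0 n u Hu) (eulerG_neq_0 (S n) u Hu). rewrite (eulerG_S n) by auto.
    intros A1 A2. field. split; auto. intros E; apply A2. rewrite E; ring. }
  { intros; eapply Rle_trans. apply ratioG_inv_bound; auto. unfold B. right. unfold Rdiv; ring. }
  assert (Hr : rGamma u = l2).
  { apply Ccv_Clim. apply (Ccv_ext_loc (fun n => / eulerG n u)%C); auto. exists 1%nat. intros. symmetry. apply rGamma_seq; auto. }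
  assert (E : (l1 * l2 = 1)%C).
  { apply (Ccv_unique (fun n => eulerG n u * / eulerG n u)%C). apply Ccv_mult; auto.
    apply (Ccv_ext (fun _ => 1%C)). intros. field. apply eulerG_neq_0; auto. apply Ccv_const. }
  assert (Hl2 : l2 <> 0%C). { intros ->. rewrite Cmult_0_r in E. apply RtoC_inj in E. lra. }
  assert (Hg : Gamma u = l1). { unfold Gamma. rewrite Hr. transitivity (l1 * l2 * / l2)%C. rewrite E; ring. field; auto. }
  rewrite Hg, Hr. auto.
Qed.

Lemma Crising_S_l u n : Crising u (S n) = (u * Crising (u + 1) n)%C.
Proof.
  induction n. simpl. ring.
  change (Crising u (S (S n))) with (Crising u (S n) * (u + INR (S n)))%C. rewrite IHn.
  change (Crising (u + 1) (S n)) with (Crising (u + 1) n * (u + 1 + INR n))%C. rewrite S_INR, RtoC_plus. ring.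
Qed.

Lemma eulerG_shift n u : 0 < Re u -> (1 <= n)%nat -> eulerG n (u + 1)%C = (eulerG n u * u * (INR n / (u + INR (S n))))%C.
Proof.
  intros Hu Hn. unfold eulerG.
  replace ((u + 1) * ln (INR n))%C with (u * ln (INR n) + ln (INR n))%C by ring.
  rewrite Cexp_plus, (Cexp_RtoC (ln (INR n))), exp_ln by (apply lt_0_INR; lia).
  assert (E : (Crising u (S n) * (u + INR (S n)) = u * Crising (u + 1) (S n))%C).
  { rewrite <- Crising_S_l. reflexivity. }
  assert (Hu1 : 0 < Re (u + 1)%C) by (unfold Re in *; simpl; lra).
  generalize (Crising_neq_0 u (S n) Hu) (Crising_neq_0 (u + 1) (S n) Hu1) (shift_neq_0 u (S n) Hu). intros A1 A2 A3.
  assert (A0 : u <> 0%C). { intros ->. simpl in Hu. lra. }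
  assert (E' : Crising (u + 1) (S n) = (Crising u (S n) * (u + INR (S n)) / u)%C). { rewrite E. field. auto. }
  rewrite E'. field. auto.
Qed.

Lemma Ccv_n_over (a : C) : 0 < Re a -> Ccv (fun n => INR n / (a + INR (S n)))%C 1%C.
Proof.
  intros Hu.
  apply Ccv_of_Cmod.
  { assert (L : is_lim_seq (fun n => Cmod (INR n / (a + INR (S n)) - 1)%C) 0).
    { apply (is_lim_seq_le_le_loc (fun _ => 0) _ (fun n => (Cmod a + 1) / INR n)).
      - exists 1%nat. intros n Hn. split. apply Cmod_ge_0.
        generalize (shift_neq_0 a (S n) Hu) (Cmod_shift_ge a (S n) Hu). intros Hne Hge.
        replace (INR n / (a + INR (S n)) - 1)%C with (- ((a + 1) / (a + INR (S n))))%C.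
        2:{ rewrite S_INR, RtoC_plus in *. field. auto. }
        rewrite Cmod_opp, Cmod_div by auto. assert (0 < INR n) by (apply lt_0_INR; lia). rewrite S_INR in Hge.
        apply Rmult_le_compat. apply Cmod_ge_0. left; apply Rinv_0_lt_compat, Cmod_gt_0; auto.
        eapply Rle_trans. apply Cmod_triangle. rewrite Cmod_1; lra.
        apply Rinv_le_contravar; auto. rewrite S_INR. lra.
      - apply is_lim_seq_const.
      - apply is_lim_seq_div_INR. }
    exact L. }
Qed.

Lemma Gamma_succ u : 0 < Re u -> Gamma (u + 1)%C = (Gamma u * u)%C.
Proof.
  intros Hu. destruct (eulerG_cv u Hu) as [H1 _].
  destruct (eulerG_cv (u + 1)%C) as [H2 _]. unfold Re in *; simpl; lra.
  apply (Ccv_unique (fun n => eulerG n (u + 1)%C)); auto.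
  apply (Ccv_ext_loc (fun n => eulerG n u * u * (INR n / (u + INR (S n))))%C).
  exists 1%nat. intros; symmetry; apply eulerG_shift; auto.
  replace (Gamma u * u)%C with (Gamma u * u * 1)%C by ring.
  apply Ccv_mult. apply Ccv_mult; auto. apply Ccv_const. apply Ccv_n_over; auto.
Qed.
Lemma rGamma_succ u : 0 < Re u -> rGamma u = (u * rGamma (u + 1))%C.
Proof.
  intros Hu. destruct (eulerG_cv u Hu) as [_ [_ H1]].
  destruct (eulerG_cv (u + 1)%C) as [_ [_ H2]]. unfold Re in *; simpl; lra.
  rewrite Gamma_succ in H2 by auto.
  transitivity (rGamma u * (Gamma u * u * rGamma (u + 1)))%C. rewrite H2; ring.
  transitivity ((Gamma u * rGamma u) * (u * rGamma (u + 1)))%C. ring. rewrite H1; ring.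
Qed.

(** Each factor of (u)_n is at least as large in modulus as the corresponding factor of
    (Re u)_n.  Using this for all factors but the first four leaves a bound by
    |u|^(-4), uniform in n. *)
Lemma Crising_decay u m : 0 < Re u ->
  Cmod (Crising u 4) * Cmod (Crising (Re u) (4 + m)) <= Cmod (Crising u (4 + m)) * Cmod (Crising (Re u) 4).
Proof.
  intros Hu. induction m. rewrite Nat.add_0_r. lra.
  rewrite Nat.add_succ_r.
  change (Crising (Re u) (S (4 + m))) with (Crising (Re u) (4 + m) * (Re u + INR (4 + m)))%C.
  change (Crising u (S (4 + m))) with (Crising u (4 + m) * (u + INR (4 + m)))%C.
  rewrite !Cmod_mult.
  assert (Cmod (Re u + INR (4 + m))%C <= Cmod (u + INR (4 + m))%C).
  { rewrite <- RtoC_plus, Cmod_R, Rabs_pos_eq. apply Cmod_shift_ge; auto. generalize (pos_INR (4 + m)); lra. }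
  generalize (Cmod_ge_0 (Re u + INR (4 + m))%C) (Cmod_ge_0 (Crising u (4 + m))) (Cmod_ge_0 (Crising (Re u) 4))
     (Cmod_ge_0 (Crising u 4)) (Cmod_ge_0 (Crising (Re u) (4 + m))). intros.
  rewrite <- Rmult_assoc. replace (Cmod (Crising u (4 + m)) * Cmod (u + INR (4 + m))%C * Cmod (Crising (Re u) 4))
    with (Cmod (Crising u (4 + m)) * Cmod (Crising (Re u) 4) * Cmod (u + INR (4 + m))%C) by ring.
  apply Rmult_le_compat; auto. apply Rmult_le_pos; auto.
Qed.

Lemma Cmod_shift_le_u u k : 0 < Re u -> Cmod u <= Cmod (u + INR k)%C.
Proof.
  intros Hu. unfold Cmod. apply sqrt_le_1_alt. unfold Re in Hu. simpl. generalize (pos_INR k). nra.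
Qed.

Lemma eulerG_decay s : 0 < s -> exists K, 0 < K /\ forall u n, Re u = s -> (3 <= n)%nat -> Cmod (eulerG n u) <= K / Cmod u ^ 4.
Proof.
  intros Hs.
  assert (HsC : 0 < Re (RtoC s)) by (simpl; auto).
  set (B := (4 * exp s + 1) * (1 + Cmod s ^ 2)).
  set (K0 := Cmod (eulerG 1 s) * exp (2 * B)).
  assert (HB : 0 <= B). { unfold B. generalize (exp_pos s) (pow2_ge_0 (Cmod s)). nra. }
  assert (HK0 : forall n, (1 <= n)%nat -> Cmod (eulerG n s) <= K0).
  { apply (product_bounded (fun n => eulerG n s) (fun n => ratioG n s)); auto.
    intros; apply eulerG_S; auto. intros; apply (ratioG_bound n s); auto. }
  exists (K0 * Cmod (Crising s 4)). split.
  { apply Rmult_lt_0_compat. apply Rmult_lt_0_compat. apply Cmod_gt_0, eulerG_neq_0; auto. apply exp_pos. apply Cmod_gt_0, Crising_neq_0; auto. }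
  intros u n Hu Hn.
  assert (Hu0 : 0 < Re u) by lra.
  assert (E : Cmod (eulerG n u) = Cmod (eulerG n s) * (Cmod (Crising s (S n)) / Cmod (Crising u (S n)))).
  { unfold eulerG. rewrite !Cmod_div by (apply Crising_neq_0; auto). rewrite !Cmod_mult, !Cmod_Cexp.
    replace (Re (s * ln (INR n))%C) with (s * ln (INR n)) by (unfold Re; simpl; ring).
    replace (Re (u * ln (INR n))%C) with (s * ln (INR n)) by (rewrite <- Hu; unfold Re; simpl; ring).
    field. split; apply Rgt_not_eq, Cmod_gt_0, Crising_neq_0; auto. }
  rewrite E. unfold Rdiv. rewrite (Rmult_assoc K0). apply Rmult_le_compat. apply Cmod_ge_0.
  apply Rmult_le_pos. apply Cmod_ge_0. left; apply Rinv_0_lt_compat, Cmod_gt_0, Crising_neq_0; auto.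
  apply HK0; lia.
  generalize (Crising_decay u (n - 3) Hu0). rewrite Hu. replace (4 + (n - 3))%nat with (S n) by lia.
  assert (P1 : 0 < Cmod (Crising u (S n))) by (apply Cmod_gt_0, Crising_neq_0; auto).
  assert (P2 : 0 < Cmod u). { generalize (re_le_Cmod u) (Rle_abs (Re u)). lra. }
  assert (P3 : Cmod u ^ 4 <= Cmod (Crising u 4)).
  { simpl Crising. rewrite !Cmod_mult, Cmod_1. generalize (Cmod_shift_le_u u 0 Hu0) (Cmod_shift_le_u u 1 Hu0) (Cmod_shift_le_u u 2 Hu0) (Cmod_shift_le_u u 3 Hu0).
    simpl INR. intros. simpl. rewrite Rmult_1_r, Rmult_1_l. rewrite <- !Rmult_assoc.
    repeat apply Rmult_le_compat; auto; try lra; repeat apply Rmult_le_pos; lra. }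
  intros D. apply (Rmult_le_reg_r (Cmod (Crising u (S n)))); auto.
  apply (Rmult_le_reg_r (Cmod u ^ 4)). apply pow_lt; auto.
  replace (Cmod (Crising s (S n)) * / Cmod (Crising u (S n)) * Cmod (Crising u (S n)) * Cmod u ^ 4) with (Cmod u ^ 4 * Cmod (Crising s (S n))) by (field; lra).
  replace (Cmod (Crising s 4) * / Cmod u ^ 4 * Cmod (Crising u (S n)) * Cmod u ^ 4) with (Cmod (Crising u (S n)) * Cmod (Crising s 4)) by (field; lra).
  eapply Rle_trans; [|apply D]. apply Rmult_le_compat_r; auto. apply Cmod_ge_0.
Qed.

(** The decay |u|^(-4) absorbs the factor 1 + |u|^2 of [ratioG_bound] and leaves an
    integrable error |u|^(-2) / n. *)
Lemma eulerG_cv_unif s : 0 < s -> exists K, 0 < K /\ forall u, Re u = s ->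
  Cmod (Gamma u) <= K /\ (forall n, (3 <= n)%nat -> Cmod (eulerG n u) <= K /\ Cmod (eulerG n u) <= K / Cmod u ^ 2 /\
     Cmod (eulerG n u - Gamma u)%C <= K / Cmod u ^ 2 / INR n).
Proof.
  intros Hs. destruct (eulerG_decay s Hs) as [K [HK HKu]].
  set (B := 4 * exp s + 1). assert (HB : 0 < B) by (unfold B; generalize (exp_pos s); lra).
  set (c := / s ^ 2). assert (Hc : 0 < c) by (apply Rinv_0_lt_compat, pow_lt; auto).
  exists (K * (c * c + c + 2 * B * (1 + c))).
  assert (Q1 : 0 < K * (c * c)) by (repeat apply Rmult_lt_0_compat; lra).
  assert (Q2 : 0 < K * c) by (repeat apply Rmult_lt_0_compat; lra).
  assert (Q3 : 0 < K * (2 * B * (1 + c))) by (repeat apply Rmult_lt_0_compat; lra).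
  split. rewrite !Rmult_plus_distr_l; lra.
  intros u Hu. assert (Hu0 : 0 < Re u) by lra.
  assert (Hsu : s <= Cmod u). { generalize (re_le_Cmod u) (Rle_abs (Re u)). lra. }
  assert (Hsu2 : 0 < s ^ 2 <= Cmod u ^ 2). { split. apply pow_lt; auto. apply pow_incr; lra. }
  assert (Huc : 0 < / Cmod u ^ 2 <= c). { split. apply Rinv_0_lt_compat; lra. apply Rinv_le_contravar; lra. }
  set (v := / Cmod u ^ 2) in *.
  assert (G1 : forall n, (3 <= n)%nat -> Cmod (eulerG n u) <= K * v * v).
  { intros n Hn. eapply Rle_trans. apply HKu; auto. right. unfold v. field. lra. }
  assert (G2 : forall n, (3 <= n)%nat -> Cmod (eulerG n u) <= K * (c * c)).
  { intros. eapply Rle_trans. apply G1; auto. rewrite Rmult_assoc. apply Rmult_le_compat_l. lra. nra. }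
  destruct (eulerG_cv u Hu0) as [L _].
  assert (INC : forall n, (3 <= n)%nat -> Cmod (eulerG (S n) u - eulerG n u)%C <= K * B * (1 + c) * v / INR n ^ 2).
  { intros n Hn. rewrite eulerG_S by auto. replace (eulerG n u * ratioG n u - eulerG n u)%C with (eulerG n u * (ratioG n u - 1))%C by ring.
    rewrite Cmod_mult.
    apply Rle_trans with (K * v * v * (B * (1 + Cmod u ^ 2) / INR n ^ 2)).
    apply Rmult_le_compat; try apply Cmod_ge_0. apply G1; auto. unfold B. rewrite <- Hu. apply ratioG_bound; auto; lia.
    replace (K * v * v * (B * (1 + Cmod u ^ 2) / INR n ^ 2)) with (K * B * (v * (v * (1 + Cmod u ^ 2))) * / INR n ^ 2) by (unfold Rdiv; ring).
    unfold Rdiv. apply Rmult_le_compat_r. left; apply Rinv_0_lt_compat, pow_lt, lt_0_INR; lia.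
    replace (K * B * (1 + c) * v) with (K * B * (v * (1 + c))) by ring. apply Rmult_le_compat_l. nra.
    apply Rmult_le_compat_l. lra. replace (v * (1 + Cmod u ^ 2)) with (v + 1) by (unfold v; field; lra). lra. }
  destruct (Ccv_of_increments (fun n => eulerG n u) (K * B * (1 + c) * v) 3) as [l [L' EST]]; auto.
  { assert (0 < K * B) by (apply Rmult_lt_0_compat; lra). apply Rmult_le_pos; [|lra]. apply Rmult_le_pos; lra. }
  rewrite (Ccv_unique _ _ _ L L') in *.
  split.
  { apply (Ccv_Cmod_le _ _ _ L'). exists 3%nat. intros. eapply Rle_trans. apply G2; auto. rewrite !Rmult_plus_distr_l; lra. }
  intros n Hn. split; [|split].
  - eapply Rle_trans. apply G2; auto. rewrite !Rmult_plus_distr_l; lra.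
  - eapply Rle_trans. apply G1; auto. unfold Rdiv. fold v. apply Rmult_le_compat_r. lra.
    assert (K * v <= K * c) by (apply Rmult_le_compat_l; lra). rewrite !Rmult_plus_distr_l; lra.
  - eapply Rle_trans. apply EST; auto. unfold Rdiv. fold v. apply Rmult_le_compat_r. left; apply Rinv_0_lt_compat, lt_0_INR; lia.
    replace (2 * (K * B * (1 + c) * v)) with (K * (2 * B * (1 + c)) * v) by ring. apply Rmult_le_compat_r. lra.
    rewrite (Rmult_plus_distr_l K (c * c + c)). rewrite (Rmult_plus_distr_l K). lra.
Qed.

(** * The derivative of the integral Wright function in beta *)

Lemma Re_RtoC a : Re (RtoC a) = a.
Proof. reflexivity. Qed.
Lemma ln_1p_exp x : Rabs x <= / 2 -> exists e, Rabs e <= 2 * x ^ 2 /\ 1 + x = exp (x + e).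
Proof.
  intros Hx. exists (ln (1 + x) - x). split. apply ln_1p_bound; auto.
  replace (x + (ln (1 + x) - x)) with (ln (1 + x)) by ring. rewrite exp_ln; auto.
  apply Rabs_le_between in Hx. lra.
Qed.
Lemma shift_exp h k : Rabs h <= / 2 -> exists e, Rabs e <= 2 * h ^ 2 * / INR (S k) ^ 2 /\
  1 + h + INR k = INR (S k) * exp (h * / INR (S k) + e).
Proof.
  intros Hh. assert (Hp : 1 <= INR (S k)) by apply INR_S_ge_1.
  destruct (ln_1p_exp (h * / INR (S k))) as [e [He1 He2]].
  { rewrite Rabs_mult, (Rabs_pos_eq (/ _)) by (left; apply Rinv_0_lt_compat; lra).
    assert (/ INR (S k) <= 1) by (rewrite <- Rinv_1; apply Rinv_le_contravar; lra).
    assert (0 < / INR (S k)) by (apply Rinv_0_lt_compat; lra).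
    generalize (Rabs_pos h). nra. }
  exists e. split. rewrite Rpow_mult_distr, pow_inv in He1. lra.
  rewrite <- He2. rewrite S_INR in *. field. lra.
Qed.

(** The factors of (1 + h)_m are k (1 + h / k); the quadratic errors of the logarithms
    sum up to at most 2 h^2 (1 + 1/4 + 1/9 + ...). *)
Lemma Crising_near_1 h m : Rabs h <= / 2 -> exists th, Rabs th <= 2 * h ^ 2 * harm2 m /\
  Crising (RtoC (1 + h)) m = RtoC (INR (fact m) * exp (h * harm m + th)).
Proof.
  intros Hh. induction m as [|m [th [T1 T2]]].
  - exists 0. rewrite harm2_0, harm_0, Rabs_R0. split. lra. simpl. f_equal. rewrite Rmult_0_r, Rplus_0_r, exp_0. ring.
  - destruct (shift_exp h m Hh) as [e [E1 E2]]. exists (th + e). split.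
    rewrite harm2_S. eapply Rle_trans. apply Rabs_triang. lra.
    change (Crising (RtoC (1 + h)) (S m)) with (Crising (RtoC (1 + h)) m * (RtoC (1 + h) + INR m))%C.
    rewrite T2, <- RtoC_plus, <- RtoC_mult. f_equal. rewrite E2, fact_simpl, mult_INR, harm_S.
    replace (h * (harm m + / INR (S m)) + (th + e)) with ((h * harm m + th) + (h * / INR (S m) + e)) by ring.
    rewrite (exp_plus (h * harm m + th)). ring.
Qed.

Lemma euler_gamma_bounds : 0 <= euler_gamma <= 1.
Proof.
  split.
  apply (is_lim_seq_le_loc (fun _ => 0) (fun n => harm n - ln (INR n)) 0 euler_gamma).
  exists 1%nat. intros; apply harm_minus_ln; auto. apply is_lim_seq_const. apply is_lim_seq_euler_gamma.
  apply (is_lim_seq_le_loc (fun n => harm n - ln (INR n)) (fun _ => 1) euler_gamma 1).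
  exists 1%nat. intros; apply harm_minus_ln; auto. apply is_lim_seq_euler_gamma. apply is_lim_seq_const.
Qed.

(** First-order expansion of 1 / Gamma at 1, with derivative gamma, obtained by letting
    n grow in the expansion of Euler's product.  Exponential form with a bounded error
    term lets the recurrence act by addition of the errors. *)
Lemma rGamma_near_1 h : Rabs h <= / 2 -> exists th, Rabs th <= 4 * h ^ 2 /\
  rGamma (RtoC (1 + h)) = RtoC (exp (euler_gamma * h + th)).
Proof.
  intros Hh. assert (Hb := proj1 (Rabs_le_between _ _) Hh).
  destruct (eulerG_cv (RtoC (1 + h))) as [_ [[L1 L2] _]]. simpl; lra.
  set (r := rGamma (RtoC (1 + h))) in *.
  assert (E : forall n, (1 <= n)%nat -> exists th, Rabs th <= 4 * h ^ 2 /\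
    (/ eulerG n (RtoC (1 + h)))%C = RtoC (INR (S n) / INR n * exp (h * (harm n - ln (INR n) + / INR (S n)) + th))).
  { intros n Hn. destruct (Crising_near_1 h (S n) Hh) as [th [T1 T2]].
    exists th. split. generalize (harm2_nonneg_le (S n)) (pow2_ge_0 h). nra.
    assert (Hp : 0 < INR n) by (apply lt_0_INR; lia).
    unfold eulerG. rewrite T2. rewrite <- RtoC_mult, Cexp_RtoC, <- RtoC_mult.
    assert (N1 := INR_fact_neq_0 (S n)). assert (N2 := exp_pos (h * harm (S n) + th)).
    assert (N3 : INR (fact (S n)) * exp (h * harm (S n) + th) <> 0) by (apply Rmult_integral_contrapositive; split; lra).
    assert (N4 : INR (fact n) * exp ((1 + h) * ln (INR n)) <> 0).
    { apply Rmult_integral_contrapositive; split. apply INR_fact_neq_0. apply Rgt_not_eq, exp_pos. }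
    rewrite <- RtoC_div by exact N3.
    rewrite <- RtoC_inv by (unfold Rdiv; apply Rmult_integral_contrapositive; split; [exact N4|apply Rinv_neq_0_compat, N3]).
    clear N1 N2 N3 N4. f_equal.
    rewrite fact_simpl, mult_INR, harm_S.
    replace (h * (harm n + / INR (S n)) + th) with (h * (harm n - ln (INR n) + / INR (S n)) + th + h * ln (INR n)) by ring.
    rewrite (exp_plus _ (h * _)), Rmult_plus_distr_r, Rmult_1_l, (exp_plus (ln _)), exp_ln by auto.
    generalize (exp_pos (h * (harm n - ln (INR n) + / INR (S n)) + th)) (exp_pos (h * ln (INR n))) (INR_fact_neq_0 n) (lt_0_INR (S n) ltac:(lia)).
    intros. field. repeat split; lra. }
  assert (Him : Im r = 0).
  { apply is_lim_seq_unique in L2.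
    assert (Lc : is_lim_seq (fun n => Im (/ eulerG n (RtoC (1 + h)))%C) 0).
    { apply (is_lim_seq_ext_loc (fun _ => 0)). 2: apply is_lim_seq_const.
      exists 1%nat. intros n Hn. destruct (E n Hn) as [th [_ ->]]. reflexivity. }
    apply is_lim_seq_unique in Lc. rewrite L2 in Lc. inversion Lc; auto. }
  assert (LB : forall c, is_lim_seq (fun n => INR (S n) / INR n * exp (h * (harm n - ln (INR n) + / INR (S n)) + c)) (exp (h * euler_gamma + c))).
  { intros c. replace (exp (h * euler_gamma + c)) with ((1 + 0) * exp (h * (euler_gamma + 0) + c)).
    2:{ rewrite !Rplus_0_r. ring. }
    apply is_lim_seq_mult'.
    - apply (is_lim_seq_ext_loc (fun n => 1 + / INR n)). exists 1%nat. intros n Hn. rewrite S_INR. field. apply Rgt_not_eq, lt_0_INR; lia.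
      apply is_lim_seq_plus'. apply is_lim_seq_const. apply is_lim_seq_inv_INR.
    - apply (is_lim_seq_continuous exp (fun n => h * (harm n - ln (INR n) + / INR (S n)) + c)). apply derivable_continuous_pt, derivable_pt_exp.
      apply is_lim_seq_plus'; [|apply is_lim_seq_const]. apply is_lim_seq_mult'; [apply is_lim_seq_const|].
      apply is_lim_seq_plus'. apply is_lim_seq_euler_gamma. apply (is_lim_seq_incr_1 (fun n => / INR n)). apply is_lim_seq_inv_INR. }
  assert (Lo : exp (h * euler_gamma + - (4 * h ^ 2)) <= Re r).
  { eapply (is_lim_seq_le_loc _ _ (Finite _) (Finite _)); [|apply LB|apply L1].
    exists 1%nat. intros n Hn. destruct (E n Hn) as [th [T1 ->]]. apply Rabs_le_between in T1. rewrite Re_RtoC.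
    apply Rmult_le_compat_l. apply Rdiv_le_0_compat. apply pos_INR. apply lt_0_INR; lia. apply exp_le_compat. lra. }
  assert (Hi : Re r <= exp (h * euler_gamma + (4 * h ^ 2))).
  { eapply (is_lim_seq_le_loc _ _ (Finite _) (Finite _)); [|apply L1|apply LB].
    exists 1%nat. intros n Hn. destruct (E n Hn) as [th [T1 ->]]. apply Rabs_le_between in T1. rewrite Re_RtoC.
    apply Rmult_le_compat_l. apply Rdiv_le_0_compat. apply pos_INR. apply lt_0_INR; lia. apply exp_le_compat. lra. }
  assert (Hpos : 0 < Re r). { eapply Rlt_le_trans; [apply exp_pos|apply Lo]. }
  exists (ln (Re r) - euler_gamma * h). split.
  - assert (A1 : h * euler_gamma + - (4 * h ^ 2) <= ln (Re r)). { rewrite <- (ln_exp (h * euler_gamma + - (4 * h ^ 2))). apply Rcomplements.ln_le; auto. apply exp_pos. }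
    assert (A2 : ln (Re r) <= h * euler_gamma + (4 * h ^ 2)). { rewrite <- (ln_exp (h * euler_gamma + (4 * h ^ 2))). apply Rcomplements.ln_le; auto. }
    apply Rabs_le. lra.
  - replace (euler_gamma * h + (ln (Re r) - euler_gamma * h)) with (ln (Re r)) by ring. rewrite exp_ln by auto.
    destruct r as [r1 r2]; simpl in *. subst r2. reflexivity.
Qed.

(** The bound on the error does not depend on k: the recurrence divides by
    k (1 + h / k) and the added errors are again summable. *)
Lemma rGamma_near_nat h k : Rabs h <= / 2 -> exists th, Rabs th <= 8 * h ^ 2 /\
  rGamma (RtoC (1 + h + INR k)) = RtoC (exp ((euler_gamma - harm k) * h + th) / INR (fact k)).
Proof.
  intros Hh. assert (Hb := proj1 (Rabs_le_between _ _) Hh).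
  assert (G : exists th, Rabs th <= 4 * h ^ 2 + 2 * h ^ 2 * harm2 k /\
    rGamma (RtoC (1 + h + INR k)) = RtoC (exp ((euler_gamma - harm k) * h + th) / INR (fact k))).
  { induction k as [|k [th [T1 T2]]].
    - destruct (rGamma_near_1 h Hh) as [th [T1 T2]]. exists th. rewrite harm2_0. split. lra.
      simpl INR. rewrite Rplus_0_r, T2, harm_0. f_equal. rewrite Rminus_0_r. field.
    - destruct (shift_exp h k Hh) as [e [E1 E2]]. exists (th + - e). split.
      { rewrite harm2_S. eapply Rle_trans. apply Rabs_triang. rewrite Rabs_Ropp. lra. }
      assert (Hp : 0 < 1 + h + INR k) by (generalize (pos_INR k); lra).
      assert (S1 := rGamma_succ (RtoC (1 + h + INR k)) Hp).
      rewrite T2, <- RtoC_plus in S1.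
      replace (1 + h + INR k + 1) with (1 + h + INR (S k)) in S1 by (rewrite S_INR; ring).
      assert (Hne : RtoC (1 + h + INR k) <> 0%C) by (apply RtoC_neq_0; lra).
      transitivity (/ RtoC (1 + h + INR k) * (RtoC (1 + h + INR k) * rGamma (1 + h + INR (S k))%R))%C.
      { field. auto. }
      rewrite <- S1, <- RtoC_inv, <- RtoC_mult by lra. f_equal.
      rewrite E2, fact_simpl, mult_INR, harm_S.
      replace ((euler_gamma - (harm k + / INR (S k))) * h + (th + - e)) with
        (((euler_gamma - harm k) * h + th) + - (h * / INR (S k) + e)) by ring.
      rewrite (exp_plus ((euler_gamma - harm k) * h + th)), exp_Ropp.
      generalize (INR_fact_neq_0 k) (lt_0_INR (S k) ltac:(lia)) (exp_pos (h * / INR (S k) + e)). intros. field. repeat split; lra. }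
  destruct G as [th [T1 T2]]. exists th. split; auto.
  generalize (harm2_nonneg_le k) (pow2_ge_0 h). nra.
Qed.

Lemma harm_bounds k : 0 <= harm k <= INR k.
Proof.
  induction k. rewrite harm_0. simpl; lra. rewrite harm_S, S_INR.
  assert (B := inv_INR_S k). rewrite S_INR in B. lra.
Qed.

Lemma ex_series_scal_R c (a : nat -> R) : ex_series a -> ex_series (fun n => c * a n).
Proof. apply (ex_series_scal (V := R_NormedModule)). Qed.
Lemma ex_series_le_R (a b : nat -> R) : (forall n, Rabs (a n) <= b n) -> ex_series b -> ex_series a.
Proof. intros L. apply (ex_series_le (K := R_AbsRing) (V := R_CompleteNormedModule) a b). auto. Qed.
Lemma ex_series_exp y : ex_series (fun k => y ^ k / INR (fact k)).
Proof.
  exists (exp y). generalize (is_exp_Reals y). unfold is_pseries. apply is_series_ext. intros n.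
  rewrite pow_n_pow. unfold scal; simpl; unfold mult; simpl. unfold Rdiv. reflexivity.
Qed.

(** All the series of the theorem have the coefficients 1 / (k k!^2) up to a factor of
    moderate growth. *)
Definition wcoef (k : nat) : R := / (INR k * INR (fact k) ^ 2).

Lemma fact_ge_1 n : 1 <= INR (fact n).
Proof. replace 1 with (INR 1) by reflexivity. apply le_INR. generalize (lt_O_fact n); lia. Qed.
Lemma wcoef_bound k : 0 <= wcoef (S k) <= / INR (fact k).
Proof.
  unfold wcoef. generalize (fact_ge_1 (S k)) (fact_ge_1 k) (lt_0_INR (S k) ltac:(lia)). intros.
  assert (1 <= INR (S k)) by apply INR_S_ge_1.
  assert (INR (fact k) <= INR (fact (S k))). { rewrite fact_simpl, mult_INR. nra. }
  split. left; apply Rinv_0_lt_compat. nra. apply Rinv_le_contravar. lra.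
  assert (INR (fact (S k)) <= INR (fact (S k)) ^ 2) by nra. nra.
Qed.

Lemma wcoef_series_abs (b : nat -> R) (x A q : R) : 0 <= q -> (forall k, Rabs (b k) <= A * q ^ k) ->
  ex_series (fun k => Rabs (x ^ S k * wcoef (S k) * b k)).
Proof.
  intros Hq Hb.
  apply (ex_series_le_R _ (fun k => (A * Rabs x) * ((Rabs x * q) ^ k / INR (fact k)))).
  2: apply ex_series_scal_R, ex_series_exp.
  intros k. rewrite Rabs_Rabsolu, !Rabs_mult, (Rabs_pos_eq (wcoef _)) by apply wcoef_bound.
  rewrite <- RPow_abs, Rpow_mult_distr. generalize (wcoef_bound k) (Hb k) (Rabs_pos (b k)) (Rabs_pos x). intros.
  assert (0 <= Rabs x ^ k) by (apply pow_le; auto).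
  replace (A * Rabs x * (Rabs x ^ k * q ^ k / INR (fact k))) with ((Rabs x * Rabs x ^ k) * / INR (fact k) * (A * q ^ k)) by (unfold Rdiv; ring).
  assert (0 <= Rabs x * Rabs x ^ k) by (apply Rmult_le_pos; auto).
  change (Rabs x ^ S k) with (Rabs x * Rabs x ^ k). apply Rmult_le_compat; [apply Rmult_le_pos; lra|lra|apply Rmult_le_compat_l; lra|lra].
Qed.

Lemma square_le_exp p : 0 <= p -> p ^ 2 <= exp (2 * p).
Proof.
  intros Hp. replace (2 * p) with (p + p) by ring. rewrite exp_plus. generalize (exp_ineq1_le p). nra.
Qed.
Lemma exp_mult_INR a k : exp (a * INR k) = exp a ^ k.
Proof.
  induction k. simpl. rewrite Rmult_0_r, exp_0; auto.
  rewrite S_INR, Rmult_plus_distr_l, Rmult_1_r, exp_plus, IHk. simpl; ring.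
Qed.

(** The series - sum psi (k + 1) x^k / (k k!^2), as psi (k + 1) = H_k - gamma. *)
Definition DWi (x : R) : R := Series (fun j => x ^ S j * wcoef (S j) * (euler_gamma - harm (S j))).

Lemma gamma_harm_bound k : Rabs (euler_gamma - harm k) <= INR k + 1.
Proof. generalize euler_gamma_bounds (harm_bounds k). intros. apply Rabs_le. lra. Qed.

Lemma INR_le_pow2 k : INR k + 1 <= 2 ^ k.
Proof. induction k. simpl; lra. rewrite S_INR. simpl. generalize (pos_INR k). lra. Qed.

(** The k-th term at 1 + h is its value at 1 times exp ((gamma - H_k) h + O(h^2)).
    Its second-order remainder is at most h^2 times a factor exponential in k, which
    the factorials absorb; so the termwise first-order expansion may be summed. *)
Lemma Wi_derive x : is_derive (fun beta => Wi 1 beta x) 1 (DWi x).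
Proof.
  set (b := fun j : nat => (INR (S j) + 5) ^ 2 * exp (INR (S j) + 5) + 8).
  assert (SM : ex_series (fun j => Rabs (x ^ S j * wcoef (S j) * b j))).
  { apply (wcoef_series_abs b x (9 * exp 18) (exp 3)). left; apply exp_pos.
    intros k. unfold b. set (p := INR (S k) + 5). assert (Hp : 0 <= p) by (unfold p; generalize (pos_INR (S k)); lra).
    replace (9 * exp 18 * exp 3 ^ k) with (9 * exp (3 * p)).
    2:{ rewrite <- exp_mult_INR, Rmult_assoc, <- exp_plus. unfold p. rewrite S_INR. f_equal. f_equal. ring. }
    generalize (square_le_exp p Hp) (exp_pos p) (exp_ineq1_le (3 * p)) (pow2_ge_0 p). intros.
    rewrite Rabs_pos_eq by nra. replace (3 * p) with (2 * p + p) in * by ring. rewrite exp_plus in *. nra. }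
  set (M := Series (fun j => Rabs (x ^ S j * wcoef (S j) * b j))).
  assert (SD : ex_series (fun j => Rabs (x ^ S j * wcoef (S j) * (euler_gamma - harm (S j))))).
  { apply (wcoef_series_abs (fun j => euler_gamma - harm (S j)) x 2 2). lra.
    intros k. eapply Rle_trans. apply gamma_harm_bound. generalize (INR_le_pow2 (S k)). simpl; lra. }
  assert (S1 : ex_series (fun j => x ^ S j * wcoef (S j))).
  { apply ex_series_Rabs. apply (ex_series_ext (fun j => Rabs (x ^ S j * wcoef (S j) * (fun _ => 1) j))).
    intros; f_equal; ring. apply (wcoef_series_abs (fun _ => 1) x 1 1). lra. intros; rewrite pow1, Rabs_R1; lra. }
  assert (T : forall h j, Rabs h <= / 2 -> exists d, Rabs d <= h ^ 2 * b j /\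
    x ^ S j / (INR (S j) * INR (fact (S j))) * Re (rGamma (1 * INR (S j) + (1 + h))%R) =
    x ^ S j * wcoef (S j) + h * (x ^ S j * wcoef (S j) * (euler_gamma - harm (S j))) + x ^ S j * wcoef (S j) * d).
  { intros h j Hh. destruct (rGamma_near_nat h (S j) Hh) as [th [T1 T2]].
    replace (1 * INR (S j) + (1 + h)) with (1 + h + INR (S j)) by ring. rewrite T2.
    set (v := (euler_gamma - harm (S j)) * h + th) in *. exists ((exp v - 1 - v) + th). split.
    - generalize (gamma_harm_bound (S j)). set (p := INR (S j)). intros G.
      assert (0 <= p) by apply pos_INR.
      assert (Hh2 : h ^ 2 <= / 2 * Rabs h). { rewrite <- pow2_abs. generalize (Rabs_pos h). nra. }
      assert (Hv : Rabs v <= Rabs h * (p + 5)).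
      { unfold v. eapply Rle_trans. apply Rabs_triang. rewrite Rabs_mult. generalize (Rabs_pos h). nra. }
      assert (Hv2 : Rabs v <= p + 5) by nra.
      eapply Rle_trans. apply Rabs_triang. unfold b. fold p.
      generalize (exp_taylor1 v). intros Ht.
      assert (exp (Rabs v) <= exp (p + 5)) by (apply exp_le_compat; auto).
      assert (Rabs v * Rabs v <= h ^ 2 * (p + 5) ^ 2).
      { rewrite <- (pow2_abs h). replace (Rabs h ^ 2 * (p + 5) ^ 2) with ((Rabs h * (p + 5)) * (Rabs h * (p + 5))) by ring.
        apply Rmult_le_compat; auto; apply Rabs_pos. }
      assert (exp (Rabs v) * (Rabs v * Rabs v) <= exp (p + 5) * (h ^ 2 * (p + 5) ^ 2)).
      { apply Rmult_le_compat; auto. left; apply exp_pos. generalize (Rabs_pos v); nra. }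
      lra.
    - rewrite Re_RtoC. unfold wcoef, v. field. split. apply INR_fact_neq_0. apply not_0_INR. lia. }
  assert (EST : forall h, Rabs h <= / 2 -> Rabs (Wi 1 (1 + h) x - Series (fun j => x ^ S j * wcoef (S j)) - h * DWi x) <= h ^ 2 * M).
  { intros h Hh. unfold Wi, DWi, M. cbv zeta.
    set (f := fun j => x ^ S j / (INR (S j) * INR (fact (S j))) * Re (rGamma (1 * INR (S j) + (1 + h))%R)).
    set (g1 := fun j => x ^ S j * wcoef (S j)). set (g2 := fun j => x ^ S j * wcoef (S j) * (euler_gamma - harm (S j))).
    set (r := fun j => f j - g1 j - h * g2 j).
    assert (Hr : forall j, Rabs (r j) <= h ^ 2 * Rabs (g1 j * b j)).
    { intros j. destruct (T h j Hh) as [d [D1 D2]]. replace (r j) with (g1 j * d) by (unfold r, f, g1, g2; rewrite D2; ring).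
      rewrite !Rabs_mult. assert (0 <= b j). { unfold b. generalize (exp_pos (INR (S j) + 5)) (pow2_ge_0 (INR (S j) + 5)). nra. }
      rewrite (Rabs_pos_eq (b j)) by auto. rewrite (Rmult_comm (h ^ 2)), Rmult_assoc. apply Rmult_le_compat_l. apply Rabs_pos. lra. }
    assert (SMh : ex_series (fun j => h ^ 2 * Rabs (g1 j * b j))) by (apply ex_series_scal_R; exact SM).
    assert (SrA : ex_series (fun j => Rabs (r j))).
    { apply (ex_series_le_R _ (fun j => h ^ 2 * Rabs (g1 j * b j))); auto.
      intros; rewrite Rabs_Rabsolu. auto. }
    assert (Sr : ex_series r) by (apply ex_series_Rabs; auto).
    assert (S2 : ex_series g2) by (apply ex_series_Rabs; auto).
    assert (E : Series f = Series r + Series g1 + h * Series g2).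
    { rewrite <- Series_scal_l, <- !Series_plus; auto. apply Series_ext. intros; unfold r; ring.
      apply (ex_series_plus (V := R_NormedModule)); auto. apply ex_series_scal_R; auto. }
    rewrite E. replace (Series r + Series g1 + h * Series g2 - Series g1 - h * Series g2) with (Series r) by ring.
    rewrite <- Series_scal_l. eapply Rle_trans. apply Series_Rabs; auto.
    apply Series_le; auto. intros; split; auto. apply Rabs_pos. }
  assert (E0 := EST 0). rewrite Rabs_R0 in E0. specialize (E0 ltac:(lra)).
  assert (W0 : Wi 1 1 x = Series (fun j => x ^ S j * wcoef (S j))).
  { apply Rminus_diag_uniq. rewrite Rplus_0_r in E0.
    match type of E0 with Rabs ?z <= ?y => assert (Z : Rabs z = 0) by
      (replace y with 0 in E0 by ring; generalize (Rabs_pos z); lra) end.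
    apply Rabs_eq_0 in Z. lra. }
  assert (HM : 0 <= M). { generalize (EST (/ 2)). rewrite Rabs_pos_eq by lra. intros E. specialize (E ltac:(lra)).
    match type of E with Rabs ?z <= _ => generalize (Rabs_pos z) end. lra. }
  apply is_derive_Reals. intros eps He.
  assert (Hd : 0 < Rmin (/ 2) (eps / (M + 1))). { apply Rmin_pos. lra. apply Rdiv_lt_0_compat; lra. }
  exists (mkposreal _ Hd). simpl. intros h Hh0 Hh.
  assert (A1 : Rabs h <= / 2) by (generalize (Rmin_l (/ 2) (eps / (M + 1))); lra).
  assert (A2 : Rabs h < eps / (M + 1)) by (generalize (Rmin_r (/ 2) (eps / (M + 1))); lra).
  specialize (EST h A1). rewrite <- W0 in EST.
  replace ((Wi 1 (1 + h) x - Wi 1 1 x) / h - DWi x) with ((Wi 1 (1 + h) x - Wi 1 1 x - h * DWi x) / h) by (field; auto).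
  unfold Rdiv. rewrite Rabs_mult, Rabs_inv. assert (0 < Rabs h) by (apply Rabs_pos_lt; auto).
  apply (Rle_lt_trans _ (h ^ 2 * M * / Rabs h)). apply Rmult_le_compat_r; auto. left; apply Rinv_0_lt_compat; auto.
  rewrite <- pow2_abs. replace (Rabs h ^ 2 * M * / Rabs h) with (Rabs h * M) by (field; lra).
  apply (Rmult_lt_compat_r (M + 1)) in A2; [|lra]. replace (eps / (M + 1) * (M + 1)) with eps in A2 by (field; lra). nra.
Qed.

(** * Partial fractions of the squared Euler products *)

Fixpoint rsum (f : nat -> R) (n : nat) : R := match n with O => 0 | S j => rsum f j + f (S j) end.
Fixpoint csum (f : nat -> C) (n : nat) : C := match n with O => 0%C | S j => (csum f j + f (S j))%C end.

Lemma rsum_ext f g n : (forall k, (1 <= k <= n)%nat -> f k = g k) -> rsum f n = rsum g n.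
Proof. induction n; simpl; auto. intros E. rewrite IHn, E; auto; try lia. intros; apply E; lia. Qed.
Lemma csum_ext f g n : (forall k, (1 <= k <= n)%nat -> f k = g k) -> csum f n = csum g n.
Proof. induction n; simpl; auto. intros E. rewrite IHn, E; auto; try lia. intros; apply E; lia. Qed.
Lemma rsum_plus f g n : rsum (fun k => f k + g k) n = rsum f n + rsum g n.
Proof. induction n; simpl. ring. rewrite IHn. ring. Qed.
Lemma rsum_scal a f n : rsum (fun k => a * f k) n = a * rsum f n.
Proof. induction n; simpl. ring. rewrite IHn. ring. Qed.
Lemma csum_plus f g n : csum (fun k => f k + g k)%C n = (csum f n + csum g n)%C.
Proof. induction n; simpl. ring. rewrite IHn. ring. Qed.
Lemma csum_scal a f n : csum (fun k => a * f k)%C n = (a * csum f n)%C.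
Proof. induction n; simpl. ring. rewrite IHn. ring. Qed.
Lemma RtoC_rsum f n : RtoC (rsum f n) = csum (fun k => RtoC (f k)) n.
Proof. induction n; simpl. auto. rewrite RtoC_plus, IHn. auto. Qed.
Lemma is_derive_rsum (f df : nat -> R -> R) n v : (forall k, (1 <= k <= n)%nat -> is_derive (f k) v (df k v)) ->
  is_derive (fun y => rsum (fun k => f k y) n) v (rsum (fun k => df k v) n).
Proof.
  induction n; intros Hd; simpl. apply (is_derive_const (V := R_NormedModule)).
  apply (is_derive_plus (V := R_NormedModule)). apply IHn. intros; apply Hd; lia. apply Hd; lia.
Qed.

(** Coefficients of 1 / (u + k)^2 and 1 / (u + k) for k >= 1 in the expansion of
    n!^2 / (u (u)_{n+1}^2).  The second is the first times the logarithmic derivative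
    of the product of the other factors. *)
Definition pcoef2 (n k : nat) : R := - (INR (fact n) / (INR (fact k) * INR (fact (n - k)))) ^ 2 / INR k.
Definition pcoef1 (n k : nat) : R := pcoef2 n k * (/ INR k + 2 * harm k - 2 * harm (n - k)).

Definition pfrac (n : nat) (u : C) : C :=
  (1 / u ^ 3 + RtoC (- 2 * harm n) / u ^ 2 + RtoC (2 * harm n ^ 2 + harm2 n) / u +
   csum (fun k => RtoC (pcoef2 n k) / (u + INR k) ^ 2 + RtoC (pcoef1 n k) / (u + INR k)) n)%C.
Definition pfrac_R (n : nat) (v : R) : R :=
  1 / v ^ 3 + (- 2 * harm n) / v ^ 2 + (2 * harm n ^ 2 + harm2 n) / v +
   rsum (fun k => pcoef2 n k / (v + INR k) ^ 2 + pcoef1 n k / (v + INR k)) n.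
Definition dpfrac_R (n : nat) (v : R) : R :=
  - 3 / v ^ 4 + (4 * harm n) / v ^ 3 - (2 * harm n ^ 2 + harm2 n) / v ^ 2 +
   rsum (fun k => - 2 * pcoef2 n k / (v + INR k) ^ 3 - pcoef1 n k / (v + INR k) ^ 2) n.

(** This is [eulerG n u ^ 2 / u] without its exponential factor. *)
Definition sqG (n : nat) (u : C) : C := (RtoC (INR (fact n) ^ 2) / (u * Crising u (S n) ^ 2))%C.
Definition sqG_R (n : nat) (v : R) : R := INR (fact n) ^ 2 / (v * rising v (S n) ^ 2).

Lemma RtoC_rising v n : Crising (RtoC v) n = RtoC (rising v n).
Proof. induction n; simpl; auto. rewrite IHn, RtoC_mult, RtoC_plus. auto. Qed.
Lemma RtoC_pow a n : RtoC (a ^ n) = (RtoC a ^ n)%C.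
Proof. induction n; simpl; auto. rewrite RtoC_mult, IHn. auto. Qed.

Definition nonpole (n : nat) (u : C) := forall k, (k <= n)%nat -> (u + INR k)%C <> 0%C.
Lemma nonpole_Crising n u : nonpole n u -> Crising u (S n) <> 0%C.
Proof.
  induction n; intros P. simpl. apply Cmult_neq_0. apply RtoC_neq_0; lra. apply (P 0%nat); lia.
  change (Crising u (S (S n))) with (Crising u (S n) * (u + INR (S n)))%C. apply Cmult_neq_0.
  apply IHn. intros k Hk; apply P; lia. apply P; lia.
Qed.
Lemma nonpole_0 n u : nonpole n u -> u <> 0%C.
Proof. intros P E. apply (P 0%nat). lia. rewrite E. simpl. ring. Qed.

Lemma RtoC_pfrac n v : (forall k, (k <= n)%nat -> v + INR k <> 0) -> pfrac n (RtoC v) = RtoC (pfrac_R n v).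
Proof.
  intros P. assert (v <> 0). { generalize (P 0%nat ltac:(lia)). simpl. rewrite Rplus_0_r. auto. }
  unfold pfrac, pfrac_R. rewrite (RtoC_plus (_ + _) (rsum _ _)), RtoC_rsum. f_equal.
  { rewrite (RtoC_plus (_ + _ / _)), (RtoC_plus (1 / _)), !RtoC_div, !RtoC_pow; auto; apply pow_nonzero; auto. }
  apply csum_ext. intros k Hk. rewrite RtoC_plus, !RtoC_div, RtoC_pow, RtoC_plus; auto.
  apply P; lia. apply pow_nonzero, P; lia.
Qed.
Lemma RtoC_sqG n v : (forall k, (k <= n)%nat -> v + INR k <> 0) -> sqG n (RtoC v) = RtoC (sqG_R n v).
Proof.
  intros P. assert (V : v <> 0). { generalize (P 0%nat ltac:(lia)). simpl. rewrite Rplus_0_r. auto. }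
  assert (rising v (S n) <> 0).
  { intros E. apply (nonpole_Crising n (RtoC v)). intros k Hk. rewrite <- RtoC_plus. apply RtoC_neq_0, P; auto.
    rewrite RtoC_rising, E. auto. }
  unfold sqG, sqG_R. rewrite RtoC_rising. rewrite RtoC_div, (RtoC_mult v), !RtoC_pow; auto.
  apply Rmult_integral_contrapositive; split; auto. apply pow_nonzero; auto.
Qed.

Lemma is_derive_pfrac_R n v : (forall k, (k <= n)%nat -> v + INR k <> 0) -> is_derive (pfrac_R n) v (dpfrac_R n v).
Proof.
  intros P. assert (V : v <> 0). { generalize (P 0%nat ltac:(lia)). simpl. rewrite Rplus_0_r. auto. }
  unfold pfrac_R, dpfrac_R. apply (is_derive_plus (V := R_NormedModule)).
  - auto_derive. repeat split; auto. apply (pow_nonzero v 3); auto. toR. field. auto.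
  - apply (is_derive_rsum (fun k y => pcoef2 n k / (y + INR k) ^ 2 + pcoef1 n k / (y + INR k))
       (fun k v => - 2 * pcoef2 n k / (v + INR k) ^ 3 - pcoef1 n k / (v + INR k) ^ 2)).
    intros k Hk. specialize (P k ltac:(lia)). auto_derive.
    repeat split; auto. toR. field. auto.
Qed.

Lemma is_derive_rising n v : (forall k, (k <= n)%nat -> v + INR k <> 0) ->
  is_derive (fun y => rising y (S n)) v (rising v (S n) * sum_n (fun k => / (v + INR k)) n).
Proof.
  induction n; intros P.
  - simpl. rewrite sum_O. auto_derive; auto. simpl. specialize (P 0%nat ltac:(lia)). simpl in P. field. rewrite Rplus_0_r in P; auto.
  - apply (is_derive_ext (fun y => rising y (S n) * (y + INR (S n)))). reflexivity.
    rewrite sum_Sn. change (plus ?a ?b) with (a + b). change (rising v (S (S n))) with (rising v (S n) * (v + INR (S n))).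
    replace (rising v (S n) * (v + INR (S n)) * (sum_n (fun k => / (v + INR k)) n + / (v + INR (S n))))
      with (rising v (S n) * sum_n (fun k => / (v + INR k)) n * (v + INR (S n)) + rising v (S n) * 1).
    2:{ field. apply P; lia. }
    apply (is_derive_mult (K := R_AbsRing) (fun y => rising y (S n)) (fun y => y + INR (S n)) v (rising v (S n) * sum_n (fun k => / (v + INR k)) n) 1).
    apply IHn. intros; apply P; lia.
    auto_derive; auto. intros; apply Rmult_comm.
Qed.

Lemma rising_neg m : forall j, (j <= m)%nat -> rising (- INR m) j * INR (fact (m - j)) = (-1) ^ j * INR (fact m).
Proof.
  induction j; intros Hj. simpl. rewrite Nat.sub_0_r. ring.
  specialize (IHj ltac:(lia)). simpl rising. replace (m - j)%nat with (S (m - S j)) in IHj by lia.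
  rewrite fact_simpl, mult_INR in IHj. replace (INR (S (m - S j))) with (INR m - INR j) in IHj.
  2:{ rewrite <- minus_INR by lia. f_equal. lia. }
  simpl pow. transitivity (- (rising (- INR m) j * ((INR m - INR j) * INR (fact (m - S j))))). ring. rewrite IHj. ring.
Qed.
Lemma sum_inv_neg n m : (n < m)%nat -> sum_n (fun k => / (- INR m + INR k)) n = harm (m - S n) - harm m.
Proof.
  induction n; intros Hn.
  - rewrite sum_O. simpl (INR 0). rewrite Rplus_0_r. destruct m. lia. rewrite harm_S. replace (S m - 1)%nat with m by lia.
    toR. field. apply not_0_INR; lia.
  - rewrite sum_Sn, IHn by lia. change (plus ?a ?b) with (a + b). replace (m - S n)%nat with (S (m - S (S n))) by lia.
    rewrite harm_S. replace (S (m - S (S n)))%nat with (m - S n)%nat by lia. rewrite minus_INR by lia.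
    assert (INR (S n) < INR m) by (apply lt_INR; lia). toR. field. lra.
Qed.

(** Passing from n to n + 1 introduces a double pole at - (n + 1), whose two
    coefficients are the value and the derivative there of the expansion for n.  Since
    that expansion equals the rational function on a real neighbourhood of the point,
    both can be read off the product form. *)
Lemma pfrac_R_values n : (forall u, nonpole n u -> sqG n u = pfrac n u) ->
  let m := INR (S n) in pfrac_R n (- m) = - / m ^ 3 /\ dpfrac_R n (- m) = - / m ^ 3 * (/ m + 2 * harm (S n)).
Proof.
  intros HF m.
  assert (Hm : 1 <= m) by (unfold m; rewrite S_INR; generalize (pos_INR n); lra).
  assert (NP : forall v, Rabs (v + m) < / 2 -> forall k, (k <= n)%nat -> v + INR k <> 0).
  { intros v Hv k Hk. apply Rabs_lt_between in Hv. assert (INR k <= INR n) by (apply le_INR; auto).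
    unfold m in Hv. rewrite S_INR in Hv. lra. }
  assert (Heq : forall v, Rabs (v + m) < / 2 -> sqG_R n v = pfrac_R n v).
  { intros v Hv. apply RtoC_inj. rewrite <- RtoC_sqG, <- RtoC_pfrac; auto. apply HF. intros k Hk.
    rewrite <- RtoC_plus. apply RtoC_neq_0, NP; auto. }
  assert (H0 : Rabs (- m + m) < / 2) by (replace (- m + m) with 0 by ring; rewrite Rabs_R0; lra).
  assert (Hr : rising (- m) (S n) ^ 2 = INR (fact (S n)) ^ 2).
  { generalize (rising_neg (S n) (S n) ltac:(lia)). rewrite Nat.sub_diag. simpl (INR (fact 0)). rewrite Rmult_1_r. fold m. intros ->.
    rewrite Rpow_mult_distr, <- pow_mult, Nat.mul_comm, pow_mult. replace ((-1) ^ 2) with 1 by ring. rewrite pow1. ring. }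
  assert (Hf : INR (fact (S n)) = m * INR (fact n)) by (rewrite fact_simpl, mult_INR; auto).
  assert (V1 : sqG_R n (- m) = - / m ^ 3).
  { unfold sqG_R. rewrite Hr, Hf. generalize (INR_fact_neq_0 n). intros. field. split; lra. }
  split. rewrite <- Heq; auto.
  assert (D1 : is_derive (sqG_R n) (- m) (dpfrac_R n (- m))).
  { apply (is_derive_ext_loc (pfrac_R n)). 2: apply is_derive_pfrac_R, NP; auto.
    exists (mkposreal (/ 2) ltac:(lra)). intros y Hy. symmetry. apply Heq.
    unfold ball in Hy; simpl in Hy; unfold AbsRing_ball, abs, minus, plus, opp in Hy; simpl in Hy. replace (y + m) with (y + - - m) by ring. exact Hy. }
  assert (Hnz : rising (- m) (S n) <> 0).
  { intros E. rewrite E in Hr. generalize (INR_fact_neq_0 (S n)). intros Hne. apply (pow_nonzero _ 2) in Hne. rewrite <- Hr in Hne. apply Hne. ring. }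
  assert (D2 : is_derive (sqG_R n) (- m) (- / m ^ 3 * (/ m + 2 * harm (S n)))).
  { unfold sqG_R. generalize (is_derive_rising n (- m) (NP _ H0)). unfold m. rewrite sum_inv_neg by lia. rewrite Nat.sub_diag, harm_0. fold m. intros Dr.
    replace (- / m ^ 3 * (/ m + 2 * harm (S n))) with (INR (fact n) ^ 2 * (- (1 * rising (- m) (S n) ^ 2 + (- m) * (INR 2 * (rising (- m) (S n) * (0 - harm (S n))) * rising (- m) (S n) ^ 1)) / ((- m) * rising (- m) (S n) ^ 2) ^ 2)).
    2:{ transitivity (INR (fact n) ^ 2 * (- (1 + 2 * m * harm (S n)) / (m ^ 2 * rising (- m) (S n) ^ 2))).
        simpl (INR 2). field. split; auto; lra.
        rewrite Hr, Hf. generalize (INR_fact_neq_0 n). intros. field. split; lra. }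
    apply is_derive_scal.
    assert (D3 := is_derive_mult (K := R_AbsRing) (fun v : R => v) (fun v => rising v (S n) ^ 2) (- m) _ _
       (is_derive_id (K := R_AbsRing) (- m)) (is_derive_pow (fun v => rising v (S n)) 2 (- m) _ Dr) Rmult_comm).
    apply (is_derive_inv (fun v => v * rising v (S n) ^ 2) (- m) _ D3).
    apply Rmult_integral_contrapositive; split; [lra|]. apply pow_nonzero; auto. }
  apply is_derive_unique in D1, D2. congruence.
Qed.

Lemma pcoef2_S n k : (1 <= k <= n)%nat -> pcoef2 (S n) k = INR (S n) ^ 2 * pcoef2 n k / (INR (S n) - INR k) ^ 2.
Proof.
  intros Hk. unfold pcoef2. rewrite (fact_simpl n), mult_INR. replace (S n - k)%nat with (S (n - k)) by lia.
  rewrite (fact_simpl (n - k)), mult_INR. replace (INR (S (n - k))) with (INR (S n) - INR k).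
  2:{ rewrite <- minus_INR by lia. f_equal. lia. }
  assert (INR k < INR (S n)) by (apply lt_INR; lia). assert (0 < INR k) by (apply lt_0_INR; lia).
  generalize (INR_fact_neq_0 k) (INR_fact_neq_0 (n - k)). intros. field. repeat split; auto; lra.
Qed.
Lemma pcoef1_S n k : (1 <= k <= n)%nat -> pcoef1 (S n) k =
  INR (S n) ^ 2 * pcoef1 n k / (INR (S n) - INR k) ^ 2 - 2 * INR (S n) ^ 2 * pcoef2 n k / (INR (S n) - INR k) ^ 3.
Proof.
  intros Hk. unfold pcoef1. rewrite pcoef2_S by auto. replace (S n - k)%nat with (S (n - k)) by lia.
  rewrite harm_S. replace (INR (S (n - k))) with (INR (S n) - INR k).
  2:{ rewrite <- minus_INR by lia. f_equal. lia. }
  assert (INR k < INR (S n)) by (apply lt_INR; lia). assert (0 < INR k) by (apply lt_0_INR; lia).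
  field. lra.
Qed.
Lemma pcoef2_diag n : pcoef2 (S n) (S n) = - / INR (S n).
Proof.
  unfold pcoef2. rewrite Nat.sub_diag. simpl (INR (fact 0)). generalize (INR_fact_neq_0 (S n)) (lt_0_INR (S n) ltac:(lia)). intros. field. split; auto; lra.
Qed.
Lemma pcoef1_diag n : pcoef1 (S n) (S n) = - / INR (S n) * (/ INR (S n) + 2 * harm (S n)).
Proof. unfold pcoef1. rewrite pcoef2_diag, Nat.sub_diag, harm_0. ring. Qed.

(** Dividing a term by (u + m)^2: subtract its Taylor polynomial of degree 1 at - m;
    what remains is again of the form a / (u + k)^2 + b / (u + k). *)
Lemma pfrac_term (a b m k u : C) : (u + k <> 0)%C -> (u + m <> 0)%C -> (m - k <> 0)%C ->
  (m ^ 2 / (u + m) ^ 2 * (a / (u + k) ^ 2 + b / (u + k)) =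
   (m ^ 2 * a / (m - k) ^ 2 / (u + k) ^ 2 + (m ^ 2 * b / (m - k) ^ 2 - 2 * m ^ 2 * a / (m - k) ^ 3) / (u + k)) +
   m ^ 2 * (a / (- m + k) ^ 2 + b / (- m + k)) / (u + m) ^ 2 +
   m ^ 2 * (- 2 * a / (- m + k) ^ 3 - b / (- m + k) ^ 2) / (u + m))%C.
Proof.
  intros H1 H2 H3. assert (H4 : (- m + k <> 0)%C).
  { intros E. apply H3. replace (m - k)%C with (- (- m + k))%C by ring. rewrite E. ring. }
  field. repeat split; auto.
Qed.

(** Induction on n: the contributions at - (n + 1) of all the terms add up to the value
    and the derivative computed in [pfrac_R_values]. *)
Theorem partial_fractions n u : nonpole n u -> sqG n u = pfrac n u.
Proof.
  revert u. induction n as [|n IH]; intros u P.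
  - assert (u <> 0%C) by (apply (nonpole_0 0); auto). unfold sqG, pfrac. rewrite harm_0, harm2_0. simpl.
    replace (-2 * 0) with 0 by ring. replace (2 * (0 * (0 * 1)) + 0) with 0 by ring. replace (1 * (1 * 1)) with 1 by ring. field. auto.
  - destruct (pfrac_R_values n IH) as [V1 V2]. set (m := INR (S n)) in *.
    assert (Hm : 0 < m) by (apply lt_0_INR; lia).
    assert (HmC : RtoC m <> 0%C) by (apply RtoC_neq_0; lra).
    assert (U0 : u <> 0%C) by (apply (nonpole_0 (S n)); auto).
    assert (Um : (u + m)%C <> 0%C) by (apply P; lia).
    assert (PN : nonpole n u) by (intros k Hk; apply P; lia).
    assert (Cr := nonpole_Crising n u PN).
    assert (E : sqG (S n) u = (RtoC m ^ 2 / (u + m) ^ 2 * sqG n u)%C).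
    { unfold sqG. change (Crising u (S (S n))) with (Crising u (S n) * (u + m))%C.
      rewrite fact_simpl, mult_INR. fold m. rewrite Rpow_mult_distr, RtoC_mult, (RtoC_pow m). field. repeat split; auto. }
    rewrite E, IH by auto. unfold pfrac at 1. rewrite Cmult_plus_distr_l, <- csum_scal.
    rewrite (csum_ext _ (fun k => (RtoC (pcoef2 (S n) k) / (u + INR k) ^ 2 + RtoC (pcoef1 (S n) k) / (u + INR k)) +
       (m ^ 2 / (u + m) ^ 2 * RtoC (pcoef2 n k / (- m + INR k) ^ 2 + pcoef1 n k / (- m + INR k)) +
         m ^ 2 / (u + m) * RtoC (- 2 * pcoef2 n k / (- m + INR k) ^ 3 - pcoef1 n k / (- m + INR k) ^ 2)))%C).
    2:{ intros k Hk. rewrite pcoef2_S, pcoef1_S by auto. fold m.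
        assert (Hk' : INR k < m) by (apply lt_INR; lia).
        assert (N1 : m - INR k <> 0) by lra. assert (N2 : - m + INR k <> 0) by lra.
        rewrite !RtoC_plus, !RtoC_minus, !RtoC_div, !RtoC_mult, !RtoC_pow, RtoC_minus, RtoC_plus, RtoC_opp; try (apply pow_nonzero; auto); auto.
        rewrite (pfrac_term (pcoef2 n k) (pcoef1 n k) m (INR k) u). field.
        repeat split; auto. rewrite <- RtoC_opp, <- RtoC_plus. apply RtoC_neq_0; auto. rewrite <- RtoC_minus. apply RtoC_neq_0; auto.
        apply P; lia. apply P; lia. auto. rewrite <- RtoC_minus. apply RtoC_neq_0; auto. }
    rewrite !csum_plus, !csum_scal, <- !RtoC_rsum.
    assert (X1 : rsum (fun k => pcoef2 n k / (- m + INR k) ^ 2 + pcoef1 n k / (- m + INR k)) n =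
       - / m ^ 3 - (1 / (- m) ^ 3 + (- 2 * harm n) / (- m) ^ 2 + (2 * harm n ^ 2 + harm2 n) / (- m))).
    { rewrite <- V1. unfold pfrac_R. ring. }
    assert (X2 : rsum (fun k => - 2 * pcoef2 n k / (- m + INR k) ^ 3 - pcoef1 n k / (- m + INR k) ^ 2) n =
      - / m ^ 3 * (/ m + 2 * harm (S n)) - (- 3 / (- m) ^ 4 + (4 * harm n) / (- m) ^ 3 - (2 * harm n ^ 2 + harm2 n) / (- m) ^ 2)).
    { rewrite <- V2. unfold dpfrac_R. ring. }
    rewrite X1, X2. unfold pfrac.
    change (csum (fun k => RtoC (pcoef2 (S n) k) / (u + INR k) ^ 2 + RtoC (pcoef1 (S n) k) / (u + INR k))%C (S n)) with
      (csum (fun k => RtoC (pcoef2 (S n) k) / (u + INR k) ^ 2 + RtoC (pcoef1 (S n) k) / (u + INR k))%C n +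
        (RtoC (pcoef2 (S n) (S n)) / (u + m) ^ 2 + RtoC (pcoef1 (S n) (S n)) / (u + m)))%C.
    rewrite csum_plus. rewrite pcoef2_diag, pcoef1_diag, harm_S, harm2_S. fold m.
    set (s1 := csum (fun k => RtoC (pcoef2 (S n) k) / (u + INR k) ^ 2)%C n).
    set (s2 := csum (fun k => RtoC (pcoef1 (S n) k) / (u + INR k))%C n).
    set (h := harm n). set (h2 := harm2 n).
    replace (- / m ^ 3 - (1 / (- m) ^ 3 + -2 * h / (- m) ^ 2 + (2 * h ^ 2 + h2) / - m)) with
      (2 * h / m ^ 2 + (2 * h ^ 2 + h2) / m) by (field; lra).
    replace (- / m ^ 3 * (/ m + 2 * (h + / m)) - (-3 / (- m) ^ 4 + 4 * h / (- m) ^ 3 - (2 * h ^ 2 + h2) / (- m) ^ 2)) with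
      (2 * h / m ^ 3 + (2 * h ^ 2 + h2) / m ^ 2) by (field; lra).
    replace (- / m * (/ m + 2 * (h + / m))) with (- 3 / m ^ 2 - 2 * h / m) by (field; lra).
    replace (-2 * (h + / m)) with (- 2 * h - 2 / m) by (field; lra).
    replace (2 * (h + / m) ^ 2 + (h2 + / m ^ 2)) with (2 * h ^ 2 + h2 + 4 * h / m + 3 / m ^ 2) by (field; lra).
    assert (m ^ 2 <> 0) by (apply pow_nonzero; lra). assert (m ^ 3 <> 0) by (apply pow_nonzero; lra). assert (m <> 0) by lra.
    repeat (rewrite RtoC_plus || rewrite RtoC_minus || rewrite RtoC_mult || rewrite RtoC_opp || rewrite RtoC_pow || (rewrite RtoC_div by assumption) || (rewrite RtoC_inv by assumption)).
    field. repeat split; auto.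
Qed.

(** * Complex functions of a real variable *)

Definition Ccont (f : R -> C) := forall t, continuous (fun t => Re (f t)) t /\ continuous (fun t => Im (f t)) t.
Lemma Ccont_const c : Ccont (fun _ => c).
Proof. split; apply continuous_const. Qed.
Lemma Ccont_plus f g : Ccont f -> Ccont g -> Ccont (fun t => f t + g t)%C.
Proof. intros Hf Hg t. destruct (Hf t), (Hg t). split; apply (continuous_plus (V := R_NormedModule)); auto. Qed.
Lemma Ccont_mult f g : Ccont f -> Ccont g -> Ccont (fun t => f t * g t)%C.
Proof.
  intros Hf Hg t. destruct (Hf t), (Hg t). split; simpl.
  - apply (continuous_minus (V := R_NormedModule)); apply (continuous_mult (K := R_AbsRing)); auto.
  - apply (continuous_plus (V := R_NormedModule)); apply (continuous_mult (K := R_AbsRing)); auto.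
Qed.
Lemma Ccont_inv f : Ccont f -> (forall t, f t <> 0%C) -> Ccont (fun t => / f t)%C.
Proof.
  intros Hf Hn t. destruct (Hf t) as [H1 H2].
  assert (Hp : Re (f t) ^ 2 + Im (f t) ^ 2 <> 0).
  { rewrite <- Cmod_sqr. apply pow_nonzero, Rgt_not_eq, Cmod_gt_0, Hn. }
  assert (D : continuous (fun t => / (Re (f t) ^ 2 + Im (f t) ^ 2)) t).
  { apply continuous_Rinv_comp; auto. apply (continuous_plus (V := R_NormedModule)); simpl;
    apply (continuous_mult (K := R_AbsRing)); auto; apply (continuous_mult (K := R_AbsRing)); auto; apply continuous_const. }
  split; simpl.
  - apply (continuous_mult (K := R_AbsRing) (fun t => Re (f t)) (fun t => / (Re (f t) ^ 2 + Im (f t) ^ 2))); auto.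
  - apply (continuous_mult (K := R_AbsRing) (fun t => - Im (f t)) (fun t => / (Re (f t) ^ 2 + Im (f t) ^ 2))); auto.
    apply (continuous_opp (V := R_NormedModule)); auto.
Qed.
Lemma Ccont_Cexp f : Ccont f -> Ccont (fun t => Cexp (f t)).
Proof.
  intros Hf t. destruct (Hf t) as [H1 H2]. unfold Cexp. split; simpl; apply (continuous_mult (K := R_AbsRing)).
  1, 3: apply continuous_comp; auto; apply continuous_exp.
  - apply continuous_comp; auto; apply continuous_cos.
  - apply continuous_comp; auto; apply continuous_sin.
Qed.
Lemma Ccont_vline a : Ccont (fun t => (a, t)).
Proof. split; simpl; [apply continuous_const|apply continuous_id]. Qed.
Lemma Ccont_hline t : Ccont (fun a => (a, t)).
Proof. split; simpl; [apply continuous_id|apply continuous_const]. Qed.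
Lemma Ccont_ex_RInt f p q : Ccont f -> ex_RInt (fun t => Re (f t)) p q /\ ex_RInt (fun t => Im (f t)) p q.
Proof. intros Hf. split; apply (ex_RInt_continuous (V := R_CompleteNormedModule)); intros z _; destruct (Hf z); assumption. Qed.

Definition Cder (f : R -> C) (t : R) (l : C) :=
  is_derive (fun s => Re (f s)) t (Re l) /\ is_derive (fun s => Im (f s)) t (Im l).
Lemma Cder_mult f g t l m : Cder f t l -> Cder g t m -> Cder (fun s => f s * g s)%C t (l * g t + f t * m)%C.
Proof.
  intros [F1 F2] [G1 G2].
  assert (M := fun u v du dv => is_derive_mult (K := R_AbsRing) u v t du dv).
  split; simpl.
  - replace (_ + _) with (minus (plus (mult (Re l) (Re (g t))) (mult (Re (f t)) (Re m))) (plus (mult (Im l) (Im (g t))) (mult (Im (f t)) (Im m)))).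
    2:{ unfold minus, plus, opp, mult, Re, Im; simpl. ring. }
    apply (is_derive_minus (V := R_NormedModule)); apply M; auto using Rmult_comm.
  - replace (_ + _) with (plus (plus (mult (Re l) (Im (g t))) (mult (Re (f t)) (Im m))) (plus (mult (Im l) (Re (g t))) (mult (Im (f t)) (Re m)))).
    2:{ unfold plus, mult, Re, Im; simpl. ring. }
    apply (is_derive_plus (V := R_NormedModule)); apply M; auto using Rmult_comm.
Qed.

(** * The integrals of exp (u tau) / u ^ m along vertical lines *)

Lemma sumsq_pos (a t : R) : a <> 0 \/ t <> 0 -> 0 < a ^ 2 + t ^ 2.
Proof. generalize (pow2_ge_0 a) (pow2_ge_0 t). intros ? ? [H|H]; apply pow2_gt_0 in H; lra. Qed.
Lemma Cpair_neq_0 (a t : R) : a <> 0 \/ t <> 0 -> ((a, t) : C) <> 0%C.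
Proof. intros H E. inversion E. lra. Qed.
Lemma Cexp_pair (a t tau : R) : Cexp ((a, t) * tau)%C = (exp (a * tau) * cos (t * tau), exp (a * tau) * sin (t * tau)).
Proof.
  unfold Cexp, Re, Im; simpl. replace (a * tau - t * 0) with (a * tau) by ring.
  replace (a * 0 + t * tau) with (t * tau) by ring. reflexivity.
Qed.

(** This is exp (u tau) / u ^ m at u = a + i t. *)
Fixpoint ker (m : nat) (a t tau : R) : C :=
  match m with O => Cexp ((a, t) * tau)%C | S j => (ker j a t tau * / (a, t))%C end.

Lemma Cmod_ker m (a t tau : R) : a <> 0 \/ t <> 0 -> Cmod (ker m a t tau) = exp (a * tau) * (/ Cmod (a, t)) ^ m.
Proof.
  intros H. induction m; simpl ker.
  - rewrite Cmod_Cexp. simpl pow. rewrite Rmult_1_r. f_equal. unfold Re; simpl; ring.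
  - rewrite Cmod_mult, IHm, Cmod_inv by (apply Cpair_neq_0; auto). simpl; ring.
Qed.
Lemma ker_bound m (a t tau c : R) : 1 <= c -> c <= Rabs a \/ c <= Rabs t -> Cmod (ker (S m) a t tau) <= exp (a * tau) / c.
Proof.
  intros Hc Hct.
  assert (H : a <> 0 \/ t <> 0).
  { destruct Hct; [left|right]; intros ->; rewrite Rabs_R0 in *; lra. }
  assert (c <= Cmod (a, t)).
  { destruct Hct; eapply Rle_trans; eauto. apply (re_le_Cmod (a, t)). apply (im_le_Cmod (a, t)). }
  assert (0 < / Cmod (a, t) <= / c) by (split; [apply Rinv_0_lt_compat; lra|apply Rinv_le_contravar; lra]).
  assert (/ c <= 1) by (rewrite <- Rinv_1; apply Rinv_le_contravar; lra).
  rewrite Cmod_ker by auto. apply Rmult_le_compat_l; [left; apply exp_pos|].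
  assert ((/ Cmod (a, t)) ^ m <= 1) by (rewrite <- (pow1 m); apply pow_incr; lra).
  assert (0 <= (/ Cmod (a, t)) ^ m) by (apply pow_le; lra). simpl. nra.
Qed.
Lemma Ccont_ker m a tau : a <> 0 -> Ccont (fun t => ker m a t tau).
Proof.
  intros Ha. induction m; simpl.
  - apply Ccont_Cexp, Ccont_mult. apply Ccont_vline. apply Ccont_const.
  - apply Ccont_mult; auto. apply Ccont_inv. apply Ccont_vline. intros t; apply Cpair_neq_0; auto.
Qed.
Lemma Ccont_ker_h m t tau : t <> 0 -> Ccont (fun a => ker m a t tau).
Proof.
  intros Ha. induction m; simpl.
  - apply Ccont_Cexp, Ccont_mult. apply Ccont_hline. apply Ccont_const.
  - apply Ccont_mult; auto. apply Ccont_inv. apply Ccont_hline. intros a; apply Cpair_neq_0; auto.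
Qed.

Lemma Cder_ker1_tau a t tau : a <> 0 \/ t <> 0 -> Cder (fun y => ker 1 a t y) tau (ker 0 a t tau).
Proof.
  intros H. simpl.
  replace (Cexp ((a, t) * tau)) with ((a, t) * Cexp ((a, t) * tau) * / (a, t) + Cexp ((a, t) * tau) * 0)%C at 1.
  2:{ field. apply Cpair_neq_0; auto. }
  apply (Cder_mult (fun y : R => Cexp ((a, t) * y)) (fun _ => / (a, t))%C tau).
  - split.
    + apply (is_derive_ext (fun s => exp (a * s) * cos (t * s))). intros s. rewrite Cexp_pair. reflexivity.
      rewrite Cexp_pair. auto_derive; auto. unfold Re; simpl. ring.
    + apply (is_derive_ext (fun s => exp (a * s) * sin (t * s))). intros s. rewrite Cexp_pair. reflexivity.
      rewrite Cexp_pair. auto_derive; auto. unfold Im; simpl. ring.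
  - split; apply (is_derive_const (V := R_NormedModule)).
Qed.
(** Along the line du = i dt, which gives the factor [Ci]. *)
Lemma Cder_ker m a t tau : a <> 0 ->
  Cder (fun s => ker m a s tau) t (Ci * (tau * ker m a t tau - INR m * ker (S m) a t tau))%C.
Proof.
  intros Ha. induction m as [|m IH].
  - replace (Ci * _)%C with (Ci * tau * Cexp ((a, t) * tau))%C by (simpl; ring). simpl. split.
    + apply (is_derive_ext (fun s => exp (a * tau) * cos (s * tau))). intros s. rewrite Cexp_pair. reflexivity.
      rewrite Cexp_pair. auto_derive; auto. unfold Re; simpl. ring.
    + apply (is_derive_ext (fun s => exp (a * tau) * sin (s * tau))). intros s. rewrite Cexp_pair. reflexivity.
      rewrite Cexp_pair. auto_derive; auto. unfold Im; simpl. ring.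
  - assert (D : Cder (fun s => / (a, s))%C t (- Ci * (/ (a, t) * / (a, t)))%C).
    { generalize (sumsq_pos a t (or_introl Ha)). simpl. intros Hp. split; unfold Re, Im; simpl; auto_derive; try lra; field; lra. }
    replace (Ci * _)%C with (Ci * (tau * ker m a t tau - INR m * ker (S m) a t tau) * / (a, t) + ker m a t tau * (- Ci * (/ (a, t) * / (a, t))))%C.
    2:{ rewrite S_INR, RtoC_plus. simpl ker. ring. }
    apply (Cder_mult (fun s => ker m a s tau) (fun s => / (a, s))%C t); auto.
Qed.

Lemma continuity_2d_mult_id x y : continuity_2d_pt (fun u v => u * v) x y.
Proof. apply continuity_2d_pt_mult; [apply continuity_2d_pt_id1|apply continuity_2d_pt_id2]. Qed.

(** Differentiation in tau cancels the denominator u. *)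
Lemma is_derive_vert a T tau : a <> 0 ->
  is_derive (fun y => RInt (fun t => Re (ker 1 a t y)) (- T) T) tau
    (RInt (fun t => exp (a * tau) * cos (t * tau)) (- T) T).
Proof.
  intros Ha.
  assert (D : forall t y, is_derive (fun u => Re (ker 1 a t u)) y (exp (a * y) * cos (t * y))).
  { intros t y. destruct (Cder_ker1_tau a t y (or_introl Ha)) as [D _]. simpl ker at 2 in D. rewrite Cexp_pair in D. exact D. }
  rewrite <- (RInt_ext (fun t => Derive (fun u => Re (ker 1 a t u)) tau)).
  2:{ intros t _. apply is_derive_unique, D. }
  apply (is_derive_RInt_param (fun y t => Re (ker 1 a t y))).
  - apply filter_forall. intros y t _. eexists. apply D.
  - intros t _. apply (continuity_2d_pt_ext (fun u v => exp (a * u) * cos (v * u))).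
    { intros u v. symmetry. apply is_derive_unique, D. }
    apply continuity_2d_pt_mult.
    + apply (continuity_1d_2d_pt_comp (fun z => exp (a * z)) (fun u v => u)).
      2: apply continuity_2d_pt_id1.
      apply derivable_continuous_pt, ex_derive_Reals_0. auto_derive. trivial.
    + apply (continuity_1d_2d_pt_comp cos (fun u v => v * u)).
      { apply derivable_continuous_pt, derivable_pt_cos. }
      apply (continuity_2d_pt_ext (fun u v => u * v)); [intros; ring|apply continuity_2d_mult_id].
  - apply filter_forall. intros y. apply (Ccont_ex_RInt (fun t => ker 1 a t y)), Ccont_ker, Ha.
Qed.

Lemma is_derive_horiz T M s tau : T <> 0 ->
  is_derive (fun y => RInt (fun a => Im (ker 1 a T y)) M s) tau
    (RInt (fun a => exp (a * tau) * sin (T * tau)) M s).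
Proof.
  intros Ha.
  assert (D : forall a y, is_derive (fun u => Im (ker 1 a T u)) y (exp (a * y) * sin (T * y))).
  { intros t y. destruct (Cder_ker1_tau t T y (or_intror Ha)) as [_ D]. simpl ker at 2 in D. rewrite Cexp_pair in D. exact D. }
  rewrite <- (RInt_ext (fun a => Derive (fun u => Im (ker 1 a T u)) tau)).
  2:{ intros t _. apply is_derive_unique, D. }
  apply (is_derive_RInt_param (fun y a => Im (ker 1 a T y))).
  - apply filter_forall. intros y t _. eexists. apply D.
  - intros t _. apply (continuity_2d_pt_ext (fun u v => exp (v * u) * sin (T * u))).
    { intros u v. symmetry. apply is_derive_unique, D. }
    apply continuity_2d_pt_mult.
    + apply (continuity_1d_2d_pt_comp exp (fun u v => v * u)).
      { apply derivable_continuous_pt, derivable_pt_exp. }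
      apply (continuity_2d_pt_ext (fun u v => u * v)); [intros; ring|apply continuity_2d_mult_id].
    + apply (continuity_1d_2d_pt_comp (fun z => sin (T * z)) (fun u v => u)).
      2: apply continuity_2d_pt_id1.
      apply derivable_continuous_pt, ex_derive_Reals_0. auto_derive. trivial.
  - apply filter_forall. intros y. apply (Ccont_ex_RInt (fun a => ker 1 a T y)), Ccont_ker_h, Ha.
Qed.

Lemma RInt_primitive (F f : R -> R) p q :
  (forall t, is_derive F t (f t)) -> (forall t, continuous f t) -> RInt f p q = F q - F p.
Proof. intros D Hc. apply is_RInt_unique. apply (is_RInt_derive F f); auto. Qed.

Lemma RInt_exp_cos a T tau : tau <> 0 ->
  RInt (fun t => exp (a * tau) * cos (t * tau)) (- T) T = 2 * exp (a * tau) * sin (T * tau) / tau.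
Proof.
  intros Ht. rewrite (RInt_primitive (fun t => exp (a * tau) * sin (t * tau) / tau)).
  - replace (- T * tau) with (- (T * tau)) by ring. rewrite sin_neg. toR; field; auto.
  - intros x. auto_derive; [auto|]. field; auto.
  - intros x. apply ex_derive_continuous_R. auto_derive. trivial.
Qed.
Lemma RInt_exp_sin s M T tau : tau <> 0 ->
  RInt (fun a => exp (a * tau) * sin (T * tau)) M s = sin (T * tau) * (exp (s * tau) - exp (M * tau)) / tau.
Proof.
  intros Ht. rewrite (RInt_primitive (fun a => exp (a * tau) * sin (T * tau) / tau)).
  - toR; field; auto.
  - intros x. auto_derive; [auto|]. field; auto.
  - intros x. apply ex_derive_continuous_R. auto_derive. trivial.
Qed.

Lemma ker1_0 a t : a <> 0 \/ t <> 0 -> ker 1 a t 0 = (a / (a ^ 2 + t ^ 2), - t / (a ^ 2 + t ^ 2)).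
Proof.
  intros H. simpl. replace ((a, t) * 0)%C with (RtoC 0) by ring. rewrite Cexp_RtoC, exp_0.
  unfold Cmult, Cinv, RtoC; simpl. f_equal; ring.
Qed.
Lemma RInt_ker1_vert_0 a T : a <> 0 -> RInt (fun t => Re (ker 1 a t 0)) (- T) T = 2 * atan (T / a).
Proof.
  intros Ha. rewrite (RInt_primitive (fun t => atan (t / a))).
  - replace (- T / a) with (- (T / a)) by (field; auto). rewrite atan_opp. toR; ring.
  - intros x. rewrite (ker1_0 a x) by auto. unfold Re; cbn [fst]. auto_derive; [auto|].
    generalize (sumsq_pos a x (or_introl Ha)); intros H. toR. field. split; [lra|auto].
  - intros x. exact (proj1 (Ccont_ker 1 a 0 Ha x)).
Qed.
Lemma RInt_ker1_horiz_0 s M T : T <> 0 -> RInt (fun a => Im (ker 1 a T 0)) M s = atan (M / T) - atan (s / T).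
Proof.
  intros Ha. rewrite (RInt_primitive (fun a => - atan (a / T))).
  - toR; ring.
  - intros x. rewrite (ker1_0 x T) by auto. unfold Im; cbn [snd]. auto_derive; [auto|].
    generalize (sumsq_pos x T (or_intror Ha)); intros H. toR. field. split; [lra|auto].
  - intros x. exact (proj2 (Ccont_ker_h 1 T 0 Ha x)).
Qed.

Lemma atan_compl x y : 0 < x -> 0 < y -> atan (x / y) + atan (y / x) = PI / 2.
Proof.
  intros Hx Hy. replace (y / x) with (/ (x / y)) by (field; lra).
  rewrite atan_inv; [lra|]. apply Rdiv_lt_0_compat; auto.
Qed.

(** The residue theorem for exp (u tau) / u on the rectangle with corners
    s +- i T and - M +- i T, written for the real parts (the two horizontal sides
    are complex conjugate).  Differentiating in tau removes the pole: the
    derivative of each side is an integral of exp (u tau), and the four of them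
    cancel.  So the value is that at tau = 0, a sum of four arctangents. *)
Lemma rectangle_residue s M T tau : 0 < s -> 0 < M -> 0 < T ->
  RInt (fun t => Re (ker 1 s t tau)) (- T) T - RInt (fun t => Re (ker 1 (- M) t tau)) (- T) T
   - 2 * RInt (fun a => Im (ker 1 a T tau)) (- M) s = 2 * PI.
Proof.
  intros Hs HM HT.
  set (Phi y := RInt (fun t => Re (ker 1 s t y)) (- T) T - RInt (fun t => Re (ker 1 (- M) t y)) (- T) T
   - 2 * RInt (fun a => Im (ker 1 a T y)) (- M) s).
  change (Phi tau = 2 * PI).
  assert (H0 : Phi 0 = 2 * PI).
  { unfold Phi. rewrite !RInt_ker1_vert_0, RInt_ker1_horiz_0 by lra.
    replace (T / - M) with (- (T / M)) by (field; lra).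
    replace (- M / T) with (- (M / T)) by (field; lra).
    rewrite !atan_opp. generalize (atan_compl T s HT Hs) (atan_compl T M HT HM). lra. }
  assert (Hd : forall y, is_derive Phi y 0).
  { intros y.
    replace 0 with (RInt (fun t => exp (s * y) * cos (t * y)) (- T) T - RInt (fun t => exp (- M * y) * cos (t * y)) (- T) T
      - 2 * RInt (fun a => exp (a * y) * sin (T * y)) (- M) s).
    - unfold Phi. apply (is_derive_minus (V := R_NormedModule)). apply (is_derive_minus (V := R_NormedModule)).
      + apply is_derive_vert; lra.
      + apply is_derive_vert; lra.
      + apply is_derive_scal, is_derive_horiz; lra.
    - destruct (Req_dec y 0) as [->|Hy].
      + rewrite (RInt_ext (fun t => exp (s * 0) * cos (t * 0)) (fun t => 1)).
        2:{ intros; rewrite !Rmult_0_r, exp_0, cos_0; toR; ring. }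
        rewrite (RInt_ext (fun t => exp (- M * 0) * cos (t * 0)) (fun t => 1)).
        2:{ intros; rewrite !Rmult_0_r, exp_0, cos_0; toR; ring. }
        rewrite (RInt_ext (fun a => exp (a * 0) * sin (T * 0)) (fun t => 0)).
        2:{ intros; rewrite !Rmult_0_r, exp_0, sin_0; toR; ring. }
        rewrite !RInt_const. unfold scal; simpl; unfold mult; simpl. toR; ring.
      + rewrite !RInt_exp_cos, RInt_exp_sin by auto. field. auto. }
  assert (B := lipschitz_at_0 Phi (fun _ => 0) 0 tau Hd ltac:(intros; cbv beta; rewrite Rabs_R0; lra)).
  rewrite Rmult_0_l in B. rewrite <- H0. apply Rminus_diag_uniq, Rabs_eq_0. generalize (Rabs_pos (Phi tau - Phi 0)). lra.
Qed.

Lemma exp_decay a : 0 < a -> forall eps, 0 < eps -> exists M, 1 <= M /\ exp (- M * a) < eps.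
Proof.
  intros Ha eps He. exists (Rmax 1 (/ (eps * a))). split. apply Rmax_l.
  set (M := Rmax 1 (/ (eps * a))).
  assert (HM : / (eps * a) <= M) by apply Rmax_r. assert (HM1 : 1 <= M) by apply Rmax_l.
  assert (0 < eps * a) by nra.
  assert (H1 : 1 <= M * (eps * a)).
  { replace 1 with (/ (eps * a) * (eps * a)) by (field; nra). apply Rmult_le_compat_r; lra. }
  replace (- M * a) with (- (M * a)) by ring. rewrite exp_Ropp.
  generalize (exp_ineq1_le (M * a)) (exp_pos (M * a)). intros.
  apply (Rmult_lt_reg_r (exp (M * a))); auto. rewrite Rinv_l by lra. nra.
Qed.

(** The left side of the rectangle goes to - oo; the horizontal ones are O(1/T). *)
Lemma vert_estimate s T tau : 0 < s -> 1 < T -> 0 < tau ->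
  Rabs (RInt (fun t => Re (ker 1 s t tau)) (- T) T - 2 * PI) <= 2 * exp (s * tau) / tau / T.
Proof.
  intros Hs HT Htau.
  apply le_epsilon. intros eps He.
  destruct (exp_decay tau Htau (eps / (2 * T))) as [M [HM1 HM2]].
  { apply Rdiv_lt_0_compat; lra. }
  rewrite <- (rectangle_residue s M T tau) by lra.
  match goal with |- Rabs (?A - (?A - ?B - 2 * ?D)) <= _ => replace (A - (A - B - 2 * D)) with (B + 2 * D) by ring;
    set (b := B); set (d := D) end.
  assert (Hb : Rabs b <= eps).
  { eapply Rle_trans.
    - apply (abs_RInt_le_const _ (- T) T (exp (- M * tau))). lra.
      apply (Ccont_ex_RInt (fun t => ker 1 (- M) t tau)), Ccont_ker; lra.
      intros t Ht. eapply Rle_trans; [apply re_le_Cmod|]. eapply Rle_trans.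
      apply (ker_bound 0 (- M) t tau M); auto. left. rewrite Rabs_Ropp, Rabs_pos_eq; lra.
      rewrite <- (Rdiv_1_r (exp (- M * tau))) at 2. apply Rmult_le_compat_l. left; apply exp_pos.
      apply Rinv_le_contravar; lra.
    - apply (Rmult_lt_compat_l (2 * T)) in HM2; [|lra].
      replace (2 * T * (eps / (2 * T))) with eps in HM2 by (field; lra). lra. }
  assert (Hd : Rabs d <= exp (s * tau) / (tau * T)).
  { assert (HE := proj2 (Ccont_ex_RInt (fun a => ker 1 a T tau) (- M) s (Ccont_ker_h 1 T tau ltac:(lra)))).
    assert (HI : is_RInt (fun a => exp (a * tau) / T) (- M) s (minus (exp (s * tau) / (tau * T)) (exp (- M * tau) / (tau * T)))).
    { apply (is_RInt_derive (fun a => exp (a * tau) / (tau * T))).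
      - intros x _. auto_derive. auto. field. lra.
      - intros x _. apply ex_derive_continuous_R. auto_derive. lra. }
    eapply Rle_trans. apply abs_RInt_le; auto. lra.
    eapply Rle_trans. apply RInt_le with (g := fun a => exp (a * tau) / T). lra.
    - apply (ex_RInt_norm (fun a => Im (ker 1 a T tau))); auto.
    - eexists; exact HI.
    - intros x Hx. eapply Rle_trans; [apply im_le_Cmod|]. apply ker_bound; [lra|]. right. rewrite Rabs_pos_eq; lra.
    - rewrite (is_RInt_unique _ _ _ _ HI). unfold minus, plus, opp; simpl.
      assert (0 < exp (- M * tau) / (tau * T)). { apply Rdiv_lt_0_compat. apply exp_pos. nra. } lra. }
  eapply Rle_trans. apply Rabs_triang. rewrite Rabs_mult, (Rabs_pos_eq 2) by lra.
  replace (2 * exp (s * tau) / tau / T) with (2 * (exp (s * tau) / (tau * T))) by (field; lra). lra.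
Qed.

Lemma RInt_ker_by_parts m a tau p q : a <> 0 ->
  INR m * RInt (fun t => Re (ker (S m) a t tau)) p q =
  tau * RInt (fun t => Re (ker m a t tau)) p q - (Im (ker m a q tau) - Im (ker m a p tau)).
Proof.
  intros Ha.
  assert (E : is_RInt (fun t => tau * Re (ker m a t tau) - INR m * Re (ker (S m) a t tau)) p q (Im (ker m a q tau) - Im (ker m a p tau))).
  { apply (is_RInt_derive (fun t => Im (ker m a t tau))).
    - intros t _. replace (tau * _ - _) with (Im (Ci * (tau * ker m a t tau - INR m * ker (S m) a t tau))%C).
      apply Cder_ker; auto. unfold Re, Im; simpl. ring.
    - intros t _. apply (continuous_minus (V := R_NormedModule)); apply (continuous_mult (K := R_AbsRing)); try apply continuous_const.
      exact (proj1 (Ccont_ker m a tau Ha t)). exact (proj1 (Ccont_ker (S m) a tau Ha t)). }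
  assert (E1 := RInt_correct (V := R_CompleteNormedModule) _ _ _ (proj1 (Ccont_ex_RInt _ p q (Ccont_ker m a tau Ha)))).
  assert (E2 := RInt_correct (V := R_CompleteNormedModule) _ _ _ (proj1 (Ccont_ex_RInt _ p q (Ccont_ker (S m) a tau Ha)))).
  apply (is_RInt_scal (V := R_NormedModule) _ _ _ tau) in E1. apply (is_RInt_scal (V := R_NormedModule) _ _ _ (INR m)) in E2.
  assert (E3 := is_RInt_minus (V := R_NormedModule) _ _ _ _ _ _ E1 E2).
  apply (is_RInt_unique (V := R_CompleteNormedModule)) in E, E3.
  assert (EQ : tau * RInt (fun t => Re (ker m a t tau)) p q - INR m * RInt (fun t => Re (ker (S m) a t tau)) p q = Im (ker m a q tau) - Im (ker m a p tau)).
  { rewrite <- E. symmetry. exact E3. }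
  lra.
Qed.

Lemma is_lim_of_bound f L c : (forall T, 1 < T -> Rabs (f T - L) <= c / T) -> is_lim f p_infty L.
Proof.
  intros Hf. apply is_lim_spec. intros eps. simpl. exists (Rmax 1 (c / eps)). intros T HT.
  assert (1 < T) by (eapply Rle_lt_trans; [apply Rmax_l|apply HT]).
  assert (c / eps < T) by (eapply Rle_lt_trans; [apply Rmax_r|apply HT]).
  eapply Rle_lt_trans. apply Hf; auto.
  apply Rlt_div_l. lra. apply Rlt_div_l in H0. lra. apply cond_pos.
Qed.

(** Symmetric improper integral.  The real part is enough, since the imaginary parts of
    the integrands below are odd functions of t ([sqG_odd]). *)
Definition PV (f : R -> C) (L : R) :=
  (forall p q, ex_RInt (fun t => Re (f t)) p q) /\ is_lim (fun T => RInt (fun t => Re (f t)) (- T) T) p_infty L.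

Lemma PV_ext f g L : (forall t, f t = g t) -> PV f L -> PV g L.
Proof.
  intros E [H1 H2]. split.
  - intros p q. apply (ex_RInt_ext (fun t => Re (f t))); auto. intros; rewrite E; auto.
  - apply (is_lim_ext (fun T => RInt (fun t => Re (f t)) (- T) T)); auto. intros. apply RInt_ext. intros; rewrite E; auto.
Qed.
Lemma PV_plus f g L M : PV f L -> PV g M -> PV (fun t => f t + g t)%C (L + M).
Proof.
  intros [H1 H2] [H3 H4]. split.
  - intros p q. apply (ex_RInt_plus (V := R_NormedModule) (fun t => Re (f t)) (fun t => Re (g t))); auto.
  - apply (is_lim_ext (fun T => RInt (fun t => Re (f t)) (- T) T + RInt (fun t => Re (g t)) (- T) T)).
    + intros. symmetry. apply (RInt_plus (V := R_CompleteNormedModule) (fun t => Re (f t)) (fun t => Re (g t))); auto.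
    + apply is_lim_plus'; auto.
Qed.
Lemma PV_scal (a : R) f L : PV f L -> PV (fun t => a * f t)%C (a * L).
Proof.
  intros [H1 H2]. split.
  - intros p q. apply (ex_RInt_ext (fun t => a * Re (f t))). intros; rewrite Re_RtoC_mult; auto.
    apply (ex_RInt_scal (V := R_NormedModule) (fun t => Re (f t))); auto.
  - apply (is_lim_ext (fun T => a * RInt (fun t => Re (f t)) (- T) T)).
    + intros. transitivity (RInt (fun t => a * Re (f t)) (- y) y).
      * symmetry. apply (RInt_scal (V := R_CompleteNormedModule) (fun t => Re (f t))); auto.
      * apply RInt_ext. intros; rewrite Re_RtoC_mult; auto.
    + apply (is_lim_scal_l _ a p_infty L); auto.
Qed.
Lemma PV_csum (f : nat -> R -> C) (L : nat -> R) n : (forall k, (1 <= k <= n)%nat -> PV (f k) (L k)) ->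
  PV (fun t => csum (fun k => f k t) n) (rsum L n).
Proof.
  induction n; intros P; simpl.
  - split. intros. simpl. apply (ex_RInt_const (V := R_NormedModule)).
    apply (is_lim_ext (fun _ => 0)). intros. rewrite RInt_const. toR. unfold scal; simpl; unfold mult; simpl; ring. apply is_lim_const.
  - apply PV_plus. apply IHn. intros; apply P; lia. apply P; lia.
Qed.

(** Inversion of the Laplace transform of tau ^ m / m!.  The simple pole is the
    rectangle; integration by parts raises its order. *)
Lemma PV_ker m (a tau : R) : 0 < a -> 0 < tau -> PV (fun t => ker (S m) a t tau) (2 * PI * (tau ^ m / INR (fact m))).
Proof.
  intros Ha Ht. split. { intros p q. apply (Ccont_ex_RInt (fun t => ker (S m) a t tau)), Ccont_ker; lra. }
  induction m as [|m IH].
  - replace (2 * PI * (tau ^ 0 / INR (fact 0))) with (2 * PI) by (simpl; field).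
    apply (is_lim_of_bound _ _ (2 * exp (a * tau) / tau)). intros T HT. apply vert_estimate; lra.
  - assert (Hm : INR (S m) <> 0) by (apply INR_S_neq_0).
    apply (is_lim_ext (fun T => / INR (S m) * (tau * RInt (fun t => Re (ker (S m) a t tau)) (- T) T - (Im (ker (S m) a T tau) - Im (ker (S m) a (- T) tau))))).
    { intros T. rewrite <- RInt_ker_by_parts by lra. rewrite <- Rmult_assoc, Rinv_l by auto. apply Rmult_1_l. }
    replace (Finite (2 * PI * (tau ^ S m / INR (fact (S m))))) with
      (Finite (/ INR (S m) * (tau * (2 * PI * (tau ^ m / INR (fact m))) - 0))).
    2:{ f_equal. rewrite fact_simpl, mult_INR. simpl pow. generalize (INR_fact_neq_0 m). intros. field. auto. }
    apply (is_lim_scal_l _ (/ INR (S m)) p_infty (tau * (2 * PI * (tau ^ m / INR (fact m))) - 0)).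
    apply is_lim_minus'. apply (is_lim_scal_l _ tau p_infty (2 * PI * (tau ^ m / INR (fact m)))), IH.
    apply (is_lim_of_bound _ _ (2 * exp (a * tau))). intros T HT. rewrite Rminus_0_r.
    assert (B1 := Rle_trans _ _ _ (im_le_Cmod _) (ker_bound m a T tau T ltac:(lra) ltac:(right; rewrite Rabs_pos_eq; lra))).
    assert (B2 := Rle_trans _ _ _ (im_le_Cmod _) (ker_bound m a (- T) tau T ltac:(lra) ltac:(right; rewrite Rabs_Ropp, Rabs_pos_eq; lra))).
    eapply Rle_trans. apply Rabs_triang. rewrite Rabs_Ropp. lra.
Qed.

(** * The inverse Mellin transform of the squared Euler products *)

Lemma vline_shift (a t k : R) : ((a, t) + RtoC k)%C = ((a + k)%R, t).
Proof. unfold Cplus; simpl. f_equal. ring. Qed.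
Lemma Cexp_shift (a t k tau : R) : Cexp ((a, t) * tau) = (RtoC (exp (- k * tau)) * Cexp (((a + k)%R, t) * tau))%C.
Proof.
  rewrite <- Cexp_RtoC, <- Cexp_plus. f_equal. rewrite <- vline_shift, RtoC_mult, RtoC_opp. ring.
Qed.

(** The sum of the residues of exp (u tau) n!^2 / (u (u)_{n+1}^2). *)
Definition res_sum (n : nat) (tau : R) : R :=
  tau ^ 2 / 2 - 2 * harm n * tau + (2 * harm n ^ 2 + harm2 n) + rsum (fun k => exp (- INR k * tau) * (pcoef2 n k * tau + pcoef1 n k)) n.

Lemma PV_sqG n (a tau : R) : 0 < a -> 0 < tau -> PV (fun t => sqG n (a, t) * Cexp ((a, t) * tau))%C (2 * PI * res_sum n tau).
Proof.
  intros Ha Ht.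
  apply (PV_ext (fun t => RtoC 1 * ker 3 a t tau + RtoC (- 2 * harm n) * ker 2 a t tau
     + RtoC (2 * harm n ^ 2 + harm2 n) * ker 1 a t tau +
     csum (fun k => RtoC (pcoef2 n k * exp (- INR k * tau)) * ker 2 (a + INR k) t tau +
       RtoC (pcoef1 n k * exp (- INR k * tau)) * ker 1 (a + INR k) t tau) n)%C).
  { intros t. rewrite partial_fractions.
    2:{ intros k Hk. apply shift_neq_0. simpl. auto. }
    unfold pfrac. simpl ker.
    assert (N : ((a, t) : C) <> 0%C) by (apply Cpair_neq_0; lra).
    rewrite Cmult_plus_distr_r. f_equal. field; auto.
    rewrite Cmult_comm, <- csum_scal. apply csum_ext. intros k Hk.
    rewrite (Cexp_shift a t (INR k) tau), vline_shift, !RtoC_mult.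
    assert (N' : (((a + INR k)%R, t) : C) <> 0%C) by (apply Cpair_neq_0; generalize (pos_INR k); lra). field; auto. }
  assert (P1 : forall b, 0 < b -> PV (fun t => ker 1 b t tau) (2 * PI)).
  { intros b Hb. replace (2 * PI) with (2 * PI * (tau ^ 0 / INR (fact 0))) by (simpl; field). apply PV_ker; auto. }
  assert (P2 : forall b, 0 < b -> PV (fun t => ker 2 b t tau) (2 * PI * tau)).
  { intros b Hb. replace (2 * PI * tau) with (2 * PI * (tau ^ 1 / INR (fact 1))) by (simpl; field). apply PV_ker; auto. }
  assert (P3 : PV (fun t => ker 3 a t tau) (2 * PI * (tau ^ 2 / 2))) by (apply (PV_ker 2); auto).
  replace (2 * PI * res_sum n tau) with (1 * (2 * PI * (tau ^ 2 / 2)) + - 2 * harm n * (2 * PI * tau) + (2 * harm n ^ 2 + harm2 n) * (2 * PI)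
    + rsum (fun k => pcoef2 n k * exp (- INR k * tau) * (2 * PI * tau) + pcoef1 n k * exp (- INR k * tau) * (2 * PI)) n).
  2:{ unfold res_sum. rewrite (rsum_ext _ (fun k => 2 * PI * (exp (- INR k * tau) * (pcoef2 n k * tau + pcoef1 n k)))). rewrite rsum_scal. ring.
      intros; ring. }
  apply PV_plus. apply PV_plus. apply PV_plus. 1, 2, 3: apply PV_scal; auto.
  apply (PV_csum (fun k t => RtoC (pcoef2 n k * exp (- INR k * tau)) * ker 2 (a + INR k) t tau +
       RtoC (pcoef1 n k * exp (- INR k * tau)) * ker 1 (a + INR k) t tau)%C).
  intros k Hk. assert (0 < a + INR k) by (generalize (pos_INR k); lra). apply PV_plus; apply PV_scal; auto.
Qed.

(** * The sum of the inverse squares *)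

Lemma rsum_app f a b : rsum f (a + b) = rsum f a + rsum (fun k => f (a + k)%nat) b.
Proof. induction b; simpl. rewrite Nat.add_0_r; ring. rewrite <- plus_n_Sm. simpl. rewrite IHb. rewrite plus_n_Sm. ring. Qed.
Lemma rsum_S_l f n : rsum f (S n) = f 1%nat + rsum (fun k => f (S k)) n.
Proof. change (S n) with (1 + n)%nat. rewrite (rsum_app f 1 n). simpl. ring. Qed.
Lemma rsum_reflect f m : rsum f m = rsum (fun k => f (S m - k)%nat) m.
Proof.
  revert f. induction m; intros f; auto. rewrite rsum_S_l, (IHm (fun k => f (S k))). cbn [rsum].
  replace (S (S m) - S m)%nat with 1%nat by lia. rewrite Rplus_comm. f_equal. apply rsum_ext. intros k Hk. f_equal. lia.
Qed.
Lemma rsum_fold f N : (1 <= N)%nat -> rsum f (2 * N - 1) = rsum (fun k => f k + f (2 * N - k)%nat) (N - 1) + f N.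
Proof.
  intros HN. replace (2 * N - 1)%nat with (N + (N - 1))%nat by lia. rewrite rsum_app, rsum_plus.
  rewrite (rsum_reflect (fun k => f (N + k)%nat)).
  rewrite (rsum_ext (fun k => f (N + (S (N - 1) - k))%nat) (fun k => f (2 * N - k)%nat)).
  2:{ intros k Hk. f_equal. lia. }
  replace N with (S (N - 1)) at 1 by lia. simpl rsum at 1. replace (S (N - 1)) with N by lia. ring.
Qed.
Lemma rsum_le f g n : (forall k, (1 <= k <= n)%nat -> f k <= g k) -> rsum f n <= rsum g n.
Proof. induction n; simpl; intros L. lra. apply Rplus_le_compat. apply IHn; intros; apply L; lia. apply L; lia. Qed.
Lemma rsum_const c n : rsum (fun _ => c) n = INR n * c.
Proof. induction n. simpl; ring. simpl rsum. rewrite IHn, S_INR. ring. Qed.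

Definition csc2 (y : R) := / sin y ^ 2.

(** From sin y = 2 sin (y/2) cos (y/2) and cos (y/2) = sin (pi/2 - y/2). *)
Lemma csc2_double y : 0 < y < PI / 2 -> csc2 (y / 2) + csc2 (PI / 2 - y / 2) = 4 * csc2 y.
Proof.
  intros Hy. unfold csc2. rewrite sin_shift. replace y with (2 * (y / 2)) at 3 by field. rewrite sin_2a.
  assert (0 < sin (y / 2)) by (apply sin_gt_0; lra). assert (0 < cos (y / 2)) by (apply cos_gt_0; lra).
  generalize (sin2_cos2 (y / 2)). unfold Rsqr. intros E.
  transitivity ((sin (y / 2) * sin (y / 2) + cos (y / 2) * cos (y / 2)) / (sin (y / 2) ^ 2 * cos (y / 2) ^ 2)).
  field. lra. rewrite E. field. lra.
Qed.

Lemma x_cos_le_sin y : 0 < y < PI / 2 -> y * cos y <= sin y.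
Proof.
  intros Hy. destruct (MVT_gen (fun z => sin z - z * cos z) 0 y (fun z => z * sin z)) as [c [Hc1 Hc2]].
  - intros z _. auto_derive; auto. toR. ring.
  - intros z _. apply continuity_pt_filterlim. apply (ex_derive_continuous (V := R_NormedModule) (fun z => sin z - z * cos z)). auto_derive; auto.
  - rewrite Rmin_left, Rmax_right in Hc1 by lra. rewrite sin_0 in Hc2.
    assert (0 <= sin c) by (apply sin_ge_0; lra). assert (0 <= c * sin c) by nra. nra.
Qed.

Lemma csc2_bounds y : 0 < y < PI / 2 -> csc2 y - 1 <= / y ^ 2 <= csc2 y.
Proof.
  intros Hy. unfold csc2. assert (0 < sin y) by (apply sin_gt_0; lra). assert (0 < cos y) by (apply cos_gt_0; lra).
  generalize (sin2_cos2 y) (x_cos_le_sin y Hy) (sin_lt_x y ltac:(lra)). unfold Rsqr. intros E L1 L2. split.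
  - replace (/ sin y ^ 2 - 1) with ((1 - sin y ^ 2) / sin y ^ 2) by (field; lra).
    replace (1 - sin y ^ 2) with (cos y ^ 2) by (simpl; lra).
    replace (/ y ^ 2) with (/ y ^ 2 * sin y ^ 2 / sin y ^ 2) by (field; lra).
    unfold Rdiv. apply Rmult_le_compat_r. left; apply Rinv_0_lt_compat, pow_lt; auto.
    replace (cos y ^ 2) with (/ y ^ 2 * (y * cos y) ^ 2) by (field; lra).
    apply Rmult_le_compat_l. left; apply Rinv_0_lt_compat, pow_lt; lra. apply pow_incr. split; auto. nra.
  - apply Rinv_le_contravar. apply pow_lt; auto. apply pow_incr. lra.
Qed.

Definition csc_sum (n : nat) := rsum (fun k => csc2 (INR k * PI / (2 * 2 ^ n))) (2 ^ n - 1).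

Lemma INR_pow2 n : INR (2 ^ n) = 2 ^ n.
Proof. rewrite pow_INR. reflexivity. Qed.
Lemma pow2_ge_1 n : (1 <= 2 ^ n)%nat.
Proof. induction n; simpl; lia. Qed.
Lemma csc_angle n k : (1 <= k <= 2 ^ n - 1)%nat -> 0 < INR k * PI / (2 * 2 ^ n) < PI / 2.
Proof.
  intros Hk. assert (P : 0 < 2 ^ n) by (apply pow_lt; lra). assert (0 < INR k) by (apply lt_0_INR; lia).
  assert (INR k < 2 ^ n). { rewrite <- INR_pow2. apply lt_INR. lia. } generalize PI_RGT_0. intros.
  split. apply Rdiv_lt_0_compat; nra. apply Rlt_div_l. lra. nra.
Qed.

(** By the previous identity every angle k pi / 2^(n+1) is replaced by two angles of the
    next subdivision, placed symmetrically about pi / 4.  Only pi / 4 itself, where the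
    summand is 2, is missed: S_(n+1) = 4 S_n + 2. *)
Lemma csc_sum_val n : csc_sum n = 2 / 3 * (4 ^ n - 1).
Proof.
  induction n. unfold csc_sum. simpl. field.
  assert (P : 0 < 2 ^ n) by (apply pow_lt; lra).
  assert (E : csc_sum (S n) = 4 * csc_sum n + 2).
  { unfold csc_sum. replace (2 ^ S n - 1)%nat with (2 * 2 ^ n - 1)%nat by (simpl; lia).
    rewrite rsum_fold by apply pow2_ge_1. f_equal.
    - rewrite <- rsum_scal. apply rsum_ext. intros k Hk. rewrite <- csc2_double by (apply csc_angle; auto). f_equal.
      + f_equal. simpl. field. lra.
      + f_equal. rewrite minus_INR, mult_INR, INR_pow2 by lia. simpl. field. lra.
    - unfold csc2. rewrite INR_pow2. replace (2 ^ n * PI / (2 * 2 ^ S n)) with (PI / 4) by (simpl; field; lra).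
      rewrite sin_PI4. rewrite <- pow_inv. replace (/ (1 / sqrt 2)) with (sqrt 2).
      rewrite pow2_sqrt; lra. field. apply Rgt_not_eq, sqrt_lt_R0; lra. }
  rewrite E, IHn. simpl. field.
Qed.

Lemma rsum_harm2 n : rsum (fun k => / INR k ^ 2) n = harm2 n.
Proof. induction n. rewrite harm2_0; auto. rewrite harm2_S, <- IHn. reflexivity. Qed.

(** Comparing 1 / y^2 with 1 / sin(y)^2 costs at most 1 per summand, and the cosecant
    sum grows like 4^n while it has only 2^n summands. *)
Lemma harm2_cv : is_lim_seq harm2 (PI ^ 2 / 6).
Proof.
  assert (Hex : ex_finite_lim_seq harm2).
  { apply (ex_finite_lim_seq_incr _ 2). intros n. rewrite harm2_S.
    assert (0 < / INR (S n) ^ 2) by (apply Rinv_0_lt_compat, pow_lt, lt_0_INR; lia). lra. intros; apply harm2_nonneg_le. }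
  destruct Hex as [Z HZ].
  set (p := fun n => (2 ^ n - 1)%nat).
  assert (Hp : is_lim_seq (fun n => harm2 (p n)) Z).
  { apply (is_lim_seq_subseq harm2 Z p); auto. apply eventually_subseq. intros n. unfold p. simpl.
    assert (HH := pow2_ge_1 n). lia. }
  generalize PI_RGT_0; intros Pi0.
  assert (B : forall n, PI ^ 2 / 4 * (2 / 3 * (1 - (/ 4) ^ n) - (/ 2) ^ n) <= harm2 (p n) <= PI ^ 2 / 4 * (2 / 3 * (1 - (/ 4) ^ n))).
  { intros n. assert (P : 0 < 2 ^ n) by (apply pow_lt; lra). assert (P4 : 4 ^ n = 2 ^ n * 2 ^ n).
    { rewrite <- Rpow_mult_distr. replace (2 * 2) with 4 by ring. auto. }
    assert (E : harm2 (p n) = PI ^ 2 / 4 * / 4 ^ n * rsum (fun k => / (INR k * PI / (2 * 2 ^ n)) ^ 2) (p n)).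
    { rewrite <- rsum_harm2, <- rsum_scal. apply rsum_ext. intros k Hk. rewrite P4. field.
      repeat split; try lra. apply not_0_INR; lia. }
    assert (U : rsum (fun k => / (INR k * PI / (2 * 2 ^ n)) ^ 2) (p n) <= csc_sum n).
    { apply rsum_le. intros k Hk. apply csc2_bounds, csc_angle; auto. }
    assert (L : csc_sum n - 2 ^ n <= rsum (fun k => / (INR k * PI / (2 * 2 ^ n)) ^ 2) (p n)).
    { apply Rle_trans with (rsum (fun k => csc2 (INR k * PI / (2 * 2 ^ n)) + - 1) (p n)).
      rewrite rsum_plus, rsum_const. fold (p n). unfold csc_sum. fold (p n).
      assert (INR (p n) <= 2 ^ n). { rewrite <- INR_pow2. apply le_INR. unfold p; lia. } lra.
      apply rsum_le. intros k Hk. generalize (csc2_bounds _ (csc_angle n k Hk)). lra. }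
    rewrite csc_sum_val in *. rewrite E, !pow_inv.
    assert (P4' : 0 < 4 ^ n) by (apply pow_lt; lra).
    assert (Hc : 0 < PI ^ 2 / 4 * / 4 ^ n). { apply Rmult_lt_0_compat. apply Rdiv_lt_0_compat; try lra. apply pow_lt; auto. apply Rinv_0_lt_compat; auto. }
    split.
    - replace (PI ^ 2 / 4 * (2 / 3 * (1 - / 4 ^ n) - / 2 ^ n)) with (PI ^ 2 / 4 * / 4 ^ n * (2 / 3 * (4 ^ n - 1) - 2 ^ n)).
      apply Rmult_le_compat_l; lra. rewrite P4. field. lra.
    - replace (PI ^ 2 / 4 * (2 / 3 * (1 - / 4 ^ n))) with (PI ^ 2 / 4 * / 4 ^ n * (2 / 3 * (4 ^ n - 1))).
      apply Rmult_le_compat_l; lra. field. lra. }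
  assert (Lg : forall q, 0 < q < 1 -> is_lim_seq (fun n => q ^ n) 0).
  { intros q Hq. apply is_lim_seq_geom. rewrite Rabs_pos_eq; lra. }
  assert (S1 : is_lim_seq (fun n => harm2 (p n)) (PI ^ 2 / 6)).
  { apply (is_lim_seq_le_le _ _ _ _ B).
    - replace (PI ^ 2 / 6) with (PI ^ 2 / 4 * (2 / 3 * (1 - 0) - 0)) by field.
      apply is_lim_seq_mult'. apply is_lim_seq_const. apply is_lim_seq_minus'; [|apply Lg; lra].
      apply is_lim_seq_mult'. apply is_lim_seq_const. apply is_lim_seq_minus'. apply is_lim_seq_const. apply Lg; lra.
    - replace (PI ^ 2 / 6) with (PI ^ 2 / 4 * (2 / 3 * (1 - 0))) by field.
      apply is_lim_seq_mult'. apply is_lim_seq_const.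
      apply is_lim_seq_mult'. apply is_lim_seq_const. apply is_lim_seq_minus'. apply is_lim_seq_const. apply Lg; lra. }
  apply is_lim_seq_unique in S1, Hp. rewrite S1 in Hp. rewrite Hp. auto.
Qed.

(** * The limit of the residue sums *)

(** Dominated convergence for series: a tail of the sum of M bounds the tails for all n
    at once, and only finitely many terms remain. *)
Lemma tannery (b : nat -> nat -> R) (l M : nat -> R) : (forall n j, Rabs (b n j) <= M j) -> ex_series M ->
  (forall j, is_lim_seq (fun n => b n j) (l j)) -> is_lim_seq (fun n => Series (b n)) (Series l).
Proof.
  intros Hb HM Hl.
  assert (Hl' : forall j, Rabs (l j) <= M j).
  { intros j. apply (is_lim_seq_le (fun n => Rabs (b n j)) (fun _ => M j) (Rabs (l j)) (M j)); auto.
    apply (is_lim_seq_abs _ (l j)); auto. apply is_lim_seq_const. }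
  assert (ES : forall a : nat -> R, (forall j, Rabs (a j) <= M j) -> ex_series a).
  { intros a Ha. apply (ex_series_le_R a M); auto. }
  assert (Tail : is_lim_seq (fun N => Series M - sum_n M N) 0).
  { replace (Finite 0) with (Finite (Series M - Series M)) by (f_equal; ring).
    apply is_lim_seq_minus'. apply is_lim_seq_const. apply (Series_correct M HM). }
  apply is_lim_seq_spec. intros eps.
  apply is_lim_seq_spec in Tail. destruct (Tail (mkposreal (eps / 4) ltac:(generalize (cond_pos eps); lra))) as [N HN].
  specialize (HN N (le_n N)). simpl in HN. rewrite Rminus_0_r in HN.
  assert (Fin : forall N, is_lim_seq (fun n => sum_n (fun j => Rabs (b n j - l j)) N) 0).
  { assert (F1 : forall j, is_lim_seq (fun n => Rabs (b n j - l j)) 0).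
    { intros j. replace (Finite 0) with (Rbar_abs (l j - l j)) by (simpl; f_equal; rewrite Rminus_diag, Rabs_R0; auto).
      apply is_lim_seq_abs. apply is_lim_seq_minus'; auto. apply is_lim_seq_const. }
    induction N0. apply (is_lim_seq_ext (fun n => Rabs (b n 0%nat - l 0%nat))). intros; rewrite sum_O; auto. apply F1.
    apply (is_lim_seq_ext (fun n => sum_n (fun j => Rabs (b n j - l j)) N0 + Rabs (b n (S N0) - l (S N0)))). intros; rewrite sum_Sn; auto.
    replace (Finite 0) with (Finite (0 + 0)) by (f_equal; ring). apply is_lim_seq_plus'; auto. }
  specialize (Fin N). apply is_lim_seq_spec in Fin.
  destruct (Fin (mkposreal (eps / 4) ltac:(generalize (cond_pos eps); lra))) as [n0 Hn0].
  exists n0. intros n Hn. specialize (Hn0 n Hn). simpl in Hn0. rewrite Rminus_0_r in Hn0.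
  rewrite <- Series_minus by (apply ES; auto).
  set (c := fun j => b n j - l j). fold c in Hn0.
  assert (Hc : forall j, Rabs (c j) <= 2 * M j).
  { intros j. unfold c. eapply Rle_trans. apply Rabs_triang. rewrite Rabs_Ropp. generalize (Hb n j) (Hl' j). lra. }
  assert (E2 : ex_series (fun j => 2 * M j)) by (apply ex_series_scal_R; auto).
  assert (EA : ex_series (fun j => Rabs (c j))).
  { apply (ex_series_le_R _ (fun j => 2 * M j)); auto.
    intros. rewrite Rabs_Rabsolu. auto. }
  eapply Rle_lt_trans. apply Series_Rabs; auto.
  rewrite (Series_incr_n _ (S N)) by (auto; lia). simpl pred. rewrite <- sum_n_Reals.
  rewrite (Series_incr_n M (S N)) in HN by (auto; lia). simpl pred in HN. rewrite <- sum_n_Reals in HN.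
  replace (sum_n (fun k => M k) N + Series (fun k => M (S N + k)%nat) - sum_n M N) with (Series (fun k => M (S N + k)%nat)) in HN by (change (sum_n (fun k => M k) N) with (sum_n M N); ring).
  assert (L : Series (fun k => Rabs (c (S N + k)%nat)) <= 2 * Series (fun k => M (S N + k)%nat)).
  { rewrite <- Series_scal_l. apply Series_le. intros; split; auto. apply Rabs_pos.
    apply (ex_series_incr_n (fun j => 2 * M j) (S N)) in E2. auto. }
  apply Rabs_def2 in HN. apply Rabs_def2 in Hn0. generalize (cond_pos eps).
  change (sum_n (fun k => Rabs (c k)) N) with (sum_n (fun j => Rabs (c j)) N). intros.
  assert (Hn0' : sum_n (fun j => Rabs (c j)) N < eps / 4) by (apply Hn0). lra.
Qed.

Lemma Series_finite (a : nat -> R) n : (forall j, (n <= j)%nat -> a j = 0) -> Series a = rsum (fun k => a (pred k)) n.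
Proof.
  intros Ha. apply is_series_unique.
  assert (E : forall m, (n <= m)%nat -> sum_n a m = rsum (fun k => a (pred k)) n).
  { assert (F : forall m, sum_n a m = rsum (fun k => a (pred k)) (S m)).
    { induction m. rewrite sum_O. simpl; toR; ring. rewrite sum_Sn, IHm. reflexivity. }
    intros m Hm. rewrite F. replace (S m) with (n + (S m - n))%nat by lia. rewrite rsum_app.
    rewrite (rsum_ext (fun k => a (pred (n + k))) (fun _ => 0)). rewrite rsum_const. toR; ring. intros k Hk. apply Ha. lia. }
  change (is_lim_seq (sum_n a) (rsum (fun k => a (pred k)) n)).
  apply (is_lim_seq_ext_loc (fun _ => rsum (fun k => a (pred k)) n)). exists n. intros; symmetry; apply E; auto. apply is_lim_seq_const.
Qed.

(** The factors that depend on n in the k-th residue: n (n - 1) ... (n - k + 1) / n^k,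
    which tends to 1, and H_(n-k) - ln n, which tends to gamma. *)
Definition falling (n k : nat) : R := INR (fact n) / (INR (fact (n - k)) * INR n ^ k).

Lemma falling_S n k : (1 <= n)%nat -> (k < n)%nat -> falling n (S k) = falling n k * (1 - INR k / INR n).
Proof.
  intros Hn Hk. unfold falling. replace (n - k)%nat with (S (n - S k)) by lia. rewrite (fact_simpl (n - S k)), mult_INR.
  replace (INR (S (n - S k))) with (INR n - INR k). 2:{ rewrite <- minus_INR by lia. f_equal; lia. }
  assert (0 < INR n) by (apply lt_0_INR; lia). assert (INR k < INR n) by (apply lt_INR; lia).
  generalize (INR_fact_neq_0 (n - S k)). intros. simpl pow. field. repeat split; try lra. apply pow_nonzero; lra.
Qed.
Lemma falling_0 n : falling n 0 = 1.
Proof. unfold falling. rewrite Nat.sub_0_r. simpl. field. apply INR_fact_neq_0. Qed.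
Lemma falling_bounds n k : (1 <= n)%nat -> (k <= n)%nat -> 0 <= falling n k <= 1.
Proof.
  intros Hn. induction k; intros Hk. rewrite falling_0; lra. specialize (IHk ltac:(lia)).
  rewrite falling_S by lia. assert (0 < INR n) by (apply lt_0_INR; lia). assert (INR k < INR n) by (apply lt_INR; lia).
  assert (0 <= INR k / INR n <= 1). { split. apply Rdiv_le_0_compat; auto. apply pos_INR. apply Rle_div_l; lra. } nra.
Qed.
Lemma falling_cv k : is_lim_seq (fun n => falling n k) 1.
Proof.
  induction k. apply (is_lim_seq_ext (fun _ => 1)). intros; rewrite falling_0; auto. apply is_lim_seq_const.
  apply (is_lim_seq_ext_loc (fun n => falling n k * (1 - INR k / INR n))). exists (S k). intros; rewrite falling_S; auto; lia.
  replace (Finite 1) with (Finite (1 * (1 - 0))) by (f_equal; ring). apply is_lim_seq_mult'; auto.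
  apply is_lim_seq_minus'. apply is_lim_seq_const. apply is_lim_seq_div_INR.
Qed.

Definition harm_gap (n k : nat) := harm (n - k) - ln (INR n).
Lemma harm_gap_S n k : (k < n)%nat -> harm_gap n (S k) = harm_gap n k - / (INR n - INR k).
Proof.
  intros Hk. unfold harm_gap. replace (n - k)%nat with (S (n - S k)) by lia. rewrite harm_S.
  replace (INR (S (n - S k))) with (INR n - INR k). 2:{ rewrite <- minus_INR by lia. f_equal; lia. } ring.
Qed.
Lemma harm_gap_bounds n k : (1 <= n)%nat -> (k <= n)%nat -> Rabs (harm_gap n k) <= INR k + 1.
Proof.
  intros Hn Hk. apply Rabs_le. assert (G : - INR k <= harm_gap n k <= 1).
  { induction k. unfold harm_gap. rewrite Nat.sub_0_r. generalize (harm_minus_ln n Hn). simpl; lra.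
    specialize (IHk ltac:(lia)). rewrite harm_gap_S, S_INR by lia.
    assert (INR (S k) <= INR n) by (apply le_INR; lia). rewrite S_INR in H.
    assert (0 < / (INR n - INR k) <= 1). { split. apply Rinv_0_lt_compat; lra. rewrite <- Rinv_1. apply Rinv_le_contravar; lra. } lra. }
  generalize (pos_INR k). lra.
Qed.
Lemma harm_gap_cv k : is_lim_seq (fun n => harm_gap n k) euler_gamma.
Proof.
  induction k. apply (is_lim_seq_ext (fun n => harm n - ln (INR n))). intros; unfold harm_gap; rewrite Nat.sub_0_r; auto. apply is_lim_seq_euler_gamma.
  apply (is_lim_seq_ext_loc (fun n => harm_gap n k - / (INR n - INR k))). exists (S k). intros; rewrite harm_gap_S; auto.
  replace (Finite euler_gamma) with (Finite (euler_gamma - 0)) by (f_equal; ring). apply is_lim_seq_minus'; auto.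
  apply (is_lim_seq_inv (fun n => INR n - INR k) p_infty); [|discriminate].
  apply (is_lim_seq_minus _ _ p_infty (INR k)). apply is_lim_seq_INR. apply is_lim_seq_const. reflexivity.
Qed.

Definition gterm (L x : R) (k : nat) : R := x ^ k * wcoef k * (L + 2 * euler_gamma - 2 * harm k - / INR k).
Definition Gpos (x : R) : R := (2 * euler_gamma + ln x) ^ 2 / 2 + PI ^ 2 / 6 + Series (fun j => gterm (ln x) x (S j)).

(** Here exp tau = n^2 / x, so that the powers of n combine with the factorials. *)
Lemma res_sum_term n k x : (1 <= k <= n)%nat -> 0 < x ->
  let tau := 2 * ln (INR n) - ln x in
  exp (- INR k * tau) * (pcoef2 n k * tau + pcoef1 n k) = x ^ k * wcoef k * (falling n k) ^ 2 * (ln x + 2 * harm_gap n k - 2 * harm k - / INR k).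
Proof.
  intros Hk Hx tau.
  assert (Hn : 0 < INR n) by (apply lt_0_INR; lia).
  assert (E : exp (- INR k * tau) = x ^ k / (INR n ^ k) ^ 2).
  { unfold tau. replace (- INR k * (2 * ln (INR n) - ln x)) with (ln x * INR k + (- ln (INR n) * INR k + - ln (INR n) * INR k)) by ring.
    rewrite !exp_plus, !exp_mult_INR, exp_Ropp, !exp_ln by auto. rewrite pow_inv. field. apply pow_nonzero; lra. }
  rewrite E. unfold pcoef1, pcoef2, wcoef, falling, harm_gap, tau.
  assert (0 < INR k) by (apply lt_0_INR; lia). assert (INR n ^ k <> 0) by (apply pow_nonzero; lra).
  field. repeat split; auto; try apply INR_fact_neq_0; lra.
Qed.

(** The pole at 0 contributes (2 (H_n - ln n) + ln x)^2 / 2 + sum_(k <= n) 1 / k^2 after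
    completing the square; for the others the series theorem applies, as the k-th
    factor grows at most linearly in k, uniformly in n. *)
Lemma res_sum_cv x : 0 < x -> is_lim_seq (fun n => res_sum n (2 * ln (INR n) - ln x)) (Gpos x).
Proof.
  intros Hx. set (L := ln x).
  set (b := fun n j => if Compare_dec.le_dec (S j) n then x ^ S j * wcoef (S j) * (falling n (S j)) ^ 2 * (L + 2 * harm_gap n (S j) - 2 * harm (S j) - / INR (S j)) else 0).
  set (K := fun j => Rabs L + 5 * INR (S j) + 3).
  set (M := fun j => Rabs (x ^ S j * wcoef (S j) * K j)).
  assert (HM : ex_series M).
  { unfold M. apply (wcoef_series_abs K x ((Rabs L + 10)) 2). lra. intros k. unfold K.
    generalize (Rabs_pos L) (pos_INR (S k)) (INR_le_pow2 k). rewrite S_INR. intros.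
    rewrite Rabs_pos_eq by lra. assert (1 <= 2 ^ k) by (generalize (pos_INR k); lra). nra. }
  assert (Hb : forall n j, Rabs (b n j) <= M j).
  { intros n j. unfold b, M. destruct (Compare_dec.le_dec (S j) n). 2: rewrite Rabs_R0; apply Rabs_pos.
    assert (B := harm_gap_bounds n (S j) ltac:(lia) l). assert (R := falling_bounds n (S j) ltac:(lia) l).
    rewrite !(Rabs_mult (x ^ S j * wcoef (S j))), (Rmult_assoc (x ^ S j * wcoef (S j))).
    rewrite (Rabs_mult (x ^ S j * wcoef (S j))). apply Rmult_le_compat_l. apply Rabs_pos.
    rewrite Rabs_mult. assert (0 <= falling n (S j) ^ 2 <= 1) by nra. rewrite (Rabs_pos_eq (falling n (S j) ^ 2)) by lra.
    assert (0 <= K j). { unfold K. generalize (Rabs_pos L) (pos_INR (S j)). lra. }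
    rewrite (Rabs_pos_eq (K j)) by auto.
    assert (Rabs (L + 2 * harm_gap n (S j) - 2 * harm (S j) - / INR (S j)) <= K j).
    { unfold K. set (e := harm_gap n (S j)) in *. generalize (harm_bounds (S j)).
      assert (I1 := inv_INR_S j).
      apply Rabs_le_between in B. generalize (Rle_abs L) (Rle_abs (- L)). rewrite Rabs_Ropp. intros. apply Rabs_le. lra. }
    set (z := Rabs (L + 2 * harm_gap n (S j) - 2 * harm (S j) - / INR (S j))) in *. assert (0 <= z) by apply Rabs_pos. nra. }
  assert (Hl : forall j, is_lim_seq (fun n => b n j) (gterm L x (S j))).
  { intros j. apply (is_lim_seq_ext_loc (fun n => x ^ S j * wcoef (S j) * (falling n (S j)) ^ 2 * (L + 2 * harm_gap n (S j) - 2 * harm (S j) - / INR (S j)))).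
    exists (S j). intros n Hn. unfold b. destruct (Compare_dec.le_dec (S j) n); auto. lia.
    replace (gterm L x (S j)) with (x ^ S j * wcoef (S j) * (1 * (1 * 1)) * (L + 2 * euler_gamma - 2 * harm (S j) - / INR (S j))) by (unfold gterm; ring).
    apply is_lim_seq_mult'. apply is_lim_seq_mult'. apply is_lim_seq_const. simpl.
    apply is_lim_seq_mult'; [apply falling_cv|]. apply is_lim_seq_mult'; [apply falling_cv|apply is_lim_seq_const].
    apply is_lim_seq_minus'; [|apply is_lim_seq_const]. apply is_lim_seq_minus'; [|apply is_lim_seq_const].
    apply is_lim_seq_plus'; [apply is_lim_seq_const|]. apply is_lim_seq_mult'; [apply is_lim_seq_const|]. apply harm_gap_cv. }
  assert (T := tannery b (fun j => gterm L x (S j)) M Hb HM Hl).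
  apply (is_lim_seq_ext_loc (fun n => (2 * (harm n - ln (INR n)) + L) ^ 2 / 2 + harm2 n + Series (b n))).
  - exists 1%nat. intros n Hn. unfold res_sum. rewrite (Series_finite (b n) n).
    2:{ intros j Hj. unfold b. destruct (Compare_dec.le_dec (S j) n); auto. lia. }
    rewrite (rsum_ext _ (fun k => exp (- INR k * (2 * ln (INR n) - ln x)) * (pcoef2 n k * (2 * ln (INR n) - ln x) + pcoef1 n k))).
    2:{ intros k Hk. rewrite res_sum_term by auto. unfold b. replace (S (pred k)) with k by lia. destruct (Compare_dec.le_dec k n); auto. lia. }
    fold L. set (q := rsum _ _). field.
  - unfold Gpos. fold L. replace ((2 * euler_gamma + L) ^ 2 / 2) with ((2 * euler_gamma + L) * ((2 * euler_gamma + L) * 1) * / 2) by (simpl; unfold Rdiv; ring).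
    apply is_lim_seq_plus'; auto. apply is_lim_seq_plus'; [|apply harm2_cv].
    assert (A : is_lim_seq (fun n => 2 * (harm n - ln (INR n)) + L) (2 * euler_gamma + L)).
    { apply is_lim_seq_plus'; [|apply is_lim_seq_const]. apply is_lim_seq_mult'. apply is_lim_seq_const. apply is_lim_seq_euler_gamma. }
    simpl. apply is_lim_seq_mult'; [|apply is_lim_seq_const]. apply is_lim_seq_mult'; auto. apply is_lim_seq_mult'; auto. apply is_lim_seq_const.
Qed.

(** * The Mellin-Barnes integral *)

Lemma RInt_tail (h : R -> R) (K p q : R) : 0 <= K -> p <= q -> 0 < p \/ q < 0 -> ex_RInt h p q ->
  (forall t, p <= t <= q -> Rabs (h t) <= K / t ^ 2) -> Rabs (RInt h p q) <= K * (/ p - / q).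
Proof.
  intros HK Hpq H0 Hex Hb.
  assert (nz : forall t, p <= t <= q -> t <> 0) by (intros; lra).
  assert (I : is_RInt (fun t => K / t ^ 2) p q (minus (- K / q) (- K / p))).
  { apply (is_RInt_derive (fun t => - K / t)); intros t Ht; rewrite Rmin_left, Rmax_right in Ht by auto; specialize (nz t Ht).
    auto_derive; auto. toR; field; auto.
    apply ex_derive_continuous_R. auto_derive. simpl. rewrite Rmult_1_r. apply Rmult_integral_contrapositive; auto. }
  eapply Rle_trans. apply abs_RInt_le; auto.
  replace (K * (/ p - / q)) with (RInt (fun t => K / t ^ 2) p q).
  2:{ rewrite (is_RInt_unique _ _ _ _ I). unfold minus, plus, opp; simpl. field. split; apply nz; lra. }
  apply RInt_le; auto. apply (ex_RInt_norm h); auto. eexists; exact I. intros; apply Hb; lra.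
Qed.

(** The approximations f n are dominated by K / (s^2 + t^2), so replacing the symmetric
    limit of their integrals by the integral over [a, b] costs O(1 / min(- a, b)),
    uniformly in n.  For a and b fixed, f n tends to F uniformly.  This turns the
    symmetric limits into a limit where a and b are independent. *)
Lemma improper_limit (f : nat -> R -> R) (F : R -> R) (ln : nat -> R) (l K s : R) (N : nat) :
  0 < s -> 0 <= K -> (forall n, (N <= n)%nat -> forall p q, ex_RInt (f n) p q) ->
  (forall n, (N <= n)%nat -> forall t, Rabs (f n t) <= K / (s ^ 2 + t ^ 2)) ->
  (forall n, (N <= n)%nat -> forall t, Rabs (f n t - F t) <= K / (s ^ 2 + t ^ 2) / INR n) ->
  (forall n, (N <= n)%nat -> is_lim (fun T => RInt (f n) (- T) T) p_infty (ln n)) -> is_lim_seq ln l ->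
  forall a b, a < 0 -> 0 < b -> exists I, is_RInt F a b I /\ Rabs (I - l) <= 2 * K / Rmin (- a) b.
Proof.
  intros Hs HK Hex Hbd Hdif Hlim Hl a b Ha Hb.
  assert (Hs2 : 0 < s ^ 2) by (apply pow_lt; auto).
  destruct (filterlim_RInt (V := R_CompleteNormedModule) (fun n => f (n + N)%nat) a b eventually _ F (fun n => RInt (f (n + N)%nat) a b)) as [I [HI1 HI2]].
  { intros n. apply (RInt_correct (V := R_CompleteNormedModule)). apply Hex. lia. }
  { intros P [eps HP].
    assert (L := is_lim_seq_div_INR (K / s ^ 2)). apply is_lim_seq_spec in L. destruct (L eps) as [n0 Hn0].
    exists (n0 + 1)%nat. intros n Hn. apply HP. intros t. unfold ball; simpl; unfold AbsRing_ball; simpl.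
    unfold abs, minus, plus, opp; simpl. fold (f (n + N)%nat t - F t).
    eapply Rle_lt_trans. apply Hdif; lia. specialize (Hn0 (n + N)%nat ltac:(lia)). rewrite Rminus_0_r in Hn0.
    eapply Rle_lt_trans; [|apply Hn0]. eapply Rle_trans; [|apply Rle_abs].
    assert (0 < INR (n + N)) by (apply lt_0_INR; lia).
    unfold Rdiv. apply Rmult_le_compat_r. left; apply Rinv_0_lt_compat; auto.
    apply Rmult_le_compat_l; auto. apply Rinv_le_contravar; auto. generalize (pow2_ge_0 t); lra. }
  exists I. split; auto.
  set (M := Rmin (- a) b). assert (HM : 0 < M) by (apply Rmin_pos; lra).
  assert (M1 : M <= - a) by apply Rmin_l. assert (M2 : M <= b) by apply Rmin_r.
  assert (Ht2 : forall n t, (N <= n)%nat -> Rabs (f n t) * t ^ 2 <= K).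
  { intros n t Hn. specialize (Hbd n Hn t). apply (Rle_trans _ (Rabs (f n t) * (s ^ 2 + t ^ 2))).
    apply Rmult_le_compat_l. apply Rabs_pos. lra.
    apply Rle_div_r in Hbd; auto. generalize (pow2_ge_0 t); lra. }
  assert (B : forall n, (N <= n)%nat -> Rabs (RInt (f n) a b - ln n) <= 2 * K / M).
  { intros n Hn.
    assert (L := Hlim n Hn).
    apply (is_lim_le_loc (fun T => Rabs (RInt (f n) a b - RInt (f n) (- T) T)) (fun _ => 2 * K / M) p_infty (Rabs (RInt (f n) a b - ln n)) (2 * K / M)).
    2:{ apply (filterlim_comp _ _ _ (fun T => RInt (f n) a b - RInt (f n) (- T) T) Rabs _ (locally (RInt (f n) a b - ln n))).
        2: apply (continuous_Rabs (RInt (f n) a b - ln n)). apply (is_lim_minus' (fun _ => RInt (f n) a b)). apply is_lim_const. exact L. }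
    2: apply is_lim_const.
    exists (Rmax (- a) b). intros T HT.
    assert (- a <= Rmax (- a) b) by apply Rmax_l. assert (b <= Rmax (- a) b) by apply Rmax_r.
    replace (RInt (f n) a b - RInt (f n) (- T) T) with (- (RInt (f n) (- T) a + RInt (f n) b T)).
    2:{ rewrite <- (RInt_Chasles (V := R_CompleteNormedModule) (f n) (- T) a T), <- (RInt_Chasles (V := R_CompleteNormedModule) (f n) a b T) by auto.
        unfold plus; simpl. ring. }
    rewrite Rabs_Ropp. eapply Rle_trans. apply Rabs_triang.
    assert (Hb' : forall t, t <> 0 -> Rabs (f n t) <= K / t ^ 2).
    { intros t Ht. apply Rle_div_r. apply pow2_gt_0; auto. auto. }
    assert (B1 := RInt_tail (f n) K (- T) a HK ltac:(lra) ltac:(right; lra) (Hex n Hn _ _) ltac:(intros; apply Hb'; lra)).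
    assert (B2 := RInt_tail (f n) K b T HK ltac:(lra) ltac:(left; lra) (Hex n Hn _ _) ltac:(intros; apply Hb'; lra)).
    assert (/ b <= / M) by (apply Rinv_le_contravar; lra). assert (/ (- a) <= / M) by (apply Rinv_le_contravar; lra).
    assert (0 < / T) by (apply Rinv_0_lt_compat; lra). rewrite Rinv_opp in *. unfold Rdiv. nra. }
  apply (is_lim_seq_le (fun n => Rabs (RInt (f (n + N)%nat) a b - ln (n + N)%nat)) (fun _ => 2 * K / M) (Rabs (I - l)) (2 * K / M)).
  intros; apply B; lia. 2: apply is_lim_seq_const.
  apply (is_lim_seq_abs _ (I - l)). apply is_lim_seq_minus'. exact HI1. apply (is_lim_seq_incr_n ln N); auto.
Qed.

Lemma Csqr_neq_0 (z : C) : z <> 0%C -> (z ^ 2)%C <> 0%C.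
Proof. intros Hz. simpl. rewrite Cmult_1_r. apply Cmult_neq_0; auto. Qed.
Lemma Ccont_Crising a n : Ccont (fun t => Crising (a, t) n).
Proof. induction n; simpl. apply Ccont_const. apply Ccont_mult; auto. apply Ccont_plus. apply Ccont_vline. apply Ccont_const. Qed.
Lemma Ccont_sqG a tau n : 0 < a -> Ccont (fun t => sqG n (a, t) * Cexp ((a, t) * RtoC tau))%C.
Proof.
  intros Ha. apply Ccont_mult.
  - unfold sqG, Cdiv. apply Ccont_mult. apply Ccont_const. apply Ccont_inv.
    exact (Ccont_mult _ _ (Ccont_vline a) (Ccont_mult _ _ (Ccont_Crising a (S n)) (Ccont_mult _ _ (Ccont_Crising a (S n)) (Ccont_const 1%C)))).
    intros t. assert (N := Crising_neq_0 (a, t) (S n) Ha). assert (N' : ((a, t) : C) <> 0%C) by (apply Cpair_neq_0; lra).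
    apply Cmult_neq_0; [exact N'|apply Csqr_neq_0, N].
  - apply Ccont_Cexp, Ccont_mult. apply Ccont_vline. apply Ccont_const.
Qed.

Lemma Cconj_RtoC (a : R) : Cconj (RtoC a) = RtoC a.
Proof. unfold Cconj, RtoC; simpl. rewrite Ropp_0. reflexivity. Qed.
Lemma Crising_conj u n : Crising (Cconj u) n = Cconj (Crising u n).
Proof.
  induction n; simpl. rewrite Cconj_RtoC. auto. rewrite Cmult_conj, Cplus_conj, IHn, Cconj_RtoC. auto.
Qed.
(** The integrand takes conjugate values at conjugate points. *)
Lemma sqG_odd (a tau : R) n (t : R) : 0 < a ->
  Im (sqG n (a, (- t)%R) * Cexp ((a, (- t)%R) * RtoC tau))%C = - Im (sqG n (a, t) * Cexp ((a, t) * RtoC tau))%C.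
Proof.
  intros Ha. rewrite <- im_conj. f_equal.
  change ((a, (- t)%R) : C) with (Cconj (a, t)).
  rewrite Cmult_conj. f_equal.
  - unfold sqG. rewrite Crising_conj, Cdiv_conj, Cmult_conj, Cpow_conj. f_equal. rewrite Cconj_RtoC; auto.
    assert (N := Crising_neq_0 (a, t) (S n) Ha). assert (N' : ((a, t) : C) <> 0%C) by (apply Cpair_neq_0; lra).
    apply Cmult_neq_0; [exact N'|apply Csqr_neq_0, N].
  - unfold Cexp, Cconj, Re, Im; simpl.
    replace (a * 0 + - t * tau) with (- (a * 0 + t * tau)) by ring. rewrite cos_neg, sin_neg.
    replace (a * tau - - t * 0) with (a * tau - t * 0) by ring. f_equal. ring.
Qed.
Lemma RInt_odd (h : R -> R) T : (forall t, h (- t) = - h t) -> ex_RInt h (- T) T -> RInt h (- T) T = 0.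
Proof.
  intros Hodd Hex. assert (I := RInt_correct (V := R_CompleteNormedModule) _ _ _ Hex). set (J := RInt h (- T) T) in *.
  assert (I2 : is_RInt h (- T) T (opp J)).
  { apply (is_RInt_ext (fun y => opp (h (- y)))). intros t _. rewrite Hodd. unfold opp; simpl. toR; ring.
    apply (is_RInt_comp_opp (V := R_NormedModule) h (- T) T (opp J)). rewrite Ropp_involutive.
    apply (is_RInt_swap (V := R_NormedModule)). exact I. }
  apply (is_RInt_unique (V := R_CompleteNormedModule)) in I2. fold J in I2. unfold opp in I2; simpl in I2. lra.
Qed.

(** The Mellin-Barnes integrand in the variable u = s + i t, after simplification by
    Gamma (1 + u) = u Gamma u. *)
Definition mb (s x t : R) : C := (Gamma (s, t) ^ 2 / (s, t) * Cexp (- ((s, t) * RtoC (ln x))))%C.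

Lemma sqG_eulerG (a x t : R) n : 0 < a -> (1 <= n)%nat ->
  (sqG n (a, t) * Cexp ((a, t) * RtoC (2 * ln (INR n) - ln x)) = eulerG n (a, t) ^ 2 / (a, t) * Cexp (- ((a, t) * RtoC (ln x))))%C.
Proof.
  intros Ha Hn. unfold sqG, eulerG.
  replace ((a, t) * RtoC (2 * ln (INR n) - ln x))%C with ((a, t) * ln (INR n) + ((a, t) * ln (INR n) + - ((a, t) * RtoC (ln x))))%C.
  2:{ rewrite RtoC_minus, RtoC_mult. ring. }
  rewrite !Cexp_plus, RtoC_pow.
  assert (N := Crising_neq_0 (a, t) (S n) Ha). assert (N' : ((a, t) : C) <> 0%C) by (apply Cpair_neq_0; lra).
  field. auto.
Qed.

Lemma mb_approx (s x : R) : 0 < s -> 0 < x -> exists K, 0 <= K /\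
  forall n t, (3 <= n)%nat -> let f := (sqG n (s, t) * Cexp ((s, t) * RtoC (2 * ln (INR n) - ln x)))%C in
    Cmod f <= K / (s ^ 2 + t ^ 2) /\ Cmod (f - mb s x t)%C <= K / (s ^ 2 + t ^ 2) / INR n.
Proof.
  intros Hs Hx. destruct (eulerG_cv_unif s Hs) as [K [HK HU]].
  set (e := exp (- (s * ln x))). assert (He : 0 < e) by apply exp_pos.
  exists (2 * (K * K * e / s)). assert (HK2 : 0 < K * K * e / s). { apply Rdiv_lt_0_compat; auto. repeat apply Rmult_lt_0_compat; auto. }
  split. lra.
  intros n t Hn f. unfold f. rewrite sqG_eulerG by (auto; lia). unfold mb.
  destruct (HU (s, t) eq_refl) as [G1 G2]. destruct (G2 n Hn) as [G3 [G4 G5]].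
  assert (Hm : Cmod (s, t) ^ 2 = s ^ 2 + t ^ 2) by (rewrite Cmod_sqr; reflexivity).
  rewrite Hm in *. set (d := s ^ 2 + t ^ 2) in *.
  assert (Hd : 0 < d) by (apply sumsq_pos; left; lra).
  assert (Hst : s <= Cmod (s, t)). { generalize (re_le_Cmod (s, t)) (Rle_abs (Re (s, t))). simpl; lra. }
  assert (Hi : 0 < / Cmod (s, t) <= / s). { split. apply Rinv_0_lt_compat; lra. apply Rinv_le_contravar; lra. }
  assert (N' : ((s, t) : C) <> 0%C) by (apply Cpair_neq_0; lra).
  assert (Ee : Cmod (Cexp (- ((s, t) * RtoC (ln x)))%C) = e).
  { rewrite Cmod_Cexp. unfold e. f_equal. unfold Re; simpl. ring. }
  assert (Hn0 : 0 < INR n) by (apply lt_0_INR; lia).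
  assert (Q : forall z w : C, forall A B : R, Cmod z <= A -> Cmod w <= B -> 0 <= B ->
    Cmod (z * w / (s, t) * Cexp (- ((s, t) * RtoC (ln x))))%C <= A * B * e / s).
  { intros z w A B Hz Hw HB. rewrite Cmod_mult, Cmod_div, Cmod_mult, Ee by auto.
    generalize (Cmod_ge_0 z) (Cmod_ge_0 w). intros.
    replace (A * B * e / s) with (A * B * / s * e) by (unfold Rdiv; ring). apply Rmult_le_compat_r. lra.
    apply Rmult_le_compat; try lra. apply Rmult_le_pos; auto. apply Rmult_le_compat; auto. }
  split.
  - simpl Cpow. rewrite Cmult_1_r. eapply Rle_trans. apply (Q _ _ K (K / d)); auto. apply Rdiv_le_0_compat; lra.
    assert (0 < K * K * e / s / d) by (apply Rdiv_lt_0_compat; auto).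
    replace (K * (K / d) * e / s) with (K * K * e / s / d) by (field; lra).
    replace (2 * (K * K * e / s) / d) with (2 * (K * K * e / s / d)) by (field; lra). lra.
  - replace (eulerG n (s, t) ^ 2 / (s, t) * Cexp (- ((s, t) * RtoC (ln x))) - Gamma (s, t) ^ 2 / (s, t) * Cexp (- ((s, t) * RtoC (ln x))))%C
     with ((eulerG n (s, t) + Gamma (s, t)) * (eulerG n (s, t) - Gamma (s, t)) / (s, t) * Cexp (- ((s, t) * RtoC (ln x))))%C by (field; auto).
    eapply Rle_trans. apply (Q _ _ (2 * K) (K / d / INR n)); auto. eapply Rle_trans. apply Cmod_triangle. lra.
    apply Rdiv_le_0_compat; auto. apply Rdiv_le_0_compat; lra.
    right. field. repeat split; lra.
Qed.

Lemma mb_integral (s x : R) : 0 < s -> 0 < x -> exists K, 0 <= K /\ forall a b, a < 0 -> 0 < b ->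
  (exists I, is_RInt (fun t => Re (mb s x t)) a b I /\ Rabs (I - 2 * PI * Gpos x) <= K / Rmin (- a) b) /\
  (exists I, is_RInt (fun t => Im (mb s x t)) a b I /\ Rabs (I - 0) <= K / Rmin (- a) b).
Proof.
  intros Hs Hx. destruct (mb_approx s x Hs Hx) as [K [HK HA]].
  exists (2 * K). split. lra. intros a b Ha Hb.
  set (f := fun n t => (sqG n (s, t) * Cexp ((s, t) * RtoC (2 * ln (INR n) - ln x)))%C).
  (* the inversion formula needs tau > 0, that is n ^ 2 > x *)
  assert (HN : exists N, (3 <= N)%nat /\ forall n, (N <= n)%nat -> 0 < 2 * ln (INR n) - ln x).
  { exists (max 3 (S (Z.to_nat (up x)))). split. lia. intros n Hn.
    assert (x < INR n). { destruct (archimed x) as [A _]. eapply Rlt_le_trans. apply A.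
      rewrite INR_IZR_INZ. apply IZR_le. lia. }
    assert (1 < INR n). { replace 1 with (INR 1) by reflexivity. apply lt_INR. lia. }
    assert (ln x < ln (INR n)) by (apply ln_increasing; auto). assert (0 < ln (INR n)). { rewrite <- ln_1. apply ln_increasing; lra. } lra. }
  destruct HN as [N [HN3 HNt]].
  split.
  - apply (improper_limit (fun n t => Re (f n t)) (fun t => Re (mb s x t)) (fun n => 2 * PI * res_sum n (2 * ln (INR n) - ln x)) (2 * PI * Gpos x) K s N); auto.
    + intros n Hn p q. apply (Ccont_ex_RInt (f n)). apply Ccont_sqG; auto.
    + intros n Hn t. eapply Rle_trans. apply re_le_Cmod. apply HA. lia.
    + intros n Hn t. replace (Re (f n t) - Re (mb s x t)) with (Re (f n t - mb s x t)%C) by reflexivity. eapply Rle_trans. apply re_le_Cmod. apply HA. lia.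
    + intros n Hn. apply (PV_sqG n s); auto.
    + apply (is_lim_seq_scal_l _ (2 * PI) (Gpos x)). apply res_sum_cv; auto.
  - apply (improper_limit (fun n t => Im (f n t)) (fun t => Im (mb s x t)) (fun n => 0) 0 K s N); auto.
    + intros n Hn p q. apply (Ccont_ex_RInt (f n)). apply Ccont_sqG; auto.
    + intros n Hn t. eapply Rle_trans. apply im_le_Cmod. apply HA. lia.
    + intros n Hn t. replace (Im (f n t) - Im (mb s x t)) with (Im (f n t - mb s x t)%C) by reflexivity. eapply Rle_trans. apply im_le_Cmod. apply HA. lia.
    + intros n Hn. apply (is_lim_ext (fun _ => 0)). 2: apply is_lim_const.
      intros T. symmetry. apply (RInt_odd (fun t => Im (f n t))). intros t. apply sqG_odd; auto. apply (Ccont_ex_RInt (f n)). apply Ccont_sqG; auto.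
    + apply is_lim_seq_const.
Qed.

Lemma meijer_integrand_mb (x c t : R) : 0 < x -> c < 0 ->
  (meijer_integrand 3 0 [RtoC 1] [RtoC 0; RtoC 0; RtoC 0] x (c + Ci * t) * Ci)%C = (mb (- c) x (- t) * Ci)%C.
Proof.
  intros Hx Hc. f_equal. unfold meijer_integrand, mb, Cprod. simpl map. simpl fold_right.
  set (u := (((- c)%R, (- t)%R) : C)).
  assert (Hu0 : 0 < Re u) by (unfold u; simpl; lra).
  assert (E1 : (RtoC 0 - (c + Ci * t))%C = u).
  { unfold u, Cminus, Cplus, Cmult, Copp, Ci; simpl. f_equal; ring. }
  assert (E2 : (RtoC 1 - (c + Ci * t))%C = (u + 1)%C) by (rewrite <- E1; ring).
  assert (E3 : (c + Ci * t)%C = (- u)%C) by (rewrite <- E1; ring).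
  rewrite E1, E2. unfold Cpower. rewrite E3.
  rewrite Cln_pos by auto. replace (- u * ln x)%C with (- (u * ln x))%C by ring.
  destruct (eulerG_cv u Hu0) as [_ [_ G1]].
  assert (N : u <> 0%C). { intros E. rewrite E in Hu0. simpl in Hu0. lra. }
  assert (S1 := rGamma_succ u Hu0).
  assert (E4 : rGamma (u + 1) = (rGamma u / u)%C) by (rewrite S1; field; auto).
  rewrite E4. transitivity (Gamma u ^ 2 / u * Cexp (- (u * ln x)) * (Gamma u * rGamma u))%C. field; auto. rewrite G1. ring.
Qed.

Lemma is_RInt_reflect (h : R -> R) a b I : is_RInt h (- b) (- a) I -> is_RInt (fun t => h (- t)) a b I.
Proof.
  intros HI. apply (is_RInt_swap (V := R_NormedModule)) in HI. apply (is_RInt_comp_opp (V := R_NormedModule)) in HI.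
  apply (is_RInt_opp (V := R_NormedModule)) in HI. rewrite opp_opp in HI.
  refine (is_RInt_ext _ _ _ _ _ _ HI). intros t _. unfold opp; simpl. toR; ring.
Qed.

(** The variable is t with s = c + i t, hence u = - c - i t: the line is run through in
    the opposite direction.  The factor [Ci] exchanges the components, and the limit is
    2 i pi times the real number [Gpos x]. *)
Theorem mellin_barnes (x c : R) : 0 < x -> c < 0 ->
  is_RInt_gen (V := C_R_NormedModule)
    (fun t : R => (meijer_integrand 3 0 [RtoC 1] [RtoC 0; RtoC 0; RtoC 0] x (c + Ci * t) * Ci)%C)
    (Rbar_locally m_infty) (Rbar_locally p_infty) ((0, 2 * PI * Gpos x) : C).
Proof.
  intros Hx Hc. destruct (mb_integral (- c) x ltac:(lra) Hx) as [K [HK HI]].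
  intros P [eps HP].
  set (M := 2 * (K + 1) / eps). assert (He := cond_pos eps).
  assert (HM : 0 < M) by (apply Rdiv_lt_0_compat; lra).
  apply (Filter_prod _ _ _ (fun a => a < - M) (fun b => M < b)). exists (- M); auto. exists M; auto.
  intros a b Ha Hb. simpl.
  destruct (HI (- b) (- a) ltac:(lra) ltac:(lra)) as [[I1 [A1 A2]] [I2 [B1 B2]]].
  exists ((- I2, I1) : C). split.
  - apply (is_RInt_fct_extend_pair (U := R_NormedModule) (V := R_NormedModule)).
    + apply (is_RInt_ext (fun t => opp (Im (mb (- c) x (- t))))).
      intros t _. rewrite meijer_integrand_mb by auto. unfold opp, Im; simpl. toR; ring.
      apply (is_RInt_opp (V := R_NormedModule)). apply (is_RInt_reflect (fun t => Im (mb (- c) x t))); auto.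
    + apply (is_RInt_ext (fun t => Re (mb (- c) x (- t)))).
      intros t _. rewrite meijer_integrand_mb by auto. unfold Re; simpl. toR; ring.
      apply (is_RInt_reflect (fun t => Re (mb (- c) x t))); auto.
  - apply HP.
    assert (Hmin : M <= Rmin (- - b) (- a)) by (apply Rmin_glb; lra).
    assert (Hk : K / Rmin (- - b) (- a) < eps).
    { apply Rle_lt_trans with (K / M). unfold Rdiv. apply Rmult_le_compat_l; auto. apply Rinv_le_contravar; auto.
      unfold M. replace (K / (2 * (K + 1) / eps)) with (eps * (K / (2 * (K + 1)))) by (field; lra).
      assert (K / (2 * (K + 1)) < 1). { apply Rlt_div_l; lra. } assert (0 <= K / (2 * (K + 1))). { apply Rdiv_le_0_compat; lra. } nra. }
    split; unfold ball; simpl; unfold AbsRing_ball; simpl; unfold abs, minus, plus, opp; simpl.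
    + rewrite Rminus_0_r in B2. rewrite Ropp_0, Rplus_0_r, Rabs_Ropp. lra.
    + change (I1 + - (2 * PI * Gpos x)) with (I1 - 2 * PI * Gpos x). lra.
Qed.

(** * Complex power series and analytic functions *)

Definition Cser (u : nat -> C) (l : C) := is_series (fun n => Re (u n)) (Re l) /\ is_series (fun n => Im (u n)) (Im l).
Definition Csum (u : nat -> C) : C := (Series (fun n => Re (u n)), Series (fun n => Im (u n))).

Lemma Cser_ext u v l : (forall n, u n = v n) -> Cser u l -> Cser v l.
Proof. intros E [H1 H2]. split; [apply (is_series_ext (fun n => Re (u n)))|apply (is_series_ext (fun n => Im (u n)))]; auto; intros; rewrite E; auto. Qed.
Lemma Cser_plus u v l m : Cser u l -> Cser v m -> Cser (fun n => u n + v n)%C (l + m)%C.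
Proof. intros [H1 H2] [H3 H4]. split; apply (is_series_plus (V := R_NormedModule)); auto. Qed.
Lemma Cser_scal c u l : Cser u l -> Cser (fun n => c * u n)%C (c * l)%C.
Proof.
  intros [H1 H2]. split; simpl.
  apply (is_series_minus (V := R_NormedModule)); apply (is_series_scal (V := R_NormedModule)); auto.
  apply (is_series_plus (V := R_NormedModule)); apply (is_series_scal (V := R_NormedModule)); auto.
Qed.
Lemma Cser_unique u l m : Cser u l -> Cser u m -> l = m.
Proof.
  intros [H1 H2] [H3 H4]. apply is_series_unique in H1, H2, H3, H4.
  destruct l, m; simpl in *. f_equal; congruence.
Qed.
Lemma Cabs_Re u : ex_series (fun n => Cmod (u n)) -> ex_series (fun n => Rabs (Re (u n))).
Proof. apply ex_series_le_R. intros; rewrite Rabs_Rabsolu. apply re_le_Cmod. Qed.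
Lemma Cabs_Im u : ex_series (fun n => Cmod (u n)) -> ex_series (fun n => Rabs (Im (u n))).
Proof. apply ex_series_le_R. intros; rewrite Rabs_Rabsolu. apply im_le_Cmod. Qed.
Lemma Cser_of_abs u : ex_series (fun n => Cmod (u n)) -> Cser u (Csum u).
Proof. intros E. split; simpl; apply Series_correct, ex_series_Rabs. apply Cabs_Re; auto. apply Cabs_Im; auto. Qed.
Lemma Cser_Cmod_le u l b : Cser u l -> ex_series b -> (forall n, Cmod (u n) <= b n) -> Cmod l <= 2 * Series b.
Proof.
  intros Hl Hb Hu.
  assert (E : ex_series (fun n => Cmod (u n))). { apply (ex_series_le_R _ b); auto. intros; rewrite Rabs_pos_eq; auto. apply Cmod_ge_0. }
  rewrite (Cser_unique _ _ _ Hl (Cser_of_abs u E)). eapply Rle_trans. apply Cmod_le_re_im. simpl.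
  assert (A : forall p : C -> R, (forall z, Rabs (p z) <= Cmod z) -> Rabs (Series (fun n => p (u n))) <= Series b).
  { intros p Hp. assert (ex_series (fun n => Rabs (p (u n)))). { apply (ex_series_le_R _ b); auto. intros; rewrite Rabs_Rabsolu. eapply Rle_trans; eauto. }
    eapply Rle_trans. apply Series_Rabs; auto. apply Series_le; auto. intros; split. apply Rabs_pos. eapply Rle_trans; eauto. }
  generalize (A Re re_le_Cmod) (A Im im_le_Cmod). lra.
Qed.
Lemma Cser_bounded u l : Cser u l -> exists M, 0 < M /\ forall n, Cmod (u n) <= M.
Proof.
  intros [H1 H2].
  assert (A : forall a : nat -> R, ex_series a -> exists M, 0 < M /\ forall n, Rabs (a n) <= M).
  { intros a Ha. apply ex_series_lim_0 in Ha. destruct (filterlim_bounded (K := R_AbsRing) (V := R_NormedModule) a) as [M HM].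
    exists 0; exact Ha. exists (Rmax 1 M). split. generalize (Rmax_l 1 M); lra. intros n. eapply Rle_trans; [apply HM|apply Rmax_r]. }
  destruct (A _ (ex_intro _ _ H1)) as [M1 [P1 B1]]. destruct (A _ (ex_intro _ _ H2)) as [M2 [P2 B2]].
  exists (M1 + M2). split. lra. intros n. eapply Rle_trans. apply Cmod_le_re_im. apply Rplus_le_compat; auto.
Qed.
Lemma sum_n_minus_R (f g : nat -> R) n : sum_n (fun k => f k - g k) n = sum_n f n - sum_n g n.
Proof. induction n. rewrite !sum_O; auto. rewrite !sum_Sn, IHn. unfold plus; simpl. toR; ring. Qed.
Lemma sum_n_plus_R (f g : nat -> R) n : sum_n (fun k => f k + g k) n = sum_n f n + sum_n g n.
Proof. exact (sum_n_plus f g n). Qed.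
Lemma Cser_mult u v l m : Cser u l -> Cser v m -> ex_series (fun n => Cmod (u n)) -> ex_series (fun n => Cmod (v n)) ->
  Cser (fun n => sum_n (fun k => u k * v (n - k)%nat)%C n) (l * m)%C.
Proof.
  intros [H1 H2] [H3 H4] U V.
  assert (P : forall (p q : C -> R) n, sum_f_R0 (fun k => p (u k) * q (v (n - k)%nat)) n = sum_n (fun k => p (u k) * q (v (n - k)%nat)) n) by (intros; rewrite sum_n_Reals; auto).
  assert (RS : forall (w : nat -> C) n, Re (sum_n w n) = sum_n (fun k => Re (w k)) n).
  { intros w n. induction n. rewrite !sum_O; auto. rewrite !sum_Sn, <- IHn. reflexivity. }
  assert (IS : forall (w : nat -> C) n, Im (sum_n w n) = sum_n (fun k => Im (w k)) n).
  { intros w n. induction n. rewrite !sum_O; auto. rewrite !sum_Sn, <- IHn. reflexivity. }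
  assert (Ur := Cabs_Re u U). assert (Ui := Cabs_Im u U). assert (Vr := Cabs_Re v V). assert (Vi := Cabs_Im v V).
  split.
  - apply (is_series_ext (fun n => sum_f_R0 (fun k => Re (u k) * Re (v (n - k)%nat)) n - sum_f_R0 (fun k => Im (u k) * Im (v (n - k)%nat)) n)).
    { intros n. rewrite (P Re Re), (P Im Im), RS.
      rewrite <- sum_n_minus_R. apply sum_n_ext. reflexivity. }
    apply (is_series_minus (V := R_NormedModule)).
    apply (is_series_mult (fun n => Re (u n)) (fun n => Re (v n))); auto. apply (is_series_mult (fun n => Im (u n)) (fun n => Im (v n))); auto.
  - apply (is_series_ext (fun n => sum_f_R0 (fun k => Re (u k) * Im (v (n - k)%nat)) n + sum_f_R0 (fun k => Im (u k) * Re (v (n - k)%nat)) n)).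
    { intros n. rewrite (P Re Im), (P Im Re), IS.
      rewrite <- sum_n_plus_R. apply sum_n_ext. reflexivity. }
    apply (is_series_plus (V := R_NormedModule)).
    apply (is_series_mult (fun n => Re (u n)) (fun n => Im (v n))); auto. apply (is_series_mult (fun n => Im (u n)) (fun n => Re (v n))); auto.
Qed.

Lemma is_series_C (u : nat -> C) (l : C) : is_series (K := C_AbsRing) (V := C_NormedModule) u l <-> Cser u l.
Proof.
  assert (RS : forall n, Re (sum_n (G := C_NormedModule) u n) = sum_n (fun k => Re (u k)) n).
  { intros n. induction n. rewrite !sum_O; auto. rewrite !sum_Sn, <- IHn. reflexivity. }
  assert (IS : forall n, Im (sum_n (G := C_NormedModule) u n) = sum_n (fun k => Im (u k)) n).
  { intros n. induction n. rewrite !sum_O; auto. rewrite !sum_Sn, <- IHn. reflexivity. }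
  assert (E : is_series (K := C_AbsRing) (V := C_NormedModule) u l <-> Ccv (fun n => sum_n (G := C_NormedModule) u n) l).
  { split.
    - intros Hs.
      assert (L : forall eps : posreal, eventually (fun n => Cmod (sum_n (G := C_NormedModule) u n - l)%C < eps)).
      { intros eps. apply (Hs (fun z => Cmod (z - l)%C < eps)).
        apply (locally_le_locally_norm (K := C_AbsRing) (V := C_NormedModule) l). exists eps. intros y Hy. exact Hy. }
      apply Ccv_of_Cmod. apply is_lim_seq_spec. intros eps. destruct (L eps) as [N HN]. exists N. intros n Hn.
      rewrite Rminus_0_r, Rabs_pos_eq by apply Cmod_ge_0. auto.
    - intros Hc P HP. apply (locally_norm_le_locally (K := C_AbsRing) (V := C_NormedModule) l) in HP. destruct HP as [eps HP].
      assert (Hc0 := Ccv_Cmod _ _ (Ccv_plus _ _ _ _ Hc (Ccv_const (- l)%C))).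
      replace (l + - l)%C with (RtoC 0) in Hc0 by ring. rewrite Cmod_0 in Hc0.
      apply is_lim_seq_spec in Hc0. destruct (Hc0 eps) as [N HN]. exists N. intros n Hn. apply HP.
      specialize (HN n Hn). rewrite Rminus_0_r, Rabs_pos_eq in HN by apply Cmod_ge_0. exact HN. }
  rewrite E. unfold Ccv, Cser, is_series. split; intros [H1 H2]; split.
  apply (filterlim_ext (fun n => Re (sum_n (G := C_NormedModule) u n))); auto.
  apply (filterlim_ext (fun n => Im (sum_n (G := C_NormedModule) u n))); auto.
  apply (is_lim_seq_ext (sum_n (fun n => Re (u n)))); auto.
  apply (is_lim_seq_ext (sum_n (fun n => Im (u n)))); auto.
Qed.
Lemma is_pseries_C a (h l : C) : is_pseries (K := C_AbsRing) (V := C_NormedModule) a h l <-> Cser (fun n => h ^ n * a n)%C l.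
Proof.
  unfold is_pseries. rewrite is_series_C. split; apply Cser_ext; intros n; reflexivity.
Qed.

Definition analytic (f : C -> C) (z0 : C) := exists a r, 0 < r /\ forall h : C, Cmod h < r ->
  Cser (fun n => h ^ n * a n)%C (f (z0 + h)%C) /\ ex_series (fun n => Cmod (h ^ n * a n)%C).

Lemma Cmod_pow (z : C) n : Cmod (z ^ n)%C = Cmod z ^ n.
Proof. induction n; simpl. apply Cmod_1. rewrite Cmod_mult, IHn. auto. Qed.

(** The terms of a series that converges at a point of larger modulus are bounded there,
    so the series is dominated by a geometric one. *)
Lemma Cser_abs_inside a (r : R) : 0 < r -> (forall h : C, Cmod h < r -> exists l, Cser (fun n => h ^ n * a n)%C l) ->
  forall h : C, Cmod h < r -> ex_series (fun n => Cmod (h ^ n * a n)%C).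
Proof.
  intros Hr Hc h Hh. set (r' := (Cmod h + r) / 2). generalize (Cmod_ge_0 h); intros Hh0.
  assert (Hr' : 0 < r') by (unfold r'; lra).
  destruct (Hc (RtoC r')) as [l Hl]. rewrite Cmod_R, Rabs_pos_eq; unfold r'; lra.
  destruct (Cser_bounded _ _ Hl) as [M [HM HB]].
  apply (ex_series_le_R _ (fun n => M * (Cmod h / r') ^ n)).
  - intros n. rewrite Rabs_pos_eq by apply Cmod_ge_0. specialize (HB n). rewrite Cmod_mult, Cmod_pow, Cmod_R, Rabs_pos_eq in HB by lra.
    rewrite Cmod_mult, Cmod_pow. unfold Rdiv. rewrite Rpow_mult_distr, pow_inv.
    assert (0 < r' ^ n) by (apply pow_lt; auto).
    replace (Cmod h ^ n * Cmod (a n)) with (Cmod h ^ n * / r' ^ n * (r' ^ n * Cmod (a n))) by (field; lra).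
    rewrite (Rmult_comm M). apply Rmult_le_compat_l; auto. apply Rmult_le_pos. apply pow_le; auto. left; apply Rinv_0_lt_compat; auto.
  - apply ex_series_scal_R. apply ex_series_geom. rewrite Rabs_pos_eq.
    apply Rlt_div_l; auto. unfold r'; lra. apply Rdiv_le_0_compat; auto.
Qed.

Lemma analytic_iff f z0 : Canalytic_at f z0 <-> analytic f z0.
Proof.
  split.
  - intros [a [r [Hr H]]]. exists a, r. split; auto.
    assert (A : forall h : C, Cmod h < r -> Cser (fun n => h ^ n * a n)%C (f (z0 + h)%C)).
    { intros h Hh. apply is_pseries_C. replace h with ((z0 + h) - z0)%C at 1 by ring. apply H.
      replace (z0 + h - z0)%C with h by ring. auto. }
    intros h Hh. split. auto. apply (Cser_abs_inside a r Hr); auto. intros h' Hh'. eexists; apply A; auto.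
  - intros [a [r [Hr H]]]. exists a, r. split; auto. intros z Hz. apply is_pseries_C.
    replace (f z) with (f (z0 + (z - z0))%C) by (f_equal; ring). apply H; auto.
Qed.

Lemma is_series_single (a : nat -> R) : (forall n, a (S n) = 0) -> is_series a (a 0%nat).
Proof.
  intros Ha. change (is_lim_seq (sum_n a) (a 0%nat)). apply (is_lim_seq_ext (fun _ => a 0%nat)); [|apply is_lim_seq_const].
  induction n. rewrite sum_O; auto. rewrite sum_Sn, <- IHn, Ha. unfold plus; simpl. toR; ring.
Qed.
Lemma analytic_const c z0 : analytic (fun _ => c) z0.
Proof.
  exists (fun n => match n with O => c | _ => 0%C end), 1. split. lra. intros h _.
  assert (A : forall p : C -> R, p 0%C = 0 -> is_series (fun n => p (h ^ n * match n with O => c | _ => 0 end)%C) (p c)).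
  { intros p Hp. replace (p c) with (p (h ^ 0 * c)%C) by (f_equal; simpl; ring).
    apply (is_series_single (fun n => p (h ^ n * match n with O => c | _ => 0 end)%C)). intros n. rewrite Cmult_0_r. auto. }
  split. split. apply A; auto. apply A; auto.
  exists (Cmod c). apply A. apply Cmod_0.
Qed.
Lemma analytic_plus f g z0 : analytic f z0 -> analytic g z0 -> analytic (fun z => f z + g z)%C z0.
Proof.
  intros [a [r [Hr H]]] [b [s [Hs K]]]. exists (fun n => a n + b n)%C, (Rmin r s). split. apply Rmin_pos; auto.
  intros h Hh. destruct (H h) as [H1 H2]. eapply Rlt_le_trans; [apply Hh|apply Rmin_l].
  destruct (K h) as [K1 K2]. eapply Rlt_le_trans; [apply Hh|apply Rmin_r].
  split. apply (Cser_ext (fun n => h ^ n * a n + h ^ n * b n)%C). intros; ring. apply Cser_plus; auto.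
  apply (ex_series_le_R _ (fun n => Cmod (h ^ n * a n)%C + Cmod (h ^ n * b n)%C)).
  intros n. rewrite Rabs_pos_eq by apply Cmod_ge_0. rewrite Cmult_plus_distr_l. apply Cmod_triangle.
  apply (ex_series_plus (V := R_NormedModule)); auto.
Qed.
Lemma sum_n_Cscal (c : C) (w : nat -> C) n : sum_n (fun k => c * w k)%C n = (c * sum_n w n)%C.
Proof. induction n. rewrite !sum_O; auto. rewrite !sum_Sn, IHn. toC. unfold plus; simpl. ring. Qed.
(** Both series converge absolutely inside the smaller disc, so their Cauchy product
    converges to the product. *)
Lemma analytic_mult f g z0 : analytic f z0 -> analytic g z0 -> analytic (fun z => f z * g z)%C z0.
Proof.
  intros [a [r [Hr H]]] [b [s [Hs K]]].
  set (cf := fun n => sum_n (fun k => a k * b (n - k)%nat)%C n).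
  assert (A : forall h : C, Cmod h < Rmin r s -> Cser (fun n => h ^ n * cf n)%C (f (z0 + h) * g (z0 + h))%C).
  { intros h Hh. destruct (H h) as [H1 H2]. eapply Rlt_le_trans; [apply Hh|apply Rmin_l].
    destruct (K h) as [K1 K2]. eapply Rlt_le_trans; [apply Hh|apply Rmin_r].
    apply (Cser_ext (fun n => sum_n (fun k => (h ^ k * a k) * (h ^ (n - k) * b (n - k)%nat))%C n)).
    intros n. unfold cf. rewrite <- sum_n_Cscal. apply sum_n_ext_loc. intros k Hk.
    replace n with (k + (n - k))%nat at 3 by lia. rewrite Cpow_add_r. toC. ring.
    exact (Cser_mult (fun k => h ^ k * a k)%C (fun k => h ^ k * b k)%C _ _ H1 K1 H2 K2). }
  exists cf, (Rmin r s). split. apply Rmin_pos; auto. intros h Hh. split. auto.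
  apply (Cser_abs_inside cf (Rmin r s)); auto. apply Rmin_pos; auto. intros h' Hh'. eexists; apply A; auto.
Qed.

(** The coefficient of h^j in (z0 + h)^m, by Pascal's recurrence; this avoids the binomial
    formula, and taking moduli in the recurrence bounds all partial sums by
    (|z0| + |h|)^m. *)
Fixpoint tcoef (z0 : C) (m j : nat) : C := match m with
  | O => match j with O => 1%C | _ => 0%C end
  | S m' => (z0 * tcoef z0 m' j + match j with O => 0 | S j' => tcoef z0 m' j' end)%C end.

Lemma tcoef_sum_S z0 m h N : csum (fun j => h ^ (pred j) * tcoef z0 (S m) (pred j))%C (S N) =
  (z0 * csum (fun j => h ^ (pred j) * tcoef z0 m (pred j)) (S N) + h * csum (fun j => h ^ (pred j) * tcoef z0 m (pred j)) N)%C.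
Proof.
  induction N. simpl. ring.
  change (csum (fun j => h ^ pred j * tcoef z0 (S m) (pred j))%C (S (S N))) with
   (csum (fun j => h ^ pred j * tcoef z0 (S m) (pred j))%C (S N) + h ^ (S N) * (z0 * tcoef z0 m (S N) + tcoef z0 m N))%C.
  rewrite IHN. simpl. ring.
Qed.
Lemma tcoef_sum z0 h m : forall N, (m <= N)%nat -> csum (fun j => h ^ (pred j) * tcoef z0 m (pred j))%C (S N) = ((z0 + h) ^ m)%C.
Proof.
  induction m; intros N HN.
  - induction N. simpl. ring. transitivity (csum (fun j => h ^ (pred j) * tcoef z0 0 (pred j))%C (S N) + h ^ (S N) * 0)%C. reflexivity.
    rewrite IHN by lia. ring.
  - rewrite tcoef_sum_S. destruct N. lia. rewrite !IHm by lia. simpl. ring.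
Qed.
Lemma tcoef_bound z0 h m : forall N, Cmod (csum (fun j => h ^ (pred j) * tcoef z0 m (pred j))%C N) <= (Cmod z0 + Cmod h) ^ m.
Proof.
  generalize (Cmod_ge_0 z0) (Cmod_ge_0 h). intros Hz Hh.
  induction m; intros N.
  - destruct N. simpl. rewrite Cmod_0; lra. rewrite tcoef_sum by lia. simpl. rewrite Cmod_1; lra.
  - destruct N. simpl. rewrite Cmod_0. apply Rmult_le_pos. lra. apply pow_le; lra.
    rewrite tcoef_sum_S. eapply Rle_trans. apply Cmod_triangle. rewrite !Cmod_mult. simpl pow. rewrite Rmult_plus_distr_r.
    apply Rplus_le_compat; apply Rmult_le_compat_l; auto.
Qed.

Lemma Re_csum w n : Re (csum w n) = rsum (fun k => Re (w k)) n.
Proof. induction n; simpl; auto. rewrite <- IHn. reflexivity. Qed.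
Lemma Im_csum w n : Im (csum w n) = rsum (fun k => Im (w k)) n.
Proof. induction n; simpl; auto. rewrite <- IHn. reflexivity. Qed.
Lemma sum_n_rsum (a : nat -> R) m : sum_n a m = rsum (fun k => a (pred k)) (S m).
Proof. induction m. rewrite sum_O. simpl; toR; ring. rewrite sum_Sn, IHm. reflexivity. Qed.

Lemma Cser_csum (u : nat -> nat -> C) (l : nat -> C) N : (forall j, Cser (fun m => u m j) (l j)) ->
  Cser (fun m => csum (u m) N) (csum l N).
Proof.
  intros Hu. induction N; simpl. split; simpl. apply (is_series_single (fun _ => 0)); auto. apply (is_series_single (fun _ => 0)); auto.
  apply Cser_plus; auto.
Qed.

(** Recentring at z0.  The partial sums in h of the rearranged series are, term by term
    in m, eventually equal to c_m (z0 + h)^m and bounded by |c_m| (|z0| + |h|)^m, so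
    [tannery] applies. *)
Lemma analytic_entire (c : nat -> C) (f : C -> C) : (forall r, 0 <= r -> ex_series (fun n => Cmod (c n) * r ^ n)) ->
  (forall z, Cser (fun n => c n * z ^ n)%C (f z)) -> forall z0, analytic f z0.
Proof.
  intros Hc Hf z0.
  set (b := fun j => Csum (fun m => c m * tcoef z0 m j)%C).
  assert (Tb : forall m j, Cmod (tcoef z0 m j) <= 2 * (Cmod z0 + 1) ^ m).
  { intros m j.
    assert (E : tcoef z0 m j = (csum (fun j => 1 ^ (pred j) * tcoef z0 m (pred j)) (S j) - csum (fun j => 1 ^ (pred j) * tcoef z0 m (pred j)) j)%C).
    { simpl csum. rewrite Cpow_1_l. simpl pred. ring. }
    rewrite E. eapply Rle_trans. apply Cmod_triangle. rewrite Cmod_opp.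
    generalize (tcoef_bound z0 1%C m (S j)) (tcoef_bound z0 1%C m j). rewrite Cmod_1. lra. }
  assert (Bj : forall j, Cser (fun m => c m * tcoef z0 m j)%C (b j)).
  { intros j. apply Cser_of_abs. apply (ex_series_le_R _ (fun m => 2 * (Cmod (c m) * (Cmod z0 + 1) ^ m))).
    intros m. rewrite Rabs_pos_eq, Cmod_mult by apply Cmod_ge_0. generalize (Tb m j) (Cmod_ge_0 (c m)). nra.
    apply ex_series_scal_R. apply Hc. generalize (Cmod_ge_0 z0); lra. }
  assert (A : forall h : C, Cser (fun n => h ^ n * b n)%C (f (z0 + h)%C)).
  { intros h.
    set (B := fun N m => (c m * csum (fun j => h ^ (pred j) * tcoef z0 m (pred j)) N)%C).
    set (M := fun m => Cmod (c m) * (Cmod z0 + Cmod h) ^ m).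
    assert (HM : ex_series M). { apply Hc. generalize (Cmod_ge_0 z0) (Cmod_ge_0 h); lra. }
    assert (BM : forall N m, Cmod (B N m) <= M m).
    { intros N m. unfold B, M. rewrite Cmod_mult. apply Rmult_le_compat_l. apply Cmod_ge_0. apply tcoef_bound. }
    assert (BN : forall N, Cser (B N) (csum (fun j => h ^ (pred j) * b (pred j))%C N)).
    { intros N. apply (Cser_ext (fun m => csum (fun j => h ^ (pred j) * (c m * tcoef z0 m (pred j)))%C N)).
      intros m. unfold B. rewrite <- csum_scal. apply csum_ext. intros; ring.
      apply (Cser_csum (fun m j => h ^ (pred j) * (c m * tcoef z0 m (pred j)))%C). intros j. apply Cser_scal. apply Bj. }
    assert (BL : forall m, exists N0, forall N, (N0 <= N)%nat -> B N m = (c m * (z0 + h) ^ m)%C).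
    { intros m. exists (S m). intros N HN. unfold B. destruct N. lia. rewrite tcoef_sum by lia. auto. }
    assert (G : forall p : C -> R, (forall z, Rabs (p z) <= Cmod z) -> is_lim_seq (fun N => Series (fun m => p (B N m))) (Series (fun m => p (c m * (z0 + h) ^ m)%C))).
    { intros p Hp. apply (tannery (fun N m => p (B N m)) _ M); auto. intros; eapply Rle_trans; [apply Hp|apply BM].
      intros m. destruct (BL m) as [N0 HN0]. apply (is_lim_seq_ext_loc (fun _ => p (c m * (z0 + h) ^ m)%C)). exists N0. intros N HN; rewrite HN0; auto. apply is_lim_seq_const. }
    destruct (Hf (z0 + h)%C) as [F1 F2].
    split.
    - change (is_lim_seq (sum_n (fun n => Re (h ^ n * b n)%C)) (Re (f (z0 + h)%C))).
      rewrite <- (is_series_unique _ _ F1). apply (is_lim_seq_ext (fun N => Series (fun m => Re (B (S N) m)))).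
      intros N. rewrite (is_series_unique _ _ (proj1 (BN (S N)))). rewrite sum_n_rsum, Re_csum. auto.
      apply (is_lim_seq_incr_1 (fun N => Series (fun m => Re (B N m)))). apply (G Re), re_le_Cmod.
    - change (is_lim_seq (sum_n (fun n => Im (h ^ n * b n)%C)) (Im (f (z0 + h)%C))).
      rewrite <- (is_series_unique _ _ F2). apply (is_lim_seq_ext (fun N => Series (fun m => Im (B (S N) m)))).
      intros N. rewrite (is_series_unique _ _ (proj2 (BN (S N)))). rewrite sum_n_rsum, Im_csum. auto.
      apply (is_lim_seq_incr_1 (fun N => Series (fun m => Im (B N m)))). apply (G Im), im_le_Cmod. }
  exists b, 1. split. lra. intros h Hh. split; auto.
  apply (Cser_abs_inside b 1); auto. lra. intros h' _. eexists; apply A.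
Qed.

(** * The principal logarithm *)

Lemma Cln_Re z : Re (Cln z) = ln (Cmod z).
Proof. reflexivity. Qed.
Lemma ln_Cmod (z : C) : z <> 0%C -> ln (Cmod z) = / 2 * ln (Re z ^ 2 + Im z ^ 2).
Proof.
  intros Hz. assert (0 < Cmod z) by (apply Cmod_gt_0; auto). rewrite <- Cmod_sqr. simpl. rewrite Rmult_1_r, ln_mult by auto. field.
Qed.
Lemma Cmod_factor_im (x y : R) : y <> 0 -> Cmod (x, y) = Rabs y * sqrt (1 + (x / y)²).
Proof.
  intros Hy. unfold Cmod; simpl. rewrite <- (sqrt_Rsqr_abs y), <- sqrt_mult_alt by apply Rle_0_sqr. f_equal. unfold Rsqr. field. auto.
Qed.
Lemma Cmod_factor_re (x y : R) : x <> 0 -> Cmod (x, y) = Rabs x * sqrt (1 + (y / x)²).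
Proof.
  intros Hy. unfold Cmod; simpl. rewrite <- (sqrt_Rsqr_abs x), <- sqrt_mult_alt by apply Rle_0_sqr. f_equal. unfold Rsqr. field. auto.
Qed.
Lemma sqrt_1_sqr_pos q : 0 < sqrt (1 + q²).
Proof. apply sqrt_lt_R0. generalize (Rle_0_sqr q). lra. Qed.

Lemma Carg_right (x y : R) : 0 < x -> Carg (x, y) = atan (y / x).
Proof.
  intros Hx. unfold Carg. rewrite Cmod_factor_re, Rabs_pos_eq by lra. simpl.
  generalize (sqrt_1_sqr_pos (y / x)). intros Hs.
  replace (x / (x * sqrt (1 + (y / x)²))) with (cos (atan (y / x))). 2:{ rewrite cos_atan. field. lra. }
  generalize (atan_bound (y / x)). intros B.
  destruct (Rle_dec 0 y).
  - apply acos_cos. split; [|lra]. rewrite <- atan_0.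
    destruct (Rle_lt_or_eq_dec 0 (y / x)). apply Rdiv_le_0_compat; lra. left; apply atan_increasing; auto. rewrite <- e; lra.
  - rewrite <- cos_neg, acos_cos. ring. assert (atan (y / x) < 0). { rewrite <- atan_0. apply atan_increasing.
    apply Rlt_div_l; lra. } lra.
Qed.
Lemma Carg_up (x y : R) : 0 < y -> Carg (x, y) = PI / 2 - atan (x / y).
Proof.
  intros Hy. unfold Carg. rewrite Cmod_factor_im, Rabs_pos_eq by lra. simpl. destruct (Rle_dec 0 y); [|lra].
  generalize (sqrt_1_sqr_pos (x / y)). intros Hs. generalize (atan_bound (x / y)). intros B.
  replace (x / (y * sqrt (1 + (x / y)²))) with (cos (PI / 2 - atan (x / y))). 2:{ rewrite cos_shift, sin_atan. field. lra. }
  apply acos_cos. lra.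
Qed.
Lemma Carg_down (x y : R) : y < 0 -> Carg (x, y) = - (PI / 2) - atan (x / y).
Proof.
  intros Hy. unfold Carg. rewrite Cmod_factor_im, Rabs_left by lra. simpl. destruct (Rle_dec 0 y); [lra|].
  generalize (sqrt_1_sqr_pos (x / y)). intros Hs. generalize (atan_bound (x / y)). intros B.
  replace (x / (- y * sqrt (1 + (x / y)²))) with (cos (PI / 2 - - atan (x / y))).
  2:{ rewrite cos_shift, sin_neg, sin_atan. field. lra. }
  rewrite acos_cos. ring. lra.
Qed.

Lemma Cln_deriv_re (x y p q s : R) : (x + s * p) ^ 2 + (y + s * q) ^ 2 <> 0 ->
  is_derive (fun s => / 2 * ln ((x + s * p) ^ 2 + (y + s * q) ^ 2)) s (Re ((p, q) / (x + s * p, y + s * q)%R)%C).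
Proof.
  intros Hn. assert (0 < (x + s * p) ^ 2 + (y + s * q) ^ 2) by (generalize (pow2_ge_0 (x + s * p)) (pow2_ge_0 (y + s * q)); lra).
  auto_derive. simpl in *; lra. unfold Cdiv, Cinv, Re; simpl. field. simpl in *; lra.
Qed.

(** The half-planes Re > 0, Im > 0 and Im < 0 cover the slit plane, and on each of them
    the argument is an arctangent up to a constant.  This avoids differentiating the
    arc cosine, which fails on the positive half-line. *)
Lemma Cln_segment z0 : slit_plane z0 -> exists r, 0 < r /\ r <= Cmod z0 /\ forall h : C, Cmod h < r ->
  exists phi : R -> R, (forall s, 0 <= s <= 1 -> Carg (z0 + s * h)%C = phi s /\ is_derive phi s (Im (h / (z0 + s * h))%C)).
Proof.
  intros Hz. destruct z0 as [x y]. unfold slit_plane, Re, Im in Hz; simpl in Hz.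
  assert (EQ : forall p q s : R, ((x, y) + s * (p, q))%C = ((x + s * p)%R, (y + s * q)%R)).
  { intros. unfold Cplus, Cmult; simpl. f_equal; ring. }
  assert (AB : forall u s r, 0 <= s <= 1 -> Rabs u < r -> - r < s * u < r).
  { intros u s r Hs Hu. apply Rabs_lt_between in Hu. split; nra. }
  destruct (Rlt_dec 0 y) as [Hy|Hy]; [|destruct (Rlt_dec y 0) as [Hy'|Hy']].
  - exists y. split; [auto|split]. eapply Rle_trans; [|apply (im_le_Cmod (x, y))]. apply Rle_abs.
    intros [p q] Hh. exists (fun s => PI / 2 - atan ((x + s * p) / (y + s * q))). intros s Hs.
    assert (Hq : Rabs q < y) by (eapply Rle_lt_trans; [apply (im_le_Cmod (p, q))|auto]).
    assert (B := AB q s y Hs Hq). rewrite EQ. split. apply Carg_up; lra.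
    auto_derive. lra. unfold Cdiv, Cinv, Im; simpl. field. split; [|lra].
    assert (0 < (y + s * q) ^ 2) by (apply pow_lt; lra). generalize (pow2_ge_0 (x + s * p)). simpl in *. lra.
  - exists (- y). split; [lra|split]. eapply Rle_trans; [|apply (im_le_Cmod (x, y))]. simpl. rewrite <- Rabs_Ropp. apply Rle_abs.
    intros [p q] Hh. exists (fun s => - (PI / 2) - atan ((x + s * p) / (y + s * q))). intros s Hs.
    assert (Hq : Rabs q < - y) by (eapply Rle_lt_trans; [apply (im_le_Cmod (p, q))|auto]).
    assert (B := AB q s (- y) Hs Hq). rewrite EQ. split. apply Carg_down; lra.
    auto_derive. lra. unfold Cdiv, Cinv, Im; simpl. field. split; [|lra].
    assert (0 < (y + s * q) ^ 2) by (apply pow2_gt_0; lra). generalize (pow2_ge_0 (x + s * p)). simpl in *. lra.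
  - assert (Hx : 0 < x). { destruct (Rlt_dec 0 x); auto. exfalso. apply Hz. lra. }
    exists x. split; [auto|split]. eapply Rle_trans; [|apply (re_le_Cmod (x, y))]. apply Rle_abs.
    intros [p q] Hh. exists (fun s => atan ((y + s * q) / (x + s * p))). intros s Hs.
    assert (Hq : Rabs p < x) by (eapply Rle_lt_trans; [apply (re_le_Cmod (p, q))|auto]).
    assert (B := AB p s x Hs Hq). rewrite EQ. split. apply Carg_right; lra.
    auto_derive. lra. unfold Cdiv, Cinv, Im; simpl. field. split; [|lra].
    assert (0 < (x + s * p) ^ 2) by (apply pow_lt; lra). generalize (pow2_ge_0 (y + s * q)). simpl in *. lra.
Qed.

Lemma Cser_shift u l : Cser u l -> Cser (fun n => u (S n)) (l - u 0%nat)%C.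
Proof.
  intros [H1 H2]. split.
  apply (is_series_incr_1 (V := R_NormedModule) (fun n => Re (u n))).
  replace (plus _ _) with (Re l). auto. unfold plus, Re; simpl. toR; ring.
  apply (is_series_incr_1 (V := R_NormedModule) (fun n => Im (u n))).
  replace (plus _ _) with (Im l). auto. unfold plus, Im; simpl. toR; ring.
Qed.

Lemma Cser_geom (q : C) : Cmod q < 1 -> Cser (fun n => q ^ n)%C (/ (1 - q))%C.
Proof.
  intros Hq.
  assert (E : ex_series (fun n => Cmod (q ^ n)%C)).
  { apply (ex_series_ext (fun n => Cmod q ^ n)). intros; rewrite Cmod_pow; auto. apply ex_series_geom. rewrite Rabs_pos_eq; auto. apply Cmod_ge_0. }
  assert (H1 := Cser_of_abs _ E). set (S := Csum _) in *.
  assert (H2 := Cser_scal q _ _ H1). assert (H3 := Cser_shift _ _ H1). simpl in H3.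
  assert (H4 := Cser_unique _ _ _ H2 H3).
  assert (N : (1 - q)%C <> 0%C). { intros N. assert (q = 1%C). { replace q with (1 - (1 - q))%C by ring. rewrite N. ring. } subst q. rewrite Cmod_1 in Hq. lra. }
  replace (/ (1 - q))%C with S; auto. transitivity ((S - q * S) / (1 - q))%C. field; auto. rewrite H4. field. auto.
Qed.

(** Both components of Log along a segment have the same derivative as the corresponding
    component of the logarithmic series, namely that of the geometric series, so they
    agree.  The projection p is the real or the imaginary part. *)
Lemma log_series (p : C -> R) (w : C) (phi : R -> R) :
  (forall z, Rabs (p z) <= Cmod z) -> (forall (r : R) z, p (r * z)%C = r * p z) ->
  (forall u l, Cser u l -> is_series (fun n => p (u n)) (p l)) -> Cmod w < 1 ->
  (forall s, 0 <= s <= 1 -> is_derive phi s (p (w / (1 + s * w))%C)) ->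
  is_series (fun n => match n with O => phi 0 | S m => (-1) ^ m / INR (S m) * p (w ^ S m)%C end) (phi 1).
Proof.
  intros Hp Hl Hs Hw Hd.
  set (al := fun n => match n with O => phi 0 | S m => (-1) ^ m / INR (S m) * p (w ^ S m)%C end).
  generalize (Cmod_ge_0 w). intros Hw0.
  (* any number between 1 and 1 / |w| would do; this one also makes sense for w = 0 *)
  set (rr := 2 / (1 + Cmod w)).
  assert (Hrr : 1 < rr). { unfold rr. apply Rlt_div_r; lra. }
  assert (Habs : forall n, Rabs (al (S n)) <= Cmod w ^ S n).
  { intros n. unfold al. rewrite Rabs_mult. assert (Rabs ((-1) ^ n / INR (S n)) <= 1).
    { unfold Rdiv. rewrite Rabs_mult, pow_1_abs, Rmult_1_l. rewrite Rabs_pos_eq.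
      rewrite <- Rinv_1. apply Rinv_le_contravar. lra. rewrite S_INR; generalize (pos_INR n); lra. left; apply Rinv_0_lt_compat, lt_0_INR; lia. }
    specialize (Hp (w ^ S n)%C). rewrite Cmod_pow in Hp. generalize (Rabs_pos (p (w ^ S n)%C)). nra. }
  assert (CV : Rbar_lt 1 (CV_radius al)).
  { apply (Rbar_lt_le_trans 1 rr); auto. destruct (CV_radius_bounded al) as [ub _]. apply ub.
    exists (Rmax (Rabs (al 0%nat)) 1). intros [|n].
    - simpl pow. rewrite Rmult_1_r. apply Rmax_l.
    - rewrite Rabs_mult. eapply Rle_trans; [|apply Rmax_r]. rewrite <- RPow_abs, (Rabs_pos_eq rr) by lra.
      apply (Rle_trans _ (Cmod w ^ S n * rr ^ S n)). apply Rmult_le_compat_r; auto. apply pow_le; lra.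
      rewrite <- Rpow_mult_distr. rewrite <- (pow1 (S n)). apply pow_incr. split. nra. unfold rr.
      replace (Cmod w * (2 / (1 + Cmod w))) with (2 * Cmod w / (1 + Cmod w)) by (field; lra). apply Rle_div_l; lra. }
  assert (CVs : forall s, 0 <= s <= 1 -> Rbar_lt (Rabs s) (CV_radius al)).
  { intros s Hs1. rewrite Rabs_pos_eq by lra. eapply Rbar_le_lt_trans; [|apply CV]. simpl; lra. }
  assert (DP : forall s, 0 <= s <= 1 -> PSeries (PS_derive al) s = p (w / (1 + s * w))%C).
  { intros s Hs1. unfold PSeries. apply is_series_unique.
    assert (Hq : Cmod (- (s * w))%C < 1). { rewrite Cmod_opp, Cmod_mult, Cmod_R, Rabs_pos_eq by lra. nra. }
    assert (G := Cser_scal w _ _ (Cser_geom _ Hq)). apply Hs in G.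
    replace (w * / (1 - - (s * w)))%C with (w / (1 + s * w))%C in G by (unfold Cdiv; do 2 f_equal; ring).
    refine (is_series_ext _ _ _ _ G). intros n. unfold PS_derive, al.
    replace (w * (- (s * w)) ^ n)%C with (RtoC ((-1) ^ n * s ^ n) * w ^ S n)%C.
    2:{ rewrite RtoC_mult, !RtoC_pow. replace (- (s * w))%C with ((-1) * s * w)%C by ring. rewrite !Cpow_mult_l. simpl. ring. }
    rewrite Hl. toR. field. apply not_0_INR; lia. }
  assert (E : phi 1 - PSeries al 1 = phi 0 - PSeries al 0).
  { destruct (MVT_gen (fun s => phi s - PSeries al s) 0 1 (fun _ => 0)) as [c [Hc1 Hc2]].
    - rewrite Rmin_left, Rmax_right by lra. intros s Hs1.
      assert (D := is_derive_minus (V := R_NormedModule) _ _ s _ _ (Hd s ltac:(lra)) (is_derive_PSeries al s (CVs s ltac:(lra)))).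
      rewrite DP in D by lra. replace 0 with (minus (p (w / (1 + s * w))%C) (p (w / (1 + s * w))%C)). exact D.
      unfold minus, plus, opp; simpl. ring.
    - rewrite Rmin_left, Rmax_right by lra. intros s Hs1. apply continuity_pt_filterlim.
      assert (D := is_derive_minus (V := R_NormedModule) _ _ s _ _ (Hd s ltac:(lra)) (is_derive_PSeries al s (CVs s ltac:(lra)))).
      apply (ex_derive_continuous (V := R_NormedModule) (fun s => phi s - PSeries al s)). eexists; exact D.
    - lra. }
  rewrite PSeries_0 in E. replace (al 0%nat) with (phi 0) in E by reflexivity.
  replace (phi 1) with (PSeries al 1) by lra. unfold PSeries.
  assert (Ex : ex_series (fun n => al n * 1 ^ n)).
  { apply ex_series_Rabs. apply CV_disk_inside. rewrite Rabs_R1. exact CV. }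
  apply (is_series_ext (fun n => al n * 1 ^ n)). intros; rewrite pow1, Rmult_1_r; reflexivity. apply Series_correct; auto.
Qed.

Lemma analytic_Cln z0 : slit_plane z0 -> analytic Cln z0.
Proof.
  intros Hz. destruct (Cln_segment z0 Hz) as [r [Hr [Hrz Hseg]]].
  assert (Z0 : z0 <> 0%C). { intros ->. rewrite Cmod_0 in Hrz. lra. }
  set (a := fun n => match n with O => Cln z0 | S m => RtoC ((-1) ^ m / INR (S m)) * / z0 ^ S m end%C).
  assert (A : forall h : C, Cmod h < r -> Cser (fun n => h ^ n * a n)%C (Cln (z0 + h))).
  { intros h Hh. destruct (Hseg h Hh) as [phi Hphi].
    assert (Nz : forall s : R, 0 <= s <= 1 -> (z0 + s * h)%C <> 0%C).
    { intros s Hs E. assert (z0 = (- (s * h))%C). { replace z0 with ((z0 + s * h) - s * h)%C by ring. rewrite E. ring. }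
      assert (Cmod z0 <= Cmod h). { rewrite H, Cmod_opp, Cmod_mult, Cmod_R, Rabs_pos_eq by lra. generalize (Cmod_ge_0 h); nra. } lra. }
    set (w := (h / z0)%C).
    assert (Hw : Cmod w < 1). { unfold w. rewrite Cmod_div by auto. apply Rlt_div_l. apply Cmod_gt_0; auto. lra. }
    assert (Ew : forall s : R, 0 <= s <= 1 -> (w / (1 + s * w))%C = (h / (z0 + s * h))%C).
    { intros s Hs. unfold w. field. auto. }
    assert (E1 : (z0 + 1 * h)%C = (z0 + h)%C) by ring. assert (E0 : (z0 + 0 * h)%C = z0) by ring.
    assert (TM : forall m, (h ^ S m * a (S m))%C = (RtoC ((-1) ^ m / INR (S m)) * w ^ S m)%C).
    { intros m. unfold a, w, Cdiv. rewrite Cpow_mult_l, Cpow_inv by auto. ring. }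
    split.
    - destruct z0 as [x y], h as [p q].
      assert (EQ : forall s : R, ((x, y) + s * (p, q))%C = ((x + s * p)%R, (y + s * q)%R)).
      { intros. unfold Cplus, Cmult; simpl. f_equal; ring. }
      set (psi := fun s => / 2 * ln ((x + s * p) ^ 2 + (y + s * q) ^ 2)).
      assert (Hpsi : forall s, 0 <= s <= 1 -> Re (Cln ((x, y) + s * (p, q))%C) = psi s).
      { intros s Hs. rewrite Cln_Re, ln_Cmod by (apply Nz; auto). rewrite EQ. reflexivity. }
      assert (L := log_series Re w psi re_le_Cmod Re_RtoC_mult (fun u l H => proj1 H) Hw).
      rewrite <- E1, Hpsi by lra. refine (is_series_ext _ _ _ _ (L _)).
      + intros [|m]. unfold a. rewrite <- Hpsi by lra. rewrite E0. f_equal. simpl. ring. rewrite TM, Re_RtoC_mult. reflexivity.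
      + intros s Hs. rewrite Ew by auto. rewrite EQ. apply Cln_deriv_re.
        specialize (Nz s Hs). rewrite EQ in Nz. intros E. apply Nz.
        generalize (pow2_ge_0 (x + s * p)) (pow2_ge_0 (y + s * q)). intros.
        assert (x + s * p = 0) by nra. assert (y + s * q = 0) by nra. rewrite H1, H2. reflexivity.
    - assert (L := log_series Im w phi im_le_Cmod Im_RtoC_mult (fun u l H => proj2 H) Hw).
      assert (P1 := proj1 (Hphi 1 ltac:(lra))). rewrite E1 in P1. assert (P0 := proj1 (Hphi 0 ltac:(lra))). rewrite E0 in P0.
      change (Im (Cln (z0 + h))) with (Carg (z0 + h)%C). rewrite P1. refine (is_series_ext _ _ _ _ (L _)).
      + intros [|m]. unfold a. rewrite <- P0. simpl. unfold Im; simpl. toR; ring. rewrite TM, Im_RtoC_mult. reflexivity.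
      + intros s Hs. rewrite Ew by auto. apply Hphi; auto. }
  exists a, r. split; auto. intros h Hh. split; auto. apply (Cser_abs_inside a r); auto. intros h' Hh'. eexists; apply A; auto.
Qed.

(** * The identity theorem *)

Lemma order_estimate (a : nat -> C) (r : R) n : 0 < r -> ex_series (fun k => Cmod (a k) * r ^ k) -> (forall k, (k < n)%nat -> a k = 0%C) ->
  exists B, 0 <= B /\ forall (h l : C), Cmod h <= r -> Cser (fun k => h ^ k * a k)%C l -> Cmod (l - h ^ n * a n)%C <= B * Cmod h ^ S n.
Proof.
  intros Hr Ex Ha.
  set (b := fun k => Cmod (a (S n + k)%nat) * r ^ k).
  assert (Eb : ex_series b).
  { apply (ex_series_incr_n (fun k => Cmod (a k) * r ^ k) (S n)) in Ex.
    apply (ex_series_ext (fun k => / r ^ S n * (Cmod (a (S n + k)%nat) * r ^ (S n + k)))).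
    intros k. unfold b. rewrite pow_add. assert (r ^ S n <> 0) by (apply pow_nonzero; lra). toR. field. auto.
    apply ex_series_scal_R. exact Ex. }
  assert (Pb : 0 <= Series b).
  { rewrite <- (Rmult_0_l (Series b)), <- Series_scal_l. apply Series_le; auto. intros k.
    assert (0 <= b k). { unfold b. apply Rmult_le_pos. apply Cmod_ge_0. apply pow_le; lra. } lra. }
  exists (2 * Series b). split. lra.
  intros h l Hh Hs.
  assert (Sh : forall m, (m <= n)%nat -> Cser (fun k => h ^ (m + k) * a (m + k)%nat)%C l).
  { induction m; intros Hm. exact Hs. specialize (IHm ltac:(lia)). apply Cser_shift in IHm. rewrite Nat.add_0_r, (Ha m) in IHm by lia.
    replace (l - h ^ m * 0)%C with l in IHm by ring.
    refine (Cser_ext _ _ _ _ IHm). intros k. rewrite <- plus_n_Sm. reflexivity. }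
  specialize (Sh n (le_n n)). apply Cser_shift in Sh. rewrite Nat.add_0_r in Sh.
  assert (Eb' : ex_series (fun k => Cmod h ^ S n * b k)) by (apply ex_series_scal_R; auto).
  assert (Q := Cser_Cmod_le _ _ (fun k => Cmod h ^ S n * b k) Sh Eb').
  rewrite Series_scal_l in Q. eapply Rle_trans. apply Q.
  - intros k. rewrite Cmod_mult, Cmod_pow, <- plus_n_Sm. change (S (n + k)) with (S n + k)%nat. rewrite pow_add, Rmult_assoc. apply Rmult_le_compat_l.
    apply pow_le, Cmod_ge_0. unfold b. rewrite Rmult_comm. apply Rmult_le_compat_l. apply Cmod_ge_0. apply pow_incr. split; auto. apply Cmod_ge_0.
  - right; ring.
Qed.

Lemma analytic_radius f z0 : analytic f z0 -> exists a r, 0 < r /\ ex_series (fun k => Cmod (a k) * r ^ k) /\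
  forall h : C, Cmod h <= r -> Cser (fun n => h ^ n * a n)%C (f (z0 + h)%C).
Proof.
  intros [a [r [Hr H]]]. exists a, (r / 2). split. lra. split.
  - destruct (H (RtoC (r / 2))) as [_ E]. rewrite Cmod_R, Rabs_pos_eq; lra.
    refine (ex_series_ext _ _ _ E). intros n. rewrite Cmod_mult, Cmod_pow, Cmod_R, Rabs_pos_eq by lra. apply Rmult_comm.
  - intros h Hh. apply H. lra.
Qed.

(** If all the coefficients before a_n vanish, a zero at z0 + h gives |a_n| <= B |h|; zeros
    at arbitrarily small h then force a_n = 0. *)
Lemma analytic_zeros d z0 : analytic d z0 -> (forall e, 0 < e -> exists h : C, 0 < Cmod h < e /\ d (z0 + h)%C = 0%C) ->
  exists r, 0 < r /\ forall h : C, Cmod h <= r -> d (z0 + h)%C = 0%C.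
Proof.
  intros A Hz. destruct (analytic_radius _ _ A) as [a [r [Hr [Ex H]]]]. exists r. split; auto.
  assert (Az : forall n k, (k < n)%nat -> a k = 0%C).
  { induction n; intros k Hk. lia. destruct (Nat.eq_dec k n) as [->|]; [|apply IHn; lia].
    destruct (order_estimate a r n Hr Ex IHn) as [B [HB Hest]].
    apply Cmod_eq_0. apply Rle_antisym; [|apply Cmod_ge_0]. apply le_epsilon. intros e He. rewrite Rplus_0_l.
    destruct (Hz (Rmin r (e / (B + 1)))) as [h [Hh Hd]]. apply Rmin_pos; auto. apply Rdiv_lt_0_compat; lra.
    assert (Hh1 := Rmin_l r (e / (B + 1))). assert (Hh2 := Rmin_r r (e / (B + 1))).
    specialize (Hest h _ ltac:(lra) (H h ltac:(lra))). rewrite Hd in Hest.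
    replace (0 - h ^ n * a n)%C with (- (h ^ n * a n))%C in Hest by ring. rewrite Cmod_opp, Cmod_mult, Cmod_pow in Hest.
    assert (P : 0 < Cmod h ^ n) by (apply pow_lt; lra).
    assert (Cmod (a n) <= B * Cmod h). { apply (Rmult_le_reg_l (Cmod h ^ n)); auto. simpl in Hest. lra. }
    assert (Cmod h * (B + 1) < e). { apply Rlt_div_r; lra. } nra. }
  intros h Hh. apply (Cser_unique (fun n => h ^ n * a n)%C). apply H; auto.
  apply (Cser_ext (fun _ => 0%C)). intros n. rewrite (Az (S n)) by lia. ring.
  split; apply (is_series_single (fun _ => 0)); auto.
Qed.

Lemma analytic_continuous f z0 : analytic f z0 -> forall e, 0 < e -> exists del, 0 < del /\ forall h : C, Cmod h < del -> Cmod (f (z0 + h) - f z0)%C < e.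
Proof.
  intros A e He. destruct (analytic_radius _ _ A) as [a [r [Hr [Ex H]]]].
  destruct (order_estimate a r 0 Hr Ex) as [B [HB Hest]]. lia.
  assert (E0 : f z0 = a 0%nat).
  { assert (Q := Hest 0%C (f (z0 + 0)%C) ltac:(rewrite Cmod_0; lra) (H 0%C ltac:(rewrite Cmod_0; lra))).
    rewrite Cmod_0 in Q. replace (z0 + 0)%C with z0 in Q by ring. simpl in Q. rewrite Rmult_0_l, Rmult_0_r in Q.
    assert (Z : Cmod (f z0 - 1 * a 0%nat)%C = 0) by (apply Rle_antisym; auto; apply Cmod_ge_0). apply Cmod_eq_0 in Z.
    transitivity ((f z0 - 1 * a 0%nat) + a 0%nat)%C. ring. rewrite Z. ring. }
  exists (Rmin r (e / (B + 1))). split. apply Rmin_pos; auto. apply Rdiv_lt_0_compat; lra.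
  intros h Hh. assert (Hh1 := Rmin_l r (e / (B + 1))). assert (Hh2 := Rmin_r r (e / (B + 1))).
  assert (Q := Hest h _ ltac:(lra) (H h ltac:(lra))). simpl in Q. rewrite Rmult_1_r in Q.
  rewrite E0. replace (f (z0 + h) - a 0%nat)%C with (f (z0 + h) - 1 * a 0%nat)%C by ring.
  assert (Cmod h * (B + 1) < e). { apply Rlt_div_r; lra. } generalize (Cmod_ge_0 h). nra.
Qed.

Lemma slit_segment z : slit_plane z -> forall s, 0 <= s <= 1 -> slit_plane (1 + s * (z - 1))%C.
Proof.
  intros Hz s Hs [H1 H2]. destruct z as [x y]. unfold slit_plane, Re, Im in *; simpl in *.
  assert (s * y = 0) by lra. assert (1 + s * (x - 1) <= 0) by lra.
  apply Rmult_integral in H. destruct H as [E|E]; subst. lra. apply Hz. split; auto. nra.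
Qed.

(** The slit plane is star-shaped about 1.  On the segment from 1 to z, consider the
    largest initial part on which d vanishes: its end point is a limit of zeros, so d
    vanishes on a disc around it and the part could be extended. *)
Theorem identity_theorem d : (forall z, slit_plane z -> analytic d z) -> (forall x : R, 0 < x -> d x = 0%C) ->
  forall z, slit_plane z -> d z = 0%C.
Proof.
  intros A H0 z Hz.
  destruct (Ceq_dec z 1%C) as [->|Hz1]. apply H0; lra.
  set (ga := fun s : R => (1 + s * (z - 1))%C).
  assert (Hne : 0 < Cmod (z - 1)%C). { apply Cmod_gt_0. intros E. apply Hz1. replace z with ((z - 1) + 1)%C by ring. rewrite E. ring. }
  set (Z := fun s => 0 <= s <= 1 /\ forall t, 0 <= t <= s -> d (ga t) = 0%C).
  assert (Z0 : Z 0). { split. lra. intros t Ht. replace t with 0 by lra. unfold ga. replace (1 + 0 * (z - 1))%C with (RtoC 1) by ring. apply H0; lra. }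
  destruct (completeness Z) as [s [ub lub]]. exists 1. intros s [Hs _]; lra. exists 0; auto.
  assert (Hs0 : 0 <= s) by (apply ub; auto). assert (Hs1 : s <= 1) by (apply lub; intros t [Ht _]; lra).
  assert (Hlt : forall t, 0 <= t < s -> d (ga t) = 0%C).
  { intros t Ht. destruct (classic (exists q, Z q /\ t < q)) as [[q [[Q1 Q2] Q3]]|Nex]. apply Q2; lra.
    exfalso. assert (s <= t). { apply lub. intros q Hq. apply Rnot_lt_le. intros Hlt. apply Nex. exists q; auto. } lra. }
  assert (Gd : forall t q : R, ga q = (ga t + (q - t)%R * (z - 1))%C). { intros. unfold ga. rewrite RtoC_minus. ring. }
  assert (Ball : exists r, 0 < r /\ forall h : C, Cmod h <= r -> d (ga s + h)%C = 0%C).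
  { apply analytic_zeros. apply A, slit_segment; auto. intros e He.
    destruct (Rlt_dec 0 s) as [Sp|Sn].
    - set (dl := Rmin s (e / Cmod (z - 1)%C) / 2). assert (Hm : 0 < Rmin s (e / Cmod (z - 1)%C)) by (apply Rmin_pos; auto; apply Rdiv_lt_0_compat; auto).
      assert (M1 := Rmin_l s (e / Cmod (z - 1)%C)). assert (M2 := Rmin_r s (e / Cmod (z - 1)%C)).
      exists ((s - dl - s)%R * (z - 1))%C. rewrite <- Gd. split; [|apply Hlt; unfold dl; lra].
      rewrite Cmod_mult, Cmod_R. replace (s - dl - s) with (- dl) by ring. rewrite Rabs_Ropp, Rabs_pos_eq by (unfold dl; lra).
      split. apply Rmult_lt_0_compat; auto; unfold dl; lra. apply Rlt_div_r; auto. unfold dl; lra.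
    - assert (s = 0) by lra. subst s. exists (RtoC (e / 2)). rewrite Cmod_R, Rabs_pos_eq by lra. split. lra.
      unfold ga. replace (1 + 0 * (z - 1) + (e / 2)%R)%C with (RtoC (1 + e / 2)) by (rewrite RtoC_plus; ring). apply H0; lra. }
  destruct Ball as [r [Hr Hball]].
  set (dl := r / Cmod (z - 1)%C). assert (Hdl : 0 < dl) by (apply Rdiv_lt_0_compat; auto).
  assert (Hup : forall t, 0 <= t <= s + dl -> d (ga t) = 0%C).
  { intros t Ht. destruct (Rlt_dec t s). apply Hlt; lra. rewrite (Gd s t). apply Hball.
    rewrite Cmod_mult, Cmod_R, Rabs_pos_eq by lra. replace r with (dl * Cmod (z - 1)%C) by (unfold dl; field; lra). apply Rmult_le_compat_r; lra. }
  assert (Hs : s = 1).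
  { apply Rle_antisym; auto. apply Rnot_lt_le. intros Hlt1.
    assert (Rmin 1 (s + dl) <= s). { apply ub. split. split. apply Rmin_glb; lra. apply Rmin_l. intros t Ht. apply Hup. generalize (Rmin_r 1 (s + dl)). lra. }
    unfold Rmin in H. destruct (Rle_dec 1 (s + dl)); lra. }
  replace z with (ga 1). apply Hup. lra. unfold ga. ring.
Qed.

(** * The G-function in closed form *)

Definition cP (n : nat) : C := match n with O => 0%C | S _ => RtoC (wcoef n) end.
Definition cQ (n : nat) : C := match n with O => 0%C | S _ => RtoC (wcoef n * (2 * euler_gamma - 2 * harm n - / INR n)) end.
Definition Pf (z : C) : C := Csum (fun n => cP n * z ^ n)%C.
Definition Qf (z : C) : C := Csum (fun n => cQ n * z ^ n)%C.

Lemma entire_wcoef (c : nat -> C) (b : nat -> R) A : c O = 0%C -> (forall k, c (S k) = RtoC (wcoef (S k) * b k)) ->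
  (forall k, Rabs (b k) <= A * 2 ^ k) -> forall r, 0 <= r -> ex_series (fun n => Cmod (c n) * r ^ n).
Proof.
  intros H0 Hc Hb r Hr. apply (ex_series_incr_1 (V := R_NormedModule) (fun n => Cmod (c n) * r ^ n)).
  apply (ex_series_ext (fun k => Rabs (r ^ S k * wcoef (S k) * b k))).
  - intros k. rewrite Hc, Cmod_R, !Rabs_mult, (Rabs_pos_eq (r ^ S k)) by (apply pow_le; auto). toR; ring.
  - apply (wcoef_series_abs b r A 2); auto. lra.
Qed.
Lemma cP_entire r : 0 <= r -> ex_series (fun n => Cmod (cP n) * r ^ n).
Proof.
  apply (entire_wcoef cP (fun _ => 1) 1); auto. intros; unfold cP; rewrite Rmult_1_r; auto.
  intros. rewrite Rabs_R1, Rmult_1_l. apply pow_R1_Rle. lra.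
Qed.
Lemma cQ_bound k : Rabs (2 * euler_gamma - 2 * harm (S k) - / INR (S k)) <= 5 * 2 ^ k.
Proof.
  generalize euler_gamma_bounds (harm_bounds (S k)) (INR_le_pow2 k). intros.
  assert (I1 := inv_INR_S k).
  assert (1 <= 2 ^ k) by (apply pow_R1_Rle; lra). rewrite S_INR in *. apply Rabs_le. lra.
Qed.
Lemma cQ_entire r : 0 <= r -> ex_series (fun n => Cmod (cQ n) * r ^ n).
Proof.
  apply (entire_wcoef cQ (fun k => 2 * euler_gamma - 2 * harm (S k) - / INR (S k)) 5); auto.
  apply cQ_bound.
Qed.
Lemma Cser_entire c : (forall r, 0 <= r -> ex_series (fun n => Cmod (c n) * r ^ n)) -> forall z, Cser (fun n => c n * z ^ n)%C (Csum (fun n => c n * z ^ n)%C).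
Proof.
  intros Hc z. apply Cser_of_abs. apply (ex_series_ext (fun n => Cmod (c n) * Cmod z ^ n)).
  intros; rewrite Cmod_mult, Cmod_pow; auto. apply Hc. apply Cmod_ge_0.
Qed.
Lemma analytic_Pf z : analytic Pf z.
Proof. apply (analytic_entire cP). apply cP_entire. apply Cser_entire, cP_entire. Qed.
Lemma analytic_Qf z : analytic Qf z.
Proof. apply (analytic_entire cQ). apply cQ_entire. apply Cser_entire, cQ_entire. Qed.

Lemma Csum_real (c : nat -> C) (b : nat -> R) (x : R) : c O = 0%C -> (forall k, c (S k) = RtoC (b (S k))) ->
  Csum (fun n => c n * x ^ n)%C = RtoC (Series (fun j => x ^ S j * b (S j))).
Proof.
  intros H0 Hc. unfold Csum. match goal with |- _ = RtoC ?s => change (RtoC s) with ((s, 0) : C) end. refine (f_equal2 pair _ _).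
  - rewrite (Series_incr_1_aux (fun n => Re (c n * x ^ n)%C)).
    + apply Series_ext. intros k. rewrite Hc, <- RtoC_pow, <- RtoC_mult, Re_RtoC. ring.
    + rewrite H0, Cmult_0_l. reflexivity.
  - rewrite (Series_ext _ (fun _ => 0 * 0)). rewrite Series_scal_l. ring.
    intros [|k]. rewrite H0, Cmult_0_l. simpl; ring. rewrite Hc, <- RtoC_pow, <- RtoC_mult. simpl. ring.
Qed.

(** The choice of the logarithm is a parameter because two are needed: the principal one,
    and near the cut the one that is analytic across it and equal to the principal one
    above. *)
Definition Gbranch (L : C -> C) (z : C) : C :=
  (RtoC (/ 2) * ((2 * euler_gamma)%R + L z) * ((2 * euler_gamma)%R + L z) + (PI ^ 2 / 6)%R + L z * Pf z + Qf z)%C.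
Definition Gclosed := Gbranch Cln.
Lemma analytic_Gbranch L z : analytic L z -> analytic (Gbranch L) z.
Proof.
  intros HL. unfold Gbranch. assert (A := analytic_plus _ _ _ (analytic_const (RtoC (2 * euler_gamma)) z) HL).
  apply analytic_plus; [|apply analytic_Qf]. apply analytic_plus; [|apply analytic_mult; [exact HL|apply analytic_Pf]].
  apply analytic_plus; [|apply analytic_const]. apply analytic_mult; [|exact A]. apply analytic_mult; [apply analytic_const|exact A].
Qed.

Lemma ex_series_wcoef x b A : (forall k, Rabs (b k) <= A * 2 ^ k) -> ex_series (fun k => x ^ S k * wcoef (S k) * b k).
Proof. intros Hb. apply ex_series_Rabs. apply (wcoef_series_abs b x A 2); auto. lra. Qed.

Definition PfR (x : R) := Series (fun j => x ^ S j * wcoef (S j)).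
Definition QfR (x : R) := Series (fun j => x ^ S j * (wcoef (S j) * (2 * euler_gamma - 2 * harm (S j) - / INR (S j)))).
Lemma Pf_real (x : R) : Pf x = RtoC (PfR x).
Proof. apply Csum_real; auto. Qed.
Lemma Qf_real (x : R) : Qf x = RtoC (QfR x).
Proof. apply (Csum_real cQ (fun n => wcoef n * (2 * euler_gamma - 2 * harm n - / INR n))); auto. Qed.

Lemma one_le_pow2 k : Rabs 1 <= 1 * 2 ^ k.
Proof. rewrite Rabs_R1, Rmult_1_l. apply pow_R1_Rle. lra. Qed.
Lemma ex_PfR x : ex_series (fun j => x ^ S j * wcoef (S j)).
Proof.
  apply (ex_series_ext (fun j => x ^ S j * wcoef (S j) * (fun _ => 1) j)). intros; toR; ring.
  apply (ex_series_wcoef x (fun _ => 1) 1). apply one_le_pow2.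
Qed.
Lemma ex_QfR x : ex_series (fun j => x ^ S j * (wcoef (S j) * (2 * euler_gamma - 2 * harm (S j) - / INR (S j)))).
Proof.
  apply (ex_series_ext (fun j => x ^ S j * wcoef (S j) * (2 * euler_gamma - 2 * harm (S j) - / INR (S j)))). intros; toR; ring.
  apply (ex_series_wcoef x (fun j => 2 * euler_gamma - 2 * harm (S j) - / INR (S j)) 5). apply cQ_bound.
Qed.

Lemma Gclosed_pos x : 0 < x -> Gclosed x = RtoC (Gpos x).
Proof.
  intros Hx. unfold Gclosed, Gbranch. rewrite Cln_pos, Pf_real, Qf_real by auto.
  rewrite <- !RtoC_plus, <- !RtoC_mult, <- !RtoC_plus. f_equal. unfold Gpos.
  replace (Series (fun j => gterm (ln x) x (S j))) with (ln x * PfR x + QfR x). field.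
  unfold PfR, QfR. rewrite <- Series_scal_l, <- Series_plus. apply Series_ext. intros; unfold gterm; ring.
  apply ex_series_scal_R, ex_PfR. apply ex_QfR.
Qed.

Lemma analytic_neg f (z0 : C) : analytic f (- z0)%C -> analytic (fun z => f (- z)%C) z0.
Proof.
  intros [a [r [Hr H]]]. exists (fun n => (- (1)) ^ n * a n)%C, r. split; auto. intros h Hh.
  destruct (H (- h)%C) as [H1 H2]. rewrite Cmod_opp; auto.
  assert (E : forall n, ((- h) ^ n * a n)%C = (h ^ n * ((- (1)) ^ n * a n))%C).
  { intros n. replace (- h)%C with (h * - (1))%C by ring. rewrite Cpow_mult_l. ring. }
  split. replace (- (z0 + h))%C with (- z0 + - h)%C by ring. refine (Cser_ext _ _ _ _ H1). auto.
  refine (ex_series_ext _ _ _ H2). intros; rewrite E; auto.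
Qed.

(** The right-hand side is analytic across the negative half-line. *)
Lemma Cln_opp (z : C) : 0 < Im z \/ (Im z = 0 /\ Re z < 0) -> Cln z = (Cln (- z) + RtoC PI * Ci)%C.
Proof.
  intros Hz. unfold Cln. rewrite Cmod_opp. unfold RtoC, Cplus, Cmult, Ci; simpl. f_equal. ring.
  unfold Carg. rewrite Cmod_opp.
  assert (Hi : 0 <= Im z) by (destruct Hz; lra). destruct (Rle_dec 0 (Im z)); [|lra].
  replace (Re (- z)%C / Cmod z) with (- (Re z / Cmod z)) by (unfold Re, Rdiv; simpl; ring). rewrite (acos_opp (Re z / Cmod z)).
  change (Im (- z)%C) with (- Im z).
  destruct (Rle_dec 0 (- Im z)); [|ring].
  destruct Hz as [|[H1 H2]]. lra.
  assert (E : Re z / Cmod z = - (1)).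
  { destruct z as [x y]; simpl in *. subst y. change (Cmod (x, 0)) with (Cmod (RtoC x)). rewrite Cmod_R, Rabs_left by auto. field. lra. }
  rewrite E, acos_opp, acos_1. ring.
Qed.

Lemma Cplus_minus_cancel (a z : C) : (a + (z - a))%C = z.
Proof. ring. Qed.

Theorem Gclosed_is_meijerG c : c < 0 -> is_meijerG 3 0 [RtoC 1] [RtoC 0; RtoC 0; RtoC 0] c Gclosed.
Proof.
  intros Hc. split; [|split].
  - intros x Hx. rewrite Gclosed_pos by auto.
    replace (2 * PI * Ci * Gpos x)%C with ((0, 2 * PI * Gpos x) : C). apply mellin_barnes; auto.
    unfold Cmult, Ci, RtoC; simpl. f_equal; ring.
  - intros z Hz. apply analytic_iff. apply (analytic_Gbranch Cln), analytic_Cln; auto.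
  - intros x Hx.
    set (L := fun z => (Cln (- z) + RtoC PI * Ci)%C).
    assert (A : analytic (Gbranch L) x).
    { apply analytic_Gbranch. apply analytic_plus; [|apply analytic_const]. apply (analytic_neg Cln). apply analytic_Cln.
      intros [_ H]. rewrite <- RtoC_opp, Re_RtoC in H. lra. }
    assert (E : forall z : C, 0 < Im z \/ (Im z = 0 /\ Re z < 0) -> Gclosed z = Gbranch L z).
    { intros z Hz. unfold Gclosed, Gbranch, L. rewrite (Cln_opp z Hz). reflexivity. }
    intros P [eps HP]. unfold filtermap, within.
    destruct (analytic_continuous _ _ A eps (cond_pos eps)) as [del [Hdel HA]].
    assert (Hd2 : 0 < del / 2) by lra.
    exists (mkposreal _ Hd2). intros z [Hz1 Hz2] Him. apply HP.
    rewrite (E z), (E (RtoC x)); [|right; split; [reflexivity|exact Hx]|left; exact Him].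
    assert (Hz : Cmod (z - x)%C < del).
    { eapply Rle_lt_trans. apply Cmod_le_re_im. unfold ball in Hz1, Hz2; simpl in Hz1, Hz2; unfold AbsRing_ball, abs, minus, plus, opp in Hz1, Hz2; simpl in Hz1, Hz2.
      unfold Re, Im; simpl. lra. }
    assert (Q := HA (z - x)%C Hz). rewrite Cplus_minus_cancel in Q.
    split; unfold ball; simpl; unfold AbsRing_ball, abs, minus, plus, opp; simpl.
    eapply Rle_lt_trans; [|exact Q]. apply (re_le_Cmod (Gbranch L z - Gbranch L x)%C).
    eapply Rle_lt_trans; [|exact Q]. apply (im_le_Cmod (Gbranch L z - Gbranch L x)%C).
Qed.

Lemma is_RInt_gen_C_unique (f : R -> C) (l m : C) :
  is_RInt_gen (V := C_R_NormedModule) f (Rbar_locally m_infty) (Rbar_locally p_infty) l ->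
  is_RInt_gen (V := C_R_NormedModule) f (Rbar_locally m_infty) (Rbar_locally p_infty) m -> l = m.
Proof.
  intros Hl Hm. rewrite <- (is_RInt_gen_unique (V := C_R_CompleteNormedModule) _ _ Hl).
  exact (is_RInt_gen_unique (V := C_R_CompleteNormedModule) _ _ Hm).
Qed.

Lemma from_above_Ccv (g : C -> C) (x : R) : filterlim g (within (fun z : C => 0 < Im z) (locally (RtoC x))) (locally (g (RtoC x))) ->
  Ccv (fun n => g (x, / INR (S n))) (g x).
Proof.
  intros Hg. apply Ccv_of_Cmod. apply is_lim_seq_spec. intros eps.
  assert (He : 0 < eps / 2) by (generalize (cond_pos eps); lra).
  assert (Hl : locally (g x) (fun y : C => Cmod (y - g x)%C < eps)).
  { exists (mkposreal _ He). intros y [Y1 Y2]. unfold ball in Y1, Y2; simpl in Y1, Y2; unfold AbsRing_ball, abs, minus, plus, opp in Y1, Y2; simpl in Y1, Y2.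
    eapply Rle_lt_trans. apply Cmod_le_re_im. unfold Re, Im; simpl. lra. }
  destruct (Hg _ Hl) as [del Hdel].
  assert (L := is_lim_seq_inv_INR). apply (is_lim_seq_incr_1 (fun n => / INR n)) in L. apply is_lim_seq_spec in L. destruct (L del) as [N HN].
  exists N. intros n Hn. rewrite Rminus_0_r, Rabs_pos_eq by apply Cmod_ge_0. apply Hdel.
  - specialize (HN n Hn). rewrite Rminus_0_r in HN. split; unfold ball; simpl; unfold AbsRing_ball, abs, minus, plus, opp; simpl.
    replace (x + - x) with 0 by ring. rewrite Rabs_R0. apply cond_pos. rewrite Ropp_0, Rplus_0_r. exact HN.
  - simpl. apply Rinv_0_lt_compat. change (0 < INR (S n)). apply lt_0_INR; lia.
Qed.

Lemma Cmult_cancel_l (w a b : C) : w <> 0%C -> (w * a)%C = (w * b)%C -> a = b.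
Proof. intros Hw E. transitivity (/ w * (w * a))%C. field; auto. rewrite E. field; auto. Qed.

Theorem meijerG_unique m n a b c g1 g2 : is_meijerG m n a b c g1 -> is_meijerG m n a b c g2 -> forall x : R, x <> 0 -> g1 x = g2 x.
Proof.
  intros [I1 [A1 L1]] [I2 [A2 L2]].
  assert (Pos : forall x : R, 0 < x -> g1 x = g2 x).
  { intros x Hx. assert (U := is_RInt_gen_C_unique _ _ _ (I1 x Hx) (I2 x Hx)).
    assert (N : (2 * PI * Ci)%C <> 0%C).
    { apply Cmult_neq_0. apply Cmult_neq_0; apply RtoC_neq_0. lra. generalize PI_RGT_0; lra. intros E. inversion E. lra. }
    apply (Cmult_cancel_l (2 * PI * Ci)%C); auto. }
  assert (Sl : forall z, slit_plane z -> g1 z = g2 z).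
  { intros z Hz. assert (D := identity_theorem (fun z => g1 z + RtoC (-1) * g2 z)%C).
    assert (E : (g1 z + RtoC (-1) * g2 z)%C = 0%C).
    { apply D; auto. intros w Hw. apply analytic_plus. apply analytic_iff; auto. apply analytic_mult. apply analytic_const. apply analytic_iff; auto.
      intros x Hx. rewrite Pos by auto. ring. }
    transitivity ((g1 z + RtoC (-1) * g2 z) + g2 z)%C. ring. rewrite E. ring. }
  intros x Hx. destruct (Rlt_dec 0 x). auto.
  assert (Hx' : x < 0) by lra.
  assert (C1 := from_above_Ccv g1 x (L1 x Hx')). assert (C2 := from_above_Ccv g2 x (L2 x Hx')).
  apply (Ccv_unique _ _ _ C1). refine (Ccv_ext _ _ _ _ C2). intros k. symmetry. apply Sl. intros [H _].
  unfold Im in H. cbn [snd] in H. assert (0 < / INR (S k)) by (apply Rinv_0_lt_compat, lt_0_INR; lia). lra.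
Qed.

Corollary meijerG_value c (x : R) : c < 0 -> x <> 0 -> meijerG 3 0 [RtoC 1] [RtoC 0; RtoC 0; RtoC 0] c x = Gclosed x.
Proof.
  intros Hc Hx. apply (meijerG_unique 3 0 [RtoC 1] [RtoC 0; RtoC 0; RtoC 0] c); auto; [|apply Gclosed_is_meijerG; auto].
  unfold meijerG. apply (epsilon_spec (inhabits (fun _ : C => RtoC 0)) (is_meijerG 3 0 [RtoC 1] [RtoC 0; RtoC 0; RtoC 0] c)). exists Gclosed. apply Gclosed_is_meijerG; auto.
Qed.

(** * The formula *)

Lemma rising_1 k : rising 1 k = INR (fact k).
Proof. induction k. reflexivity. simpl rising. rewrite IHk, fact_simpl, mult_INR, S_INR. ring. Qed.
Lemma rising_2 k : rising 2 k = INR (fact (S k)).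
Proof. induction k. simpl. ring. simpl rising. rewrite IHk, (fact_simpl (S k)), mult_INR, !S_INR. ring. Qed.

Definition P2R (x : R) := Series (fun j => x ^ S j * (wcoef (S j) * / INR (S j))).
Lemma hyp_2F3 x : x * pFq [1; 1] [2; 2; 2] x = PfR x.
Proof.
  unfold pFq, PfR. rewrite <- Series_scal_l. apply Series_ext. intros k. simpl map. simpl fold_right. rewrite rising_1, rising_2.
  unfold wcoef. rewrite fact_simpl, mult_INR. generalize (INR_fact_neq_0 k) (INR_S_neq_0 k). intros. change (x ^ S k) with (x * x ^ k). field. auto.
Qed.
Lemma hyp_3F4 x : x * pFq [1; 1; 1] [2; 2; 2; 2] x = P2R x.
Proof.
  unfold pFq, P2R. rewrite <- Series_scal_l. apply Series_ext. intros k. simpl map. simpl fold_right. rewrite rising_1, rising_2.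
  unfold wcoef. rewrite fact_simpl, mult_INR. generalize (INR_fact_neq_0 k) (INR_S_neq_0 k). intros. change (x ^ S k) with (x * x ^ k). field. auto.
Qed.
Lemma inv_bound k : Rabs (/ INR (S k)) <= 1 * 2 ^ k.
Proof.
  assert (B := inv_INR_S k). assert (1 <= 2 ^ k) by (apply pow_R1_Rle; lra). rewrite Rabs_pos_eq; lra.
Qed.
Lemma QfR_eq x : QfR x = 2 * DWi x - P2R x.
Proof.
  unfold QfR, DWi, P2R. rewrite <- Series_scal_l, <- Series_minus. apply Series_ext. intros; ring.
  apply ex_series_scal_R. apply (ex_series_wcoef x (fun j => euler_gamma - harm (S j)) 2).
  intros k. eapply Rle_trans. apply gamma_harm_bound. generalize (INR_le_pow2 (S k)). simpl; lra.
  apply (ex_series_ext (fun j => x ^ S j * wcoef (S j) * / INR (S j))). intros; toR; ring.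
  apply (ex_series_wcoef x (fun j => / INR (S j)) 1). apply inv_bound.
Qed.

Theorem theorem3p6 (x c : R) (hx : x <> 0) (hc : c < 0) :
  ex_derive (fun beta : R => Wi 1 beta x) 1 /\
  RtoC (Derive (fun beta : R => Wi 1 beta x) 1) =
    (x / 2 * (pFq [1; 1; 1] [2; 2; 2; 2] x - Cln x * pFq [1; 1] [2; 2; 2] x)
     + / 2 * meijerG 3 0 [RtoC 1] [RtoC 0; RtoC 0; RtoC 0] c x
     - / 4 * Cln x * (Cln x + 4 * euler_gamma)
     - euler_gamma ^ 2 - PI ^ 2 / 12)%C.
Proof.
  split. eexists; apply Wi_derive.
  replace (Derive (fun beta : R => Wi 1 beta x) 1) with (DWi x) by (symmetry; apply is_derive_unique, Wi_derive).
  rewrite meijerG_value by auto.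
  unfold Gclosed, Gbranch. rewrite Pf_real, Qf_real, QfR_eq.
  replace (x / 2 * (pFq [1; 1; 1] [2; 2; 2; 2] x - Cln x * pFq [1; 1] [2; 2; 2] x))%C
    with (/ 2 * (RtoC (P2R x) - Cln x * RtoC (PfR x)))%C.
  2:{ rewrite <- hyp_2F3, <- hyp_3F4, !RtoC_mult. field. }
  rewrite !RtoC_minus, !RtoC_mult, RtoC_div, RtoC_inv, RtoC_pow by lra.
  set (L := Cln x). set (D := RtoC (DWi x)).
  field.
Qed.
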